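(* Let $r\ge1$ and let $(\pi:\mathcal X\to M,\ J,\ L)$ be a scale-invariant special K\''ahler (SK) geometry of rank $r$ over a connected complex manifold $M$ of dimension $r$ (the regular locus of a Coulomb branch). Suppose it is completely iso-split: for all $u$ in a dense open subset $M^\circ$ of $M$ there is an isogeny of complex tori (with no condition on polarizations) $f_u:X_u\to\tilde X_u=\tilde X^1_u\times\cdots\times\tilde X^r_u$ onto a product of $r$ one-dimensional complex tori, with $f_u$ locally on $M^\circ$ depending continuously on $u$. Then the SK geometry is isotrivial.
   Context: A polarized abelian variety (p.a.v.) of rank $r$ is a pair $(X,J)$ where $X=V/\Lambda$ is an $r$-dimensional complex torus and $J$ is a polarization, i.e. a non-degenerate integral skew-symmetric form on $\Lambda=H_1(X,\mathbb Z)$ that is the imaginary part of a positive-definite hermitian form on $V$. There is a basis $\{\alpha_i,\beta^i\}$ of $\Lambda$ in which $J=\begin{pmatrix}0&\Delta\\-\Delta&0\end{pmatrix}$, $\Delta=\mathrm{diag}(d_1,\dots,d_r)$ with positive integers $d_i\mid d_{i+1}$ (a symplectic basis), and a basis $\{\theta^i\}$ of holomorphic $1$-forms with $\int_{\alpha_i}\theta^j=\Delta^j_i$; then $\tau^{ij}=\int_{\beta^i}\theta^j$ is symmetric with positive-definite imaginary part and is called the modulus. An isogeny of complex tori is a surjective holomorphic group homomorphism with finite kernel. Continuous dependence of $f_u$ on $u$ means that the induced inclusions of lattices $H_1(X_u,\mathbb Z)\to H_1(\tilde X_u,\mathbb Z)$ are locally constant in $u$ and the tori $\tilde X_u$ form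 a holomorphic family; equivalently, locally the kernels of $f_u$ form a locally constant family of finite subgroups and the splitting of $H_1(\tilde X_u,\mathbb Z)$ into the rank-two lattices of the factors is locally constant. An SK geometry of rank $r$ over $M$ consists of a holomorphic family $\pi:\mathcal X\to M$ of $r$-dimensional complex tori $X_u=\pi^{-1}(u)$, a polarization $J$ on the fibers that is locally constant on the lattices $H_1(X_u,\mathbb Z)$, making each $(X_u,J)$ a p.a.v., and a closed non-degenerate holomorphic $(2,0)$-form $L$ on $\mathcal X$ whose restriction to each fiber vanishes. It is scale-invariant if there is a holomorphic local action $(\lambda,u)\mapsto\lambda\circ u$ of $\mathbb C^\times$ near the identity: every point of $M$ has a neighborhood $U$ and an $\epsilon>0$ such that $\lambda\circ u\in M$ is defined and holomorphic for $u\in U$, $\lambda\in B_\epsilon=\{|\lambda-1|<\epsilon\}$, with $1\circ u=u$, $\lambda\circ(\mu\circ u)=(\lambda\mu)\circ u$ whenever defined, and $\lambda\circ u\ne u$ for $\lambda\neq1$; and this action lifts to a holomorphic local action on $\mathcal X$ covering it that maps fibers $X_u\to X_{\lambda\circ u}$ by isomorphisms of p.a.v.s and satisfies $\lambda^*L=\lambda L$. The SK geometry is isotrivial if, on every contractible open subset $\mathcal C\subset M$, with respect to a locally constant symplectic basis of the fiber homology, the modulus $\tau^{ij}(u)$ is constant on $\mathcal C$ (equivalently, $\tau$ is locally constant on $M$). *)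

(* Defs.v *)
(* MathComp-Analysis, over an arbitrary R : realType; the complex numbers are
   R[i].  Vectors are rows: a linear map is v |-> v *m A. *)
From HB Require Import structures.
From mathcomp Require Import all_boot all_order all_algebra complex.
From mathcomp Require Import all_classical all_reals all_analysis.

Set Implicit Arguments.
Unset Strict Implicit.
Unset Printing Implicit Defensive.
Import Order.TTheory GRing.Theory Num.Theory numFieldNormedType.Exports.
Local Open Scope classical_set_scope.
Local Open Scope ring_scope.

(* R[i] itself carries no topological instance; seen as a numFieldType it gets
   the one attached to its norm, and with it 'rV[Cx R]_n is a normed space. *)
Definition Cx (R : realType) : numFieldType := R[i].

Section Defs.
Context {R : realType}.
Notation C := (Cx R).

(** * Holomorphic maps and complex manifolds *)

(* Continuously complex-differentiable on a neighbourhood of x ("u is C^1 and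
   du is complex linear"); [differentiable] is over the scalars C. *)
Definition holomorphic_at (V W : normedModType C) (f : V -> W) (x : V) : Prop :=
  \forall y \near x, differentiable f y /\
    forall v, {for y, continuous (fun t => 'd f t v)}.

Record cmanifold (n : nat) := CManifold {
  mcar :> topologicalType;
  m_hausdorff : hausdorff_space mcar;
  m_countable : @second_countable mcar;
  chart : Type;
  cdom : chart -> set mcar;
  cmap : chart -> mcar -> 'rV[C]_n;
  cinv : chart -> 'rV[C]_n -> mcar;
  cdom_cover : forall x, exists c, cdom c x;
  cdom_open : forall c, open (cdom c);
  cimg_open : forall c, open (cmap c @` cdom c);
  cmapK : forall c x, cdom c x -> cinv c (cmap c x) = x;
  cmap_continuous : forall c x, cdom c x -> {for x, continuous (cmap c)};
  cinv_continuous : forall c x, cdom c x ->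
    {for cmap c x, continuous (cinv c)};
  chart_change : forall c c' x, cdom c x -> cdom c' x ->
    holomorphic_at (cmap c' \o cinv c) (cmap c x) }.

(* q : D -> Y is holomorphic, D a subset of C^k. *)
Definition holo_into k n (Y : cmanifold n) (D : set 'rV[C]_k)
    (q : 'rV[C]_k -> Y) : Prop :=
  forall y, D y -> {for y, continuous q} /\
    forall c, cdom c (q y) -> holomorphic_at (cmap c \o q) y.

(* g : W -> V is holomorphic, W a subset of Y and V a normed space. *)
Definition holo_from n (Y : cmanifold n) (V : normedModType C) (W : set Y)
    (g : Y -> V) : Prop :=
  forall x, W x -> forall c, cdom c x -> holomorphic_at (g \o cinv c) (cmap c x).

Definition local_biholo n (Y : cmanifold n) (D : set 'rV[C]_n)
    (q : 'rV[C]_n -> Y) : Prop :=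
  holo_into D q /\
  forall y, D y -> exists (V : set 'rV[C]_n) (g : Y -> 'rV[C]_n),
    [/\ open V /\ V y, V `<=` D, open (q @` V), holo_from (q @` V) g
      & forall y', V y' -> g (q y') = y'].

(* A holomorphic (2,0)-form: in the chart c it is
   (v, w) |-> v *m form c y *m w^T. *)
Record hol2form n (Y : cmanifold n) := Hol2Form {
  form : chart Y -> 'rV[C]_n -> 'M[C]_n;
  form_skew : forall c x, cdom c x ->
    (form c (cmap c x))^T = - form c (cmap c x);
  form_holo : forall c x, cdom c x -> holomorphic_at (form c) (cmap c x);
  form_change : forall c c' x, cdom c x -> cdom c' x ->
    let A := 'J (cmap c' \o cinv c) (cmap c x) in
    form c (cmap c x) = A *m form c' (cmap c' x) *m A^T }.

Definition form_closed n (Y : cmanifold n) (L : hol2form Y) : Prop :=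
  forall c x, cdom c x -> forall i j k : 'I_n,
    let D (a b d : 'I_n) :=
      'D_(delta_mx 0 a : 'rV[C]_n) (fun y => form L c y b d) (cmap c x) in
    D i j k + D j k i + D k i j = 0.

Definition form_nondegenerate n (Y : cmanifold n) (L : hol2form Y) : Prop :=
  forall c x, cdom c x -> form L c (cmap c x) \in unitmx.

(* Pullback of L at y along q, for a chart c of Y at q y. *)
Definition form_pullback k n (Y : cmanifold n) (L : hol2form Y)
    (q : 'rV[C]_k -> Y) (c : chart Y) (y : 'rV[C]_k) : 'M[C]_k :=
  let A := 'J (cmap c \o q) y in A *m form L c (cmap c (q y)) *m A^T.

(** * Complex tori *)

(* The rows of B are an R-basis of C^n and a Z-basis of Lam. *)
Definition lattice_basis n (Lam : set 'rV[C]_n) (B : 'M[C]_(n + n, n)) : Prop :=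
  (forall a : 'rV[R]_(n + n),
      map_mx (fun t => t%:C%C : C) a *m B = 0 -> a = 0) /\
  Lam = [set map_mx intr m *m B | m in [set: 'rV[int]_(n + n)]].

Definition periods n (T : Type) (p : 'rV[C]_n -> T) : set 'rV[C]_n :=
  [set l | forall z, p (z + l) = p z].

(* p : V = C^n -> A presents the set A as the complex torus V / periods p; group
   law and complex structure of A are the quotient ones, and periods p is
   H_1(A, Z), a cycle being identified with the end point of its lift
   starting at 0. *)
Definition torus_cover n (T : Type) (A : set T) (p : 'rV[C]_n -> T) : Prop :=
  [/\ range p = A,
      forall z z', p z = p z' -> periods p (z' - z)
    & exists B, lattice_basis (periods p) B].

Record torus n := Torus {
  tcar :> Type;
  tcov : 'rV[C]_n -> tcar;
  tcovP : torus_cover [set: tcar] tcov }.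

Definition prod_cover r (E : 'I_r -> torus 1) (z : 'rV[C]_r) :
  forall i, E i := fun i => tcov (E i) (col i z).

(* Homomorphism between the groups presented by p and q. *)
Definition torus_morph n m (S T : Type) (p : 'rV[C]_n -> S)
    (q : 'rV[C]_m -> T) (f : S -> T) : Prop :=
  forall z w z' w', f (p z) = q z' -> f (p w) = q w' ->
    f (p (z + w)) = q (z' + w').

(* q being a local biholomorphism, f is holomorphic iff it lifts locally to
   holomorphic maps C^n -> C^m. *)
Definition torus_holo n m (S T : Type) (p : 'rV[C]_n -> S)
    (q : 'rV[C]_m -> T) (f : S -> T) : Prop :=
  forall z, exists h : 'rV[C]_n -> 'rV[C]_m,
    (\forall y \near z, f (p y) = q (h y)) /\ holomorphic_at h z.

Definition isogeny n m (S T : Type) (A : set S) (p : 'rV[C]_n -> S)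
    (B : set T) (q : 'rV[C]_m -> T) (f : S -> T) : Prop :=
  [/\ torus_holo p q f, torus_morph p q f, f @` A = B
    & finite_set [set x | A x /\ f x = q 0]].

(* F is the linear lift of f to the universal covers; restricted to periods p
   it is the map induced by f on H_1. *)
Definition lift_of n m (S T : Type) (p : 'rV[C]_n -> S) (q : 'rV[C]_m -> T)
    (f : S -> T) (F : 'M[C]_(n, m)) : Prop :=
  forall z, f (p z) = q (z *m F).

(** * Holomorphic families of tori *)

Definition frame_map m n N (M : cmanifold m) (Y : cmanifold N)
    (unif : M -> 'rV[C]_n -> Y) (G : M -> 'M[C]_n) (c : chart M)
    (y : 'rV[C]_(m + n)) : Y :=
  let u := cinv c (lsubmx y) in unif u (rsubmx y *m G u).

(* V_u, the universal cover of the fibre at u, is identified with C^n by a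
   basis chosen separately for each u.  G is a holomorphic frame of the bundle
   of the V_u over W if (u, z) |-> unif u (z *m G u) is locally biholomorphic
   on W x C^n. *)
Definition holo_frame m n (M : cmanifold m) (Y : cmanifold (m + n))
    (unif : M -> 'rV[C]_n -> Y) (W : set M) (G : M -> 'M[C]_n) : Prop :=
  (forall u, W u -> G u \in unitmx) /\
  forall c : chart M,
    local_biholo [set y | (cmap c @` (cdom c `&` W)) (lsubmx y)]
      (frame_map unif G c).

Record torus_family m (M : cmanifold m) (n : nat) := TorusFamily {
  total :> cmanifold (m + n);
  proj : total -> M;
  unif : M -> 'rV[C]_n -> total;
  fibre_torus : forall u, torus_cover (proj @^-1` [set u]) (unif u);
  family_local : forall u0, exists (W : set M) (G : M -> 'M[C]_n)
      (B : M -> 'M[C]_(n + n, n)),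
    [/\ open W /\ W u0, holo_frame unif W G,
        forall u, W u -> lattice_basis (periods (unif u)) (B u)
      & holo_from W (fun u => B u *m invmx (G u))] }.

(* H_1(X_u, Z). *)
Definition H1 m (M : cmanifold m) n (X : torus_family M n) (u : M) :
  set 'rV[C]_n := periods (@unif _ _ _ X u).

(* B is a locally constant basis of the fibre homology over the open set U: a
   basis of H1 X u for each u, continuous when read in a holomorphic frame. *)
Definition flat_frame m (M : cmanifold m) n (X : torus_family M n)
    (U : set M) (B : M -> 'M[C]_(n + n, n)) : Prop :=
  [/\ open U, forall u, U u -> lattice_basis (H1 X u) (B u)
    & forall u0, U u0 -> exists (W : set M) (G : M -> 'M[C]_n),
      [/\ open W /\ W u0, holo_frame (@unif _ _ _ X) W G
        & {for u0, continuous (fun u => B u *m invmx (G u))}]].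

(** * Special Kähler geometries *)

(* Hermitian forms are conjugate-linear in the first argument: with
   J (alpha_i) (beta_j) = d_i delta_ij it is this convention that makes the
   imaginary part of the modulus positive. *)
Definition hform n (H : 'M[C]_n) (v w : 'rV[C]_n) : C :=
  (map_mx (fun t : C => conjc t : C) v *m H *m w^T) 0 0.

(* J is a polarization of C^n / Lam; only its values on Lam matter. *)
Definition polarization n (Lam : set 'rV[C]_n)
    (J : 'rV[C]_n -> 'rV[C]_n -> int) : Prop :=
  [/\ forall l l' k, Lam l -> Lam l' -> Lam k -> J (l + l') k = J l k + J l' k,
      forall l k, Lam l -> Lam k -> J l k = - J k l,
      forall l, Lam l -> (forall k, Lam k -> J l k = 0) -> l = 0
    & exists H : 'M[C]_n,
      [/\ forall v w, hform H w v = conjc (hform H v w),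
          forall v, v != 0 -> 0 < hform H v v
        & forall l k, Lam l -> Lam k ->
            (J l k)%:~R = complex.Im (hform H l k)]].

Record SK_geometry r (M : cmanifold r) := SKGeometry {
  sk_fam :> torus_family M r;
  sk_J : M -> 'rV[C]_r -> 'rV[C]_r -> int;
  sk_L : hol2form sk_fam;
  sk_polarization : forall u, polarization (H1 sk_fam u) (sk_J u);
  sk_J_locally_constant : forall U B, flat_frame sk_fam U B ->
    forall u, U u -> forall i j, \forall v \near u,
      sk_J v (row i (B v)) (row j (B v)) = sk_J u (row i (B u)) (row j (B u));
  sk_closed : form_closed sk_L;
  sk_nondegenerate : form_nondegenerate sk_L;
  sk_fibre0 : forall u z c, cdom c (@unif _ _ _ sk_fam u z) ->
    form_pullback sk_L (@unif _ _ _ sk_fam u) c z = 0 }.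

(* (t, y) |-> act t y is holomorphic on { |t - 1| < e } x U. *)
Definition holo_action n (Y : cmanifold n) (act : C -> Y -> Y) (e : C)
    (U : set Y) : Prop :=
  forall c : chart Y,
    holo_into [set y : 'rV[C]_(1 + n) |
        `|lsubmx y 0 0 - 1| < e /\ (cmap c @` (cdom c `&` U)) (rsubmx y)]
      (fun y => act (lsubmx y 0 0) (cinv c (rsubmx y))).

(* dom t u : "t o u is defined"; the lift is then defined on the fibre at u.
   e ranges over C, where 0 < e means real and positive. *)
Definition scale_invariant r (M : cmanifold r) (X : SK_geometry M) : Prop :=
  exists (dom : C -> set M) (act : C -> M -> M) (actX : C -> X -> X),
  [/\ forall t u, dom t u -> t != 0,
      forall u0, exists (U : set M) (e : C),
        [/\ open U /\ U u0, 0 < e,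
            forall t u, `|t - 1| < e -> U u -> dom t u,
            holo_action act e U
          & [/\ forall u, U u -> act 1 u = u,
            forall t u, `|t - 1| < e -> U u -> act t u = u -> t = 1,
            holo_action actX e (@proj _ _ _ X @^-1` U),
            forall x : X, U (proj x) -> actX 1 x = x
          & forall t (x : X), `|t - 1| < e -> U (proj x) ->
              forall c c', cdom c x -> cdom c' (actX t x) ->
              form_pullback (sk_L X) (actX t \o cinv c) c' (cmap c x)
                = t *: form (sk_L X) c (cmap c x)]],
      forall s t u, dom t u -> dom s (act t u) -> dom (s * t) u ->
        act s (act t u) = act (s * t) u,
      forall s t (x : X), dom t (proj x) -> dom s (act t (proj x)) ->
        dom (s * t) (proj x) -> actX s (actX t x) = actX (s * t) x
    & forall t u, dom t u ->
        set_bij (@proj _ _ _ X @^-1` [set u])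
          (@proj _ _ _ X @^-1` [set act t u]) (actX t) /\
        exists A : 'M[C]_r,
          lift_of (@unif _ _ _ X u) (@unif _ _ _ X (act t u)) (actX t) A /\
          forall l k, H1 X u l -> H1 X u k ->
            sk_J X (act t u) (l *m A) (k *m A) = sk_J X u l k].

(** * Complete iso-splitting and isotriviality *)

(* Near each point of Mo: the rows of P u = (diag a; diag b) are a basis of the
   H_1 of the product adapted to its splitting, the pairs (a_i, b_i) being bases
   of the H_1 of the factors; g makes this basis holomorphic, i.e. the products
   form a holomorphic family in which it is locally constant; and the inclusion
   of H1 X u induced by f u has a constant matrix N in locally constant bases. *)
Definition completely_iso_split r (M : cmanifold r) (X : torus_family M r) :
    Prop :=
  exists (Mo : set M) (E : M -> 'I_r -> torus 1)
    (f : forall u, X -> forall i, E u i),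
  [/\ open Mo, dense Mo,
      forall u, Mo u ->
        isogeny (@proj _ _ _ X @^-1` [set u]) (@unif _ _ _ X u)
          [set: forall i, E u i] (@prod_cover r (E u)) (f u)
    & forall u0, Mo u0 ->
      exists (U : set M) (B : M -> 'M[C]_(r + r, r)) (F : M -> 'M[C]_r)
        (a b : M -> 'rV[C]_r) (g : M -> 'M[C]_r) (N : 'M[int]_(r + r)),
      let P u := col_mx (diag_mx (a u)) (diag_mx (b u)) in
      [/\ U u0 /\ U `<=` Mo,
          flat_frame X U B,
          forall u, U u ->
            lift_of (@unif _ _ _ X u) (@prod_cover r (E u)) (f u) (F u),
          forall u i, U u -> lattice_basis (periods (tcov (E u i)))
            (col_mx (col i (a u)) (col i (b u)))
        & [/\ forall u, U u -> g u \in unitmx,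
              holo_from U (fun u => P u *m g u)
            & forall u, U u -> B u *m F u = map_mx intr N *m P u]]].

Definition contractible (T : topologicalType) (A : set T) : Prop :=
  exists a (H : T * R -> T),
  [/\ A a, {within A `*` `[0, 1], continuous H},
      forall x t, A x -> t \in `[0, 1] -> A (H (x, t)),
      forall x, A x -> H (x, 0) = x
    & forall x, A x -> H (x, 1) = a].

Definition elementary_divisors r (d : 'I_r -> nat) : Prop :=
  (forall i, (0 < d i)%N) /\
  forall i j : 'I_r, j = i.+1 :> nat -> (d i %| d j)%N.

(* The rows of alpha and beta form a symplectic basis of type d. *)
Definition symplectic r (J : 'rV[C]_r -> 'rV[C]_r -> int) (d : 'I_r -> nat)
    (alpha beta : 'M[C]_r) : Prop :=
  let B := col_mx alpha beta in
  let Delta := diag_mx (\row_i (d i)%:Z) in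
  \matrix_(i, j) J (row i B) (row j B) = block_mx 0 Delta (- Delta) 0.

(* Holomorphic 1-forms on V / Lam are the linear forms on V, with integral over
   a cycle l given by evaluation at l; the columns of theta are the basis
   theta^j normalized by the alpha-periods. *)
Definition is_modulus r (d : 'I_r -> nat) (alpha beta tau : 'M[C]_r) : Prop :=
  exists theta : 'M[C]_r,
    [/\ theta \in unitmx, alpha *m theta = diag_mx (\row_i (d i)%:R)
      & beta *m theta = tau].

Definition isotrivial r (M : cmanifold r) (X : SK_geometry M) : Prop :=
  forall (U : set M), open U -> contractible U ->
  forall (d : 'I_r -> nat) (alpha beta tau : M -> 'M[C]_r),
    elementary_divisors d ->
    flat_frame X U (fun u => col_mx (alpha u) (beta u)) ->
    (forall u, U u -> symplectic (sk_J X u) d (alpha u) (beta u)) ->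
    (forall u, U u -> is_modulus d (alpha u) (beta u) (tau u)) ->
    exists tau0, forall u, U u -> tau u = tau0.

End Defs.

Arguments cmanifold R n : clear implicits.

(* Main.v *)
(* Let eta be the contraction of L with the Euler vector field E of the scaling
   action on the total space.  Since L is closed and has weight 1, d eta = L.
   In a holomorphic frame (u, z) of the universal covers of the fibres, eta is
   invariant under the lattice translations z -> z + Z_a(u), so by Liouville its
   fibre components do not depend on z; pairing them with Z_a gives the periods
   sigma_a, which satisfy d sigma_a = K(u) Z_a with K the mixed block of L.  As L
   vanishes on the fibres, K is invertible.

   Where the torus is isogenous to a product of elliptic curves, some rational
   combinations Z', Z'' of the Z_a are proportional, Z'' = t Z'.  Then
   sigma'' = t sigma' and d sigma'' = t d sigma', hence sigma' dt = 0.  As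
   d sigma' never vanishes, sigma' vanishes on no open set, so t is locally
   constant.  The modulus is a function of the r ratios t, so it is locally
   constant on the dense open set; being holomorphic it is so everywhere, and
   hence constant on contractible sets. *)
Require Import Defs.
From HB Require Import structures.
From mathcomp Require Import all_boot all_order all_algebra complex.
From mathcomp Require Import all_classical all_reals all_analysis.
From mathcomp Require Import perm ring lra.

Set Implicit Arguments.
Unset Strict Implicit.
Unset Printing Implicit Defensive.
Import Order.TTheory GRing.Theory Num.Theory numFieldNormedType.Exports.
Local Open Scope classical_set_scope.
Local Open Scope ring_scope.

Local Notation Re := complex.Re.
Local Notation Im := complex.Im.

Section ComplexNumbers.
Context {R : realType}.
Notation C := (Cx R).

Definition cr (x : R) : C := x%:C%C.

Lemma crD x y : cr (x + y) = cr x + cr y. Proof. exact: rmorphD. Qed.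
Lemma crB x y : cr (x - y) = cr x - cr y. Proof. exact: rmorphB. Qed.
Lemma crM x y : cr (x * y) = cr x * cr y. Proof. exact: rmorphM. Qed.
Lemma cr0 : cr 0 = 0. Proof. exact: rmorph0. Qed.
Lemma cr1 : cr 1 = 1. Proof. exact: rmorph1. Qed.
Lemma crV x : cr x^-1 = (cr x)^-1. Proof. exact: fmorphV. Qed.
Lemma crn n : cr n%:R = n%:R. Proof. exact: rmorph_nat. Qed.
Lemma cr_le x y : (cr x <= cr y) = (x <= y). Proof. exact: lecR. Qed.
Lemma cr_lt x y : (cr x < cr y) = (x < y). Proof. exact: ltcR. Qed.
Lemma cr_gt0 x : (0 < cr x) = (0 < x). Proof. by rewrite -cr0 cr_lt. Qed.
Lemma cr_ge0 x : (0 <= cr x) = (0 <= x). Proof. by rewrite -cr0 cr_le. Qed.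
Lemma cr_eq0 x : (cr x == 0) = (x == 0).
Proof. by apply/eqP/eqP => [[]|->]. Qed.
Lemma cr_norm x : `|cr x| = cr `|x|.
Proof. by rewrite [LHS]normc_def /= expr0n addr0 sqrtr_sqr. Qed.

Lemma gt0_cr (e : C) : 0 < e -> exists2 d : R, 0 < d & e = cr d.
Proof.
move=> e0; exists (Re e); first by move: e0; rewrite ltcE => /andP[].
by case: e e0 => a b; rewrite ltcE /= => /andP[/eqP -> _].
Qed.

Definition nrm (V : normedModType C) (v : V) : R := Re `|v|.

Lemma nrmE (V : normedModType C) (v : V) : `|v| = cr (nrm v).
Proof.
have := normr_ge0 v; rewrite /nrm; case: (`|v|) => a b; rewrite lecE /=.
by move=> /andP[/eqP -> _].
Qed.

Lemma cr_Re_normr (x : C) : `|Re x| <= nrm (x : C).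
Proof. by rewrite -cr_le -nrmE; exact: normc_ge_Re. Qed.

Lemma cr_Im_normr (x : C) : `|Im x| <= nrm (x : C).
Proof.
rewrite -cr_le -nrmE [X in _ <= X]normc_def.
rewrite cr_le -sqrtr_sqr; apply: ler_wsqrtr; rewrite lerDr sqr_ge0 //.
Qed.

Lemma nrm_le_ReIm (x : C) : nrm (x : C) <= `|Re x| + `|Im x|.
Proof.
rewrite -cr_le -nrmE [X in X <= _]normc_def cr_le.
rewrite -[X in _ <= X]ger0_norm ?addr_ge0 // -[`|_ + _|]sqrtr_sqr; apply: ler_wsqrtr.
rewrite -[Re x ^+ 2]real_normK ?num_real // -[Im x ^+ 2]real_normK ?num_real //.
have := normr_ge0 (Re x); have := normr_ge0 (Im x); nra.
Qed.

Lemma cReB (x y : C) : Re (x - y) = Re x - Re y. Proof. by case: x y => a b []. Qed.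
Lemma cImB (x y : C) : Im (x - y) = Im x - Im y. Proof. by case: x y => a b []. Qed.
Lemma cReD (x y : C) : Re (x + y) = Re x + Re y. Proof. by case: x y => a b []. Qed.
Lemma cImD (x y : C) : Im (x + y) = Im x + Im y. Proof. by case: x y => a b []. Qed.
Lemma cReM (x y : C) : Re (x * y) = Re x * Re y - Im x * Im y.
Proof. by case: x y => a b []. Qed.
Lemma cImM (x y : C) : Im (x * y) = Re x * Im y + Im x * Re y.
Proof. by case: x y => a b []. Qed.
Lemma cReZ (x : R) (y : C) : Re (cr x * y) = x * Re y.
Proof. by rewrite cReM /= mul0r subr0. Qed.
Lemma cImZ (x : R) (y : C) : Im (cr x * y) = x * Im y.
Proof. by rewrite cImM /= mul0r addr0. Qed.

Section Norm.
Variable V : normedModType C.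
Implicit Types v w : V.

Lemma nrm_ge0 v : 0 <= nrm v. Proof. by rewrite -cr_ge0 -nrmE normr_ge0. Qed.
Lemma nrm0 : nrm (0 : V) = 0.
Proof. by apply/eqP; rewrite -cr_eq0 -nrmE normr0. Qed.
Lemma nrm0_eq0 v : nrm v = 0 -> v = 0.
Proof. by move=> h; apply/normr0_eq0; rewrite nrmE h cr0. Qed.
Lemma nrmN v : nrm (- v) = nrm v. Proof. by rewrite /nrm normrN. Qed.
Lemma nrmB v w : nrm (v - w) = nrm (w - v). Proof. by rewrite /nrm distrC. Qed.
Lemma nrmD v w : nrm (v + w) <= nrm v + nrm w.
Proof. by rewrite -cr_le crD -!nrmE ler_normD. Qed.
Lemma nrmBD v w : nrm (v - w) <= nrm v + nrm w.
Proof. by rewrite -(nrmN w) nrmD. Qed.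
Lemma nrmZ (a : C) v : nrm (a *: v) = nrm (a : C) * nrm v.
Proof. by apply: complexI; rewrite -!/(cr _) crM -!nrmE normrZ. Qed.
Lemma nrm_dist z v w : nrm (v - w) <= nrm (v - z) + nrm (z - w).
Proof. by rewrite -cr_le crD -!nrmE ler_distD. Qed.
Lemma nrm_gt0 v : (0 < nrm v) = (v != 0).
Proof. by rewrite -cr_gt0 -nrmE normr_gt0. Qed.

Lemma cvg_nrmP (T : Type) (F : set_system T) (FF : Filter F) (f : T -> V) (l : V) :
  f @ F --> l <-> forall e : R, 0 < e -> \forall t \near F, nrm (l - f t) < e.
Proof.
split=> [/cvgrPdist_lt H e e0|H].
  have := H (cr e); rewrite cr_gt0 => /(_ e0); apply: filterS => t.
  by rewrite nrmE cr_lt.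
apply/cvgrPdist_lt => e /gt0_cr[d d0 ->].
by apply: filterS (H d d0) => t; rewrite nrmE cr_lt.
Qed.

Lemma nbhs_nrmP (x : V) (P : set V) :
  (\forall y \near x, P y) <->
  exists2 d : R, 0 < d & forall y, nrm (y - x) < d -> P y.
Proof.
split=> [/nbhs_normP[e /= /gt0_cr[d d0 ->] H]|[d d0 H]].
  exists d => // y xy; apply: H; rewrite /ball_ /= nrmE cr_lt nrmB //.
apply/nbhs_normP; exists (cr d); rewrite /= ?cr_gt0 // => y.
by rewrite /ball_ /= nrmE cr_lt nrmB => /H.
Qed.

Lemma continuous_nrmP (T : topologicalType) (f : T -> V) (x : T) :
  {for x, continuous f} <->
  forall e : R, 0 < e -> \forall t \near x, nrm (f t - f x) < e.
Proof.
split=> [/cvg_nrmP H e /H|H]; first by apply: filterS => t; rewrite nrmB.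
by apply/cvg_nrmP => e /H; apply: filterS => t; rewrite nrmB.
Qed.

End Norm.

Lemma nrmM (a b : C) : nrm (a * b : C) = nrm (a : C) * nrm (b : C).
Proof. exact: (nrmZ a (b : C)). Qed.

Lemma nrm_cr x : nrm (cr x : C) = `|x|.
Proof. by apply: complexI; rewrite -!/(cr _) -nrmE cr_norm. Qed.

Lemma nrmV (a : C) : nrm (a^-1 : C) = (nrm (a : C))^-1.
Proof. by apply: complexI; rewrite -!/(cr _) crV -!nrmE normfV. Qed.

Lemma cvg_absP (T : Type) (F : set_system T) (FF : Filter F) (f : T -> R) (l : R) :
  f @ F --> l <-> forall e : R, 0 < e -> \forall t \near F, `|l - f t| < e.
Proof. exact: (@cvgrPdist_lt R R^o). Qed.

Lemma nbhs_absP (x : R) (P : set R) :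
  (\forall y \near x, P y) <->
  exists2 d : R, 0 < d & forall y, `|y - x| < d -> P y.
Proof.
split=> [/nbhs_normP[d /= d0 H]|[d d0 H]].
  by exists d => // y xy; apply: H; rewrite /ball_ /= distrC.
by apply/(@nbhs_normP R R^o); exists d => // y; rewrite /ball_ /= distrC => /H.
Qed.

Lemma Re_continuous : continuous (fun z : C => Re z).
Proof.
move=> x; apply/(@cvg_absP C (nbhs (x : C))) => d d0; apply/(nbhs_nrmP (V := C)); exists d => // y yx.
by rewrite -cReB; apply: le_lt_trans (cr_Re_normr _) _; rewrite nrmB.
Qed.

Lemma Im_continuous : continuous (fun z : C => Im z).
Proof.
move=> x; apply/(@cvg_absP C (nbhs (x : C))) => d d0; apply/(nbhs_nrmP (V := C)); exists d => // y yx.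
by rewrite -cImB; apply: le_lt_trans (cr_Im_normr _) _; rewrite nrmB.
Qed.

Section RealDerivative.
Variable V : normedModType C.

Definition rder (g : R -> V) (s : R) (l : V) : Prop :=
  forall e : R, 0 < e ->
    \forall h \near (0 : R), nrm (g (s + h) - g s - cr h *: l) <= e * `|h|.

Lemma rder_near g s l : rder g s l ->
  \forall h \near (0 : R), nrm (g (s + h) - g s) <= (nrm l + 1) * `|h|.
Proof.
move=> /(_ 1 ltr01); apply: filterS => h H.
rewrite -(subrK (cr h *: l) (_ - _)); apply: le_trans (nrmD _ _) _.
by rewrite nrmZ nrm_cr; lra.
Qed.

Lemma rder_continuous g s l : rder g s l -> {for s, continuous g}.
Proof.
move=> /rder_near/nbhs_absP[d d0 H]; apply/continuous_nrmP => e e0; apply/nbhs_absP.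
have L0 : 0 < nrm l + 1 by rewrite ltr_wpDl ?nrm_ge0.
exists (Num.min d (e / (nrm l + 1))); first by rewrite lt_min d0 divr_gt0.
move=> y; rewrite lt_min => /andP[yd ye].
have := H (y - s); rewrite subr0 => /(_ yd); rewrite (addrC s) subrK.
move=> /le_lt_trans; apply; rewrite mulrC -ltr_pdivlMr //.
Qed.

End RealDerivative.

Lemma diff_eps (V W : normedModType C) (f : V -> W) (x : V) :
  differentiable f x -> forall e : R, 0 < e ->
  \forall h \near (0 : V), nrm (f (x + h) - f x - 'd f x h) <= e * nrm h.
Proof.
move=> df e e0.
have /eqaddoP/(_ (cr e)) := diff_locally df; rewrite cr_gt0 => /(_ e0).
apply: filterS => h /=; rewrite !fctE [h + x]addrC opprD addrA -cr_le crM -!nrmE.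
by [].
Qed.

Lemma diffI_eps (V W : normedModType C) (f : V -> W) (x : V)
    (L : {linear V -> W}) : continuous L ->
  (forall e : R, 0 < e ->
    \forall h \near (0 : V), nrm (f (x + h) - f x - L h) <= e * nrm h) ->
  differentiable f x /\ 'd f x = L :> (V -> W).
Proof.
move=> cL H.
have E : f \o shift x = cst (f x) + L +o_ 0 id.
  apply/eqaddoP => _ /gt0_cr[e e0 ->]; apply: filterS (H e e0) => h /=.
  rewrite !fctE [h + x]addrC opprD addrA -cr_le crM -!nrmE.
  by [].
have D := diff_unique cL E.
by split => //; apply/diff_locallyP; rewrite D.
Qed.

Lemma diff_lip (V W : normedModType C) (f : V -> W) (x : V) :
  differentiable f x ->
  exists2 k : R, 0 < k & forall h, nrm ('d f x h) <= k * nrm h.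
Proof.
move=> /diff_continuous/linear_lipschitz[_ /gt0_cr[k k0 ->] H].
by exists k => // h; rewrite -cr_le crM -!nrmE.
Qed.

Lemma rder_comp (V W : normedModType C) (f : V -> W) (g : R -> V) s l :
  differentiable f (g s) -> rder g s l -> rder (f \o g) s ('d f (g s) l).
Proof.
move=> df dg e e0.
have L0 : 0 < nrm l + 1 by rewrite ltr_wpDl ?nrm_ge0.
have e1 : 0 < e / 2 / (nrm l + 1) by rewrite !divr_gt0.
have /nbhs_nrmP[d d0 Hf] := diff_eps df e1.
have [k k0 Hk] := diff_lip df.
have e2 : 0 < e / 2 / k by rewrite !divr_gt0.
have /continuous_nrmP/(_ _ d0)/nbhs_absP[d1 d10 H1] := rder_continuous dg.
near=> h.
have kd : nrm (g (s + h) - g s) < d.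
  apply: H1; rewrite addrAC subrr add0r.
  by near: h; apply/nbhs_absP; exists d1 => // y; rewrite subr0.
have := Hf (g (s + h) - g s); rewrite subr0 => /(_ kd).
rewrite (addrC (g s)) subrK => Hf'.
have N1 : nrm (g (s + h) - g s) <= (nrm l + 1) * `|h|.
  by near: h; exact: rder_near dg.
have N2 : nrm (g (s + h) - g s - cr h *: l) <= e / 2 / k * `|h|.
  by near: h; exact: dg.
rewrite /= -linearZ.
rewrite -(subrKA ('d f (g s) (g (s + h) - g s))) -linearB.
apply: le_trans (nrmD _ _) _.
have := Hk (g (s + h) - g s - cr h *: l).
have -> : e * `|h| = e / 2 / (nrm l + 1) * ((nrm l + 1) * `|h|) + k * (e / 2 / k * `|h|).
  by field; rewrite !gt_eqF.
move=> Hk'; apply: lerD.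
  by apply: le_trans Hf' _; rewrite ler_pM2l.
by apply: le_trans Hk' _; rewrite ler_pM2l.
Unshelve. all: by end_near. Qed.

Lemma rderD (V : normedModType C) (f g : R -> V) s l m :
  rder f s l -> rder g s m -> rder (fun x => f x + g x) s (l + m).
Proof.
move=> df dg e e0; have e2 : 0 < e / 2 by rewrite divr_gt0.
apply: filterS2 (df _ e2) (dg _ e2) => h Hf Hg.
have -> : f (s + h) + g (s + h) - (f s + g s) - cr h *: (l + m) =
  (f (s + h) - f s - cr h *: l) + (g (s + h) - g s - cr h *: m).
  by rewrite scalerDr !opprD (addrACA (f (s + h))) (addrACA (_ - _)) .
by apply: le_trans (nrmD _ _) _; lra.
Qed.

Lemma is_derive_eps (F : R -> R) (s l : R) :
  (forall e : R, 0 < e ->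
    \forall h \near (0 : R), `|F (s + h) - F s - h * l| <= e * `|h|) ->
  is_derive s 1 F l.
Proof.
move=> H.
suff Hl : h^-1 *: ((F \o shift s) (h *: 1) - F s) @[h --> 0^'] --> (l : R^o).
  by apply: DeriveDef; [apply/cvg_ex; exists l|apply/cvg_lim].
apply/(@cvg_absP R (dnbhs (0 : R))) => e e0; have e2 : 0 < e / 2 by rewrite divr_gt0.
rewrite near_withinE; apply: filterS (H _ e2) => h Hh h0.
have h0' : 0 < `|h| by rewrite normr_gt0.
rewrite /= [h *: 1]mulr1 (addrC h) -(@ltr_pM2l _ `|h|) // -normrM mulrBr.
rewrite mulrA divff // mul1r distrC; apply: le_lt_trans Hh _.
by rewrite mulrC ltr_pM2l //; lra.
Qed.

Lemma rder_Re (g : R -> C) s l : rder (g : R -> C) s l ->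
  is_derive s 1 (fun x => Re (g x)) (Re l).
Proof.
move=> dg; apply: is_derive_eps => e e0; apply: filterS (dg e e0) => h.
by apply: le_trans; rewrite -cReZ -!cReB; exact: cr_Re_normr.
Qed.

Lemma rder_Im (g : R -> C) s l : rder (g : R -> C) s l ->
  is_derive s 1 (fun x => Im (g x)) (Im l).
Proof.
move=> dg; apply: is_derive_eps => e e0; apply: filterS (dg e e0) => h.
by apply: le_trans; rewrite -cImZ -!cImB; exact: cr_Im_normr.
Qed.

Lemma rder_affine (V : normedModType C) (x v : V) s :
  rder (fun t => x + cr t *: v) s v.
Proof.
move=> e e0; apply/nbhs_absP; exists 1 => // h _.
by rewrite crD scalerDl opprD addrACA subrr add0r [cr s *: v + _]addrC addrK subrr nrm0 mulr_ge0 // ltW.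
Qed.

Lemma rder_eq (V : normedModType C) (g : R -> V) s l l' :
  rder g s l -> l = l' -> rder g s l'.
Proof. by move=> ? <-. Qed.

(* The factor 2 comes from bounding real and imaginary parts separately. *)
Lemma mvi (g : R -> C) (dg : R -> C) (M : R) :
  (forall s, 0 <= s <= 1 -> rder (g : R -> C) s (dg s)) ->
  (forall s, 0 <= s <= 1 -> nrm (dg s : C) <= M) ->
  nrm (g 1 - g 0 : C) <= M *+ 2.
Proof.
move=> dgs HM.
have cont (P : C -> R) : continuous P ->
    {within `[0, 1], continuous (fun x => P (g x))}.
  move=> cP; apply: continuous_in_subspaceT => s; rewrite inE /= in_itv /= => s01.
  apply: continuous_comp; last exact: cP.
  exact: rder_continuous (dgs _ s01).
have [a a01 Ha] : exists2 c, c \in `]0, 1[ &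
    Re (g 1) - Re (g 0) = Re (dg c) * (1 - 0).
  apply: (@MVT R (fun x => Re (g x)) (fun x => Re (dg x)) 0 1) => //.
    move=> x; rewrite in_itv /= => /andP[x0 x1]; apply: rder_Re; apply: dgs.
    by rewrite !ltW.
  by apply: cont; exact: Re_continuous.
have [b b01 Hb] : exists2 c, c \in `]0, 1[ &
    Im (g 1) - Im (g 0) = Im (dg c) * (1 - 0).
  apply: (@MVT R (fun x => Im (g x)) (fun x => Im (dg x)) 0 1) => //.
    move=> x; rewrite in_itv /= => /andP[x0 x1]; apply: rder_Im; apply: dgs.
    by rewrite !ltW.
  by apply: cont; exact: Im_continuous.
apply: le_trans (nrm_le_ReIm _) _; rewrite cReB cImB Ha Hb subr0 !mulr1 mulr2n.
apply: lerD; [apply: le_trans (cr_Re_normr _) _|apply: le_trans (cr_Im_normr _) _];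
  apply: HM; [move: a01|move: b01]; rewrite in_itv /= => /andP[? ?]; rewrite !ltW //.
Qed.

End ComplexNumbers.

(** * Cauchy's formula and its consequences *)

Section CircleIntegral.
Context {R : realType}.
Notation C := (Cx R).
Notation mu := (@lebesgue_measure R).

Definition circ : set R := `[0, pi *+ 2]%classic.

Definition Ic (h : R -> C) : C :=
  Complex (\int[mu]_(t in circ) Re (h t)) (\int[mu]_(t in circ) Im (h t)).

Definition ccont (h : R -> C) : Prop :=
  forall t, circ t -> {for t, continuous h}.

Lemma pi2_gt0 : 0 < pi *+ 2 :> R. Proof. by rewrite pmulrn_lgt0 // pi_gt0. Qed.

Lemma circ_measurable : @measurable _ (measurableTypeR R) circ. Proof. exact: measurable_itv. Qed.

Lemma circ_compact : compact circ. Proof. exact: segment_compact. Qed.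

Lemma circ_fine : fine (mu circ) = pi *+ 2.
Proof. by rewrite /circ lebesgue_measure_itv /= lte_fin pi2_gt0 /= oppr0 addr0. Qed.

Lemma ccont_integrable (P : C -> R) h : continuous P -> ccont h ->
  mu.-integrable circ (EFin \o (fun t => P (h t))).
Proof.
move=> cP ch; apply: continuous_compact_integrable; first exact: circ_compact.
apply: continuous_in_subspaceT => s; rewrite inE /= => sc.
by apply: continuous_comp; [exact: ch|exact: cP].
Qed.

Definition ccRe h (ch : ccont h) := ccont_integrable (@Re_continuous R) ch.
Definition ccIm h (ch : ccont h) := ccont_integrable (@Im_continuous R) ch.

Lemma Ic_ext f g : (forall t, circ t -> f t = g t) -> Ic f = Ic g.
Proof.
by move=> fg; congr Complex; apply: eq_Rintegral => t /set_mem /fg ->.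
Qed.

Lemma IcD f g : ccont f -> ccont g -> Ic (fun t => f t + g t) = Ic f + Ic g.
Proof.
move=> cf cg; have mc := circ_measurable; apply: (f_equal2 (@Complex R)).
  etransitivity; last exact: (RintegralD mc (ccRe cf) (ccRe cg)).
  by apply: eq_Rintegral => t _; rewrite cReD.
etransitivity; last exact: (RintegralD mc (ccIm cf) (ccIm cg)).
by apply: eq_Rintegral => t _; rewrite cImD.
Qed.

Lemma IcZ (c : C) f : ccont f -> Ic (fun t => c * f t) = c * Ic f.
Proof.
move=> cf; have mc := circ_measurable; case: c => a b.
have iRe := ccRe cf; have iIm := ccIm cf.
have I1 (x : R) : mu.-integrable circ (EFin \o (fun t => x * Re (f t))).
  by have := integrableZl mc x iRe; apply.
have I2 (x : R) : mu.-integrable circ (EFin \o (fun t => x * Im (f t))).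
  by have := integrableZl mc x iIm; apply.
apply: (f_equal2 (@Complex R)).
  rewrite -(RintegralZl a mc iRe) -(RintegralZl b mc iIm).
  rewrite -(RintegralB mc (I1 a) (I2 b)).
  by apply: eq_Rintegral => t _; rewrite cReM.
rewrite -(RintegralZl a mc iIm) -(RintegralZl b mc iRe).
rewrite -(RintegralD mc (I2 a) (I1 b)).
by apply: eq_Rintegral => t _; rewrite cImM.
Qed.

Lemma ccontM f g : ccont f -> ccont g -> ccont (fun t => f t * g t).
Proof. by move=> cf cg t ct; apply: (@continuousM C); [exact: cf|exact: cg]. Qed.

Lemma ccont_cst c : ccont (fun=> c).
Proof. by move=> t _; exact: cst_continuous. Qed.

Lemma IcB f g : ccont f -> ccont g -> Ic (fun t => f t - g t) = Ic f - Ic g.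
Proof.
move=> cf cg; have cNg := ccontM (@ccont_cst (-1)) cg.
have := IcD cf cNg; rewrite (IcZ (-1) cg) mulN1r => <-.
by apply: Ic_ext => t _; rewrite mulN1r.
Qed.

Lemma Ic_cst c : Ic (fun=> c) = cr (pi *+ 2) * c.
Proof.
have E := Rintegral_cst mu circ_measurable.
case: c => a b; apply: (f_equal2 (@Complex R)); rewrite E circ_fine mulrC.
  by rewrite mul0r subr0.
by rewrite mul0r addr0.
Qed.

Lemma Ic_bound f (M : R) : ccont f -> (forall t, circ t -> nrm (f t : C) <= M) ->
  nrm (Ic f : C) <= pi *+ 4 * M.
Proof.
move=> cf fM; have mc := circ_measurable.
have B (P : C -> R) : continuous P -> (forall z, `|P z| <= nrm (z : C)) ->
    `|\int[mu]_(t in circ) P (f t)| <= pi *+ 2 * M.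
  move=> cP Pn; have I := ccont_integrable cP cf.
  apply: le_trans (le_normr_Rintegral mc I) _.
  rewrite mulrC -circ_fine -(Rintegral_cst mu mc).
  apply: le_Rintegral => //.
  - exact: (@integrable_norm _ _ _ _ _ _ I).
  - exact: (ccont_integrable (@Re_continuous R) (@ccont_cst (cr M))).
  - by move=> t /fM; apply: le_trans.
apply: le_trans (nrm_le_ReIm _) _.
have -> : pi *+ 4 * M = pi *+ 2 * M + pi *+ 2 * M by lra.
by apply: lerD; apply: B; [exact: Re_continuous|exact: cr_Re_normr|exact: Im_continuous|exact: cr_Im_normr].
Qed.

Lemma Ic_der (g g' : R -> C) : (forall t, rder (g : R -> C) t (g' t)) ->
  ccont g' -> g (pi *+ 2) = g 0 -> Ic g' = 0.
Proof.
move=> dg cg' g02.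
have H (P : C -> R) : continuous P ->
    (forall t : R, is_derive t 1 (fun x => P (g x)) (P (g' t))) ->
    \int[mu]_(t in circ) P (g' t) = 0.
  move=> cP dP; rewrite /Rintegral.
  rewrite (@continuous_FTC2 R _ (fun x => P (g x)) 0 (pi *+ 2)) ?pi2_gt0 //.
  - by rewrite g02 -EFinB subrr.
  - apply: continuous_in_subspaceT => s; rewrite inE /= => sc.
    by apply: continuous_comp; [exact: cg'|exact: cP].
  - have dc x : P (g t) @[t --> x] --> P (g x).
      apply: continuous_comp; [exact: rder_continuous (dg _)|exact: cP].
    split.
    + by move=> x _; apply: ex_derive.
    + exact: cvg_at_right_filter.
    + exact: cvg_at_left_filter.
  - by move=> x _; rewrite derive1E derive_val.
apply: (f_equal2 (@Complex R)).
  exact: (H (fun z => Re z) (@Re_continuous R) (fun t => rder_Re (dg t))).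
exact: (H (fun z => Im z) (@Im_continuous R) (fun t => rder_Im (dg t))).
Qed.

End CircleIntegral.

Section StrictDifferentiability.
Context {R : realType}.
Notation C := (Cx R).
Variable V : normedModType C.
Implicit Types (f : V -> C) (x y k : V).

Definition c1 f x : Prop := differentiable f x /\
  forall e : R, 0 < e -> \forall y \near x, differentiable f y /\
    forall k, nrm ('d f y k - 'd f x k) <= e * nrm k.

Lemma c1_strict f x : c1 f x -> forall e : R, 0 < e ->
  exists2 d : R, 0 < d & forall y k, nrm (y - x) < d -> nrm k < d ->
    [/\ differentiable f y, forall h, nrm ('d f y h - 'd f x h) <= e * nrm h
      & nrm (f (y + k) - f y - 'd f x k) <= e * nrm k].
Proof.
move=> [_ H] e e0; have e2 : 0 < e / 2 by rewrite divr_gt0.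
have /nbhs_nrmP[d d0 Hd] := H _ e2.
exists (d / 2); first by rewrite divr_gt0.
move=> y k yd kd; split.
- by have [] := Hd y; first lra.
- move=> h; have [|_ /(_ h)] := Hd y; first lra.
  by move=> /le_trans; apply; rewrite ler_wpM2r ?nrm_ge0 //; lra.
pose g (s : R) := f (y + cr s *: k) + (0 + cr s *: - 'd f x k).
have near s : 0 <= s <= 1 -> nrm (y + cr s *: k - x) < d.
  move=> /andP[s0 s1]; rewrite addrAC; apply: le_lt_trans (nrmD _ _) _.
  rewrite nrmZ nrm_cr ger0_norm //.
  have : s * nrm k <= 1 * nrm k by rewrite ler_wpM2r ?nrm_ge0.
  lra.
have dg s : 0 <= s <= 1 ->
    rder (g : R -> C) s ('d f (y + cr s *: k) k + (- 'd f x k)).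
  move=> /near/Hd[df _]; apply: rderD; last exact: rder_affine.
  by apply: (rder_comp (f := f)) df (rder_affine _ _ _).
have := mvi dg (M := e / 2 * nrm k); rewrite /g cr0 cr1 !scale0r !scale1r !addr0 add0r.
have -> : (e / 2 * nrm k) *+ 2 = e * nrm k by lra.
have -> : f (y + k) - 'd f x k - f y = f (y + k) - f y - 'd f x k by rewrite addrAC.
by apply=> s /near/Hd[_]; apply.
Qed.

Lemma c1_dcont f x (T : Type) (F : set_system T) (FF : Filter F)
    (u v : T -> V) (w : V) :
  c1 f x -> u @ F --> x -> v @ F --> w -> ('d f (u t) (v t) : C) @[t --> F] --> ('d f x w : C).
Proof.
move=> [df H] ux vw; apply/cvg_nrmP => e e0.
have [K K0 HK] := diff_lip df.
pose e1 := e / 2 / (nrm w + 1).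
have w1 : 0 < nrm w + 1 by rewrite ltr_wpDl ?nrm_ge0.
have e10 : 0 < e1 by rewrite !divr_gt0.
have e20 : 0 < e / 2 / K by rewrite !divr_gt0.
have H1 : \forall t \near F, differentiable f (u t) /\
    forall k, nrm ('d f (u t) k - 'd f x k) <= e1 * nrm k by exact: ux _ (H _ e10).
have H2 : \forall t \near F, nrm (w - v t) < 1 by move: vw => /cvg_nrmP; apply.
have H3 : \forall t \near F, nrm (w - v t) < e / 2 / K.
  by move: vw => /cvg_nrmP; apply.
apply: filterS3 H1 H2 H3 => t [_ /(_ (v t)) h1] h2 h3.
rewrite -(subrKA ('d f x (v t))) -linearB; apply: le_lt_trans (nrmD _ _) _.
have h4 := HK (w - v t).
have h5 : K * nrm (w - v t) < e / 2 by rewrite mulrC -ltr_pdivlMr.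
have h6 : nrm (v t) < nrm w + 1.
  by rewrite -(subrK w (v t)); apply: le_lt_trans (nrmD _ _) _; rewrite nrmB; lra.
have h7 : e1 * nrm (v t) < e / 2.
  have -> : e / 2 = e1 * (nrm w + 1) by rewrite /e1 divfK // gt_eqF.
  by rewrite ltr_pM2l.
rewrite [X in _ + X]nrmB; lra.
Qed.

End StrictDifferentiability.

Section ParametricCircleIntegral.
Context {R : realType}.
Notation C := (Cx R).

Lemma circ_near (T : Type) (F : set_system T) (FF : Filter F)
    (Q : T -> R -> Prop) :
  (forall t, @circ R t -> \forall t' \near t & x \near F, Q x t') ->
  \forall x \near F, forall t, circ t -> Q x t.
Proof.
move=> H.
exact: (iffLR (compact_near_coveringP _) (@circ_compact R) T F Q FF H).
Qed.

Lemma Ic_cvg (T : topologicalType) (x0 : T) (H : T -> R -> C) :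
  (forall t, circ t -> (H p.2 p.1 : C) @[p --> filter_prod (nbhs t) (nbhs x0)] --> (H x0 t : C)) ->
  (\forall x \near x0, ccont (H x)) ->
  (Ic (H x) : C) @[x --> x0] --> (Ic (H x0) : C).
Proof.
move=> HH cH; apply/cvg_nrmP => e e0.
have K0 : 0 < pi *+ 4 :> R by rewrite pmulrn_lgt0 // pi_gt0.
pose d := e / 2 / pi *+ 4.
have d0 : 0 < e / 2 / (pi *+ 4) by rewrite !divr_gt0.
have cH0 : ccont (H x0) := nbhs_singleton cH.
have U : \forall x \near x0, forall t, circ t ->
    nrm (H x0 t - H x t : C) <= e / 2 / (pi *+ 4).
  apply: (@circ_near T (nbhs x0)) => t ct.
  have := HH t ct => /cvg_nrmP/(_ (e / 2 / (pi *+ 4) / 2)).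
  rewrite divr_gt0 // => /(_ isT) [[U1 U2] /= [hU1 hU2] U12].
  exists (U1, U2) => // -[t' x] /= [U1t' U2x].
  have A1 := U12 (t', x) (conj U1t' U2x).
  have A2 := U12 (t', x0) (conj U1t' (nbhs_singleton hU2)).
  rewrite /= in A1 A2.
  have A3 := nrm_dist (H x0 t : C) (H x0 t') (H x t').
  have A4 := nrmB (H x0 t : C) (H x0 t'); lra.
apply: filterS2 cH U => x cx Ux.
rewrite -IcB //.
have cc : ccont (fun t => H x0 t - H x t).
  by move=> t ct; apply: (@continuousB _ C); [exact: cH0|exact: cx].
have := Ic_bound cc Ux; rewrite mulrC divfK ?gt_eqF // => ?; lra.
Qed.

Variable V : normedModType C.
Variables (f : V -> C) (b : R -> V) (a c : R -> C) (w0 : V).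
Hypothesis cb : forall t, circ t -> {for t, continuous b}.
Hypothesis ca : ccont a.
Hypothesis cc : ccont c.
Hypothesis cf : forall t, circ t -> c1 f (b t + a t *: w0).
Hypothesis cfn : forall t, circ t -> \forall y \near (b t + a t *: w0), c1 f y.

Let arg w t := b t + a t *: w.
Let dd w v t : C := 'd f (arg w t) (a t *: v) * c t.

Lemma arg_cvg t : circ t ->
  arg p.2 p.1 @[p --> filter_prod (nbhs t) (nbhs w0)] --> arg w0 t.
Proof.
move=> ct; apply: cvgD.
  by apply: cvg_comp; [exact: cvg_fst|exact: cb].
apply: cvgZ; last exact: cvg_snd.
by apply: cvg_comp; [exact: cvg_fst|exact: ca].
Qed.

Lemma arg_c1 : \forall w \near w0, forall t, circ t -> c1 f (arg w t).
Proof.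
apply: (@circ_near V (nbhs w0)) => t ct.
exact: (arg_cvg ct (cfn ct)).
Qed.

Lemma dd_cvg v t : circ t ->
  (dd p.2 v p.1 : C) @[p --> filter_prod (nbhs t) (nbhs w0)] --> (dd w0 v t : C).
Proof.
move=> ct; apply: (@cvgM C).
  apply: c1_dcont (cf ct) (arg_cvg ct) _.
  apply: cvgZr_tmp.
  by apply: cvg_comp; [exact: cvg_fst|exact: ca].
by apply: cvg_comp; [exact: cvg_fst|exact: cc].
Qed.

Lemma ccont_arg w : (forall t, circ t -> c1 f (arg w t)) ->
  ccont (fun t => f (arg w t) * c t).
Proof.
move=> H t ct; apply: (@cvgM C); last exact: cc.
apply: (@continuous_comp _ _ _ (arg w) f t).
  by apply: cvgD; [exact: cb|apply: cvgZr_tmp; exact: ca].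
by apply: differentiable_continuous; case: (H t ct).
Qed.

Lemma ccont_dd w v : (forall t, circ t -> c1 f (arg w t)) -> ccont (dd w v).
Proof.
move=> H t ct; apply: (@cvgM C); last exact: cc.
apply: c1_dcont (H t ct) _ _.
  by apply: cvgD; [exact: cb|apply: cvgZr_tmp; exact: ca].
by apply: cvgZr_tmp; exact: ca.
Qed.

Lemma Ic_dd_linear w : (forall t, circ t -> c1 f (arg w t)) ->
  linear (fun v => Ic (dd w v) : C).
Proof.
move=> H k u v; have ck := @ccont_cst R k.
have E : forall t, circ t -> dd w (k *: u + v) t = k * dd w u t + dd w v t.
  move=> t _; rewrite /dd scalerDr scalerA (mulrC (a t)) -scalerA linearD linearZ.
  have aux (p q s z : C) : (p * q + s) * z = p * (q * z) + s * z by rewrite mulrDl mulrA.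
  exact: aux.
have cu : ccont (dd w u) by exact: ccont_dd.
have cv : ccont (dd w v) by exact: ccont_dd.
rewrite (Ic_ext E) (IcD (ccontM ck cu) cv) (IcZ k cu).
by [].
Qed.

Lemma Ic_param_eps (e : R) : 0 < e -> \forall w \near (0 : V),
  nrm (Ic (fun t => f (arg (w0 + w) t) * c t) - Ic (fun t => f (arg w0 t) * c t)
       - Ic (dd w0 w) : C) <= e * nrm w.
Proof.
move=> e0; have [K K0 EK] : exists2 K : R, 0 < K & K = pi *+ 4.
  by exists (pi *+ 4); rewrite // pmulrn_lgt0 // pi_gt0.
have e1 : 0 < e / K by rewrite divr_gt0.
have ctr : (w0 + w) @[w --> (0 : V)] --> w0.
  rewrite -[X in _ --> X]addr0; apply: cvgD; [exact: cvg_cst|exact: cvg_id].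
have U1 : \forall w \near (0 : V), forall t, circ t -> c1 f (arg (w0 + w) t).
  exact: ctr arg_c1.
have U2 : \forall w \near (0 : V), forall t, circ t ->
    nrm ((f (arg (w0 + w) t) - f (arg w0 t) - 'd f (arg w0 t) (a t *: w)) * c t : C)
      <= e / K * nrm w.
  apply: (@circ_near V (nbhs (0 : V))) => t ct.
  pose A := nrm (a t : C) + 1; pose B := nrm (c t : C) + 1.
  have A0 : 0 < A by rewrite ltr_wpDl ?nrm_ge0.
  have B0 : 0 < B by rewrite ltr_wpDl ?nrm_ge0.
  have e2 : 0 < e / K / 2 / (A * B) by rewrite !divr_gt0 // mulr_gt0.
  have [d d0 Hd] := c1_strict (cf ct) e2.
  have Ha : \forall t' \near t, nrm (a t' : C) < A.
    have /continuous_nrmP/(_ 1 ltr01) := ca ct; apply: filterS => t' h.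
    by rewrite -(subrK (a t) (a t')); apply: le_lt_trans (nrmD _ _) _; rewrite /A; lra.
  have Hc : \forall t' \near t, nrm (c t' : C) < B.
    have /continuous_nrmP/(_ 1 ltr01) := cc ct; apply: filterS => t' h.
    by rewrite -(subrK (c t) (c t')); apply: le_lt_trans (nrmD _ _) _; rewrite /B; lra.
  have Hb : \forall t' \near t, nrm (arg w0 t' - arg w0 t) < d.
    have : {for t, continuous (arg w0)}.
      by apply: cvgD; [exact: cb|apply: cvgZr_tmp; exact: ca].
    by move=> /continuous_nrmP; apply.
  have Hw : \forall w \near (0 : V), nrm w < d / A.
    by apply/nbhs_nrmP; exists (d / A); rewrite ?divr_gt0 // => y; rewrite subr0.
  exists ([set t' | [/\ nrm (a t' : C) < A, nrm (c t' : C) < B &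
      nrm (arg w0 t' - arg w0 t) < d]], [set w | nrm w < d / A]).
    by split => //; apply: filterS3 Ha Hc Hb.
  move=> [t' w] /= [[hA hB hb] hw].
  have aw : nrm (a t' *: w) <= A * nrm w.
    by rewrite nrmZ ler_wpM2r ?nrm_ge0 // ltW.
  have aw' : nrm (a t' *: w) < d.
    apply: le_lt_trans aw _; rewrite mulrC -ltr_pdivlMr //.
  have [_ /(_ (a t' *: w)) h1 h2] := Hd _ _ hb aw'.
  have E : arg (w0 + w) t' = arg w0 t' + a t' *: w by rewrite /arg scalerDr addrA.
  rewrite nrmM E.
  set e3 := e / _ / 2 / (A * B) in h1 h2 e2.
  have -> : e / K * nrm w = (2 * (e3 * (A * nrm w))) * B.
    by rewrite /e3; field; rewrite !gt_eqF.
  apply: ler_pM; [exact: nrm_ge0|exact: nrm_ge0| |exact: ltW].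
  rewrite -(subrKA ('d f (arg w0 t) (a t' *: w))); apply: le_trans (nrmD _ _) _.
  have h3 : e3 * nrm (a t' *: w) <= e3 * (A * nrm w) by rewrite ler_pM2l.
  have h4 := nrmB ('d f (arg w0 t) (a t' *: w)) ('d f (arg w0 t') (a t' *: w)).
  rewrite -/(arg w0 t) in h1 h2; lra.
apply: filterS2 U1 U2 => w cw Hw.
have c10 : forall t, circ t -> c1 f (arg w0 t) := cf.
have C1 : ccont (fun t => f (arg w0 t) * c t) by exact: ccont_arg.
have C2 : ccont (fun t => f (arg (w0 + w) t) * c t) by exact: ccont_arg.
have C3 : ccont (dd w0 w) by exact: ccont_dd.
have C4 : ccont (fun t => f (arg (w0 + w) t) * c t - f (arg w0 t) * c t).
  by move=> t ct; apply: (@continuousB _ C); [exact: C2|exact: C1].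
rewrite -IcB // -IcB //.
have -> : e * nrm w = K * (e / K * nrm w) by field; rewrite gt_eqF.
rewrite EK; apply: Ic_bound.
  by move=> t ct; apply: (@continuousB _ C); [exact: C4|exact: C3].
by move=> t ct; have := Hw t ct; rewrite -EK !mulrBl.
Qed.

Lemma Ic_dd_continuous : continuous (fun v => Ic (dd w0 v) : C).
Proof.
have L := Ic_dd_linear (w := w0) cf.
pose gL : {linear V -> C} := HB.pack (fun v => Ic (dd w0 v) : C)
  (GRing.isLinear.Build C V C _ _ L).
apply: (@continuousfor0_continuous _ _ _ gL).
have E0 : (fun=> 0) = dd w0 0.
  by apply/funext => t; rewrite /dd scaler0 linear0 mul0r.
have : (Ic (dd w0 v) : C) @[v --> (0 : V)] --> (Ic (dd w0 0) : C).
  apply: (@Ic_cvg V 0 (fun v => dd w0 v)).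
    move=> t ct; apply: (@cvgM C).
      apply: c1_dcont (cf ct) _ _.
        apply: cvgD; first by apply: cvg_comp; [exact: cvg_fst|exact: cb].
        by apply: cvgZr_tmp; apply: cvg_comp; [exact: cvg_fst|exact: ca].
      by apply: cvgZ; [apply: cvg_comp; [exact: cvg_fst|exact: ca]|exact: cvg_snd].
    by apply: cvg_comp; [exact: cvg_fst|exact: cc].
  by apply: nearW => v; exact: ccont_dd.
exact.
Qed.

Lemma Ic_param_diff : 
  differentiable (fun w => Ic (fun t => f (arg w t) * c t) : C) w0 /\
  forall v, 'd (fun w => Ic (fun t => f (arg w t) * c t) : C) w0 v = Ic (dd w0 v).
Proof.
have L := Ic_dd_linear (w := w0) cf.
pose gL : {linear V -> C} := HB.pack (fun v => Ic (dd w0 v) : C)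
  (GRing.isLinear.Build C V C _ _ L).
have [] := @diffI_eps R V C (fun w => Ic (fun t => f (arg w t) * c t)) w0 gL
  Ic_dd_continuous Ic_param_eps.
by move=> D E; split => // v; rewrite E.
Qed.

Lemma Ic_dd_param_continuous v :
  (Ic (dd w v) : C) @[w --> w0] --> (Ic (dd w0 v) : C).
Proof.
apply: (@Ic_cvg V w0 (fun w => dd w v)); first by move=> t; exact: dd_cvg.
by apply: filterS arg_c1 => w Hw; exact: ccont_dd.
Qed.

End ParametricCircleIntegral.

Section HolomorphicCalculus.
Context {R : realType}.
Notation C := (Cx R).

Section Calculus.
Variable V : normedModType C.
Implicit Types (f g : V -> C) (x : V).

Lemma holI f x (D : V -> V -> C) :
  (\forall y \near x, differentiable f y /\
     forall v, 'd f y v = D y v /\ (D z v : C) @[z --> y] --> (D y v : C)) ->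
  holomorphic_at f x.
Proof.
move=> H; have HH := near_join H.
apply: filterS2 H HH => y [dfy Hy] Hyy; split => // v.
have [E cD] := Hy v; rewrite /prop_for /continuous_at E.
apply: cvg_trans cD; apply: near_eq_cvg.
by apply: filterS Hyy => z [_ /(_ v) [->]].
Qed.

Lemma hol_near f x : holomorphic_at f x -> \forall y \near x, holomorphic_at f y.
Proof. exact: near_join. Qed.

Lemma hol_diff f x : holomorphic_at f x -> differentiable f x.
Proof. by move=> /nbhs_singleton []. Qed.

Lemma hol_dcont f x v : holomorphic_at f x ->
  ('d f z v : C) @[z --> x] --> ('d f x v : C).
Proof. by move=> /nbhs_singleton [_ /(_ v)]. Qed.

Lemma hol_cont f x : holomorphic_at f x -> {for x, continuous f}.
Proof. by move=> /hol_diff/differentiable_continuous. Qed.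

Lemma hol_cst (c : C) x : holomorphic_at (fun=> c : C) x.
Proof.
apply: (holI (D := fun _ _ => 0)); apply: filterE => y.
by split=> // v; rewrite diff_cst; split => //; exact: cvg_cst.
Qed.

Lemma holD f g x : holomorphic_at f x -> holomorphic_at g x ->
  holomorphic_at (fun y => f y + g y) x.
Proof.
move=> hf hg; apply: (holI (D := fun y v => 'd f y v + 'd g y v)).
apply: filterS2 hf hg => y [df cf] [dg cg].
split; first exact: differentiableD.
move=> v; split; first exact: (congr1 (fun h => h v) (diffD df dg)).
by apply: (@cvgD _ C); [exact: cf|exact: cg].
Qed.

Lemma holM f g x : holomorphic_at f x -> holomorphic_at g x ->
  holomorphic_at (fun y => f y * g y : C) x.
Proof.
move=> hf hg; apply: (holI (D := fun y v => f y * 'd g y v + g y * 'd f y v)).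
apply: filterS2 hf hg => y [df cf] [dg cg].
split; first exact: differentiableM.
move=> v; split; first exact: (congr1 (fun h => h v) (diffM df dg)).
apply: (@cvgD _ C); apply: (@cvgM C).
- exact: differentiable_continuous.
- exact: cg.
- exact: differentiable_continuous.
- exact: cf.
Qed.

Lemma holN f x : holomorphic_at f x -> holomorphic_at (fun y => - f y) x.
Proof.
move=> hf; pose m1 : C := -1.
have := holM (hol_cst m1 x) hf.
have -> : (fun y => m1 * f y) = (fun y => - f y); last by [].
by apply/funext => y; exact: mulN1r.
Qed.

Lemma holB f g x : holomorphic_at f x -> holomorphic_at g x ->
  holomorphic_at (fun y => f y - g y) x.
Proof. by move=> hf hg; exact: (holD hf (holN hg)). Qed.

Lemma holV f x : holomorphic_at f x -> f x != 0 ->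
  holomorphic_at (fun y => (f y)^-1 : C) x.
Proof.
move=> hf fx0.
have fn : \forall y \near x, f y != 0.
  have /continuous_nrmP/(_ (nrm (f x))) := hol_cont hf.
  rewrite nrm_gt0 => /(_ fx0); apply: filterS => y; apply: contraTneq => ->.
  by rewrite sub0r nrmN ltxx.
apply: (holI (D := fun y v => - ((f y)^-1 * (f y)^-1) * 'd f y v)).
apply: filterS2 hf fn => y [df cf] fy0.
split; first exact: differentiableV.
move=> v; split.
  rewrite -expr2 exprVn; exact: (congr1 (fun h => h v) (diffV df fy0)).
apply: (@cvgM C); last exact: cf.
apply: (@cvgN _ C); apply: (@cvgM C); apply: (@cvgV C) => //;
  exact: differentiable_continuous.
Qed.

Lemma hol_sum (I : Type) (r : seq I) (P : pred I) (F : I -> V -> C) x :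
  (forall i, P i -> holomorphic_at (F i) x) ->
  holomorphic_at (fun y => \sum_(i <- r | P i) F i y) x.
Proof.
move=> HF; elim: r => [|i r IH].
  under eq_fun do rewrite big_nil; exact: hol_cst.
under eq_fun do rewrite big_cons.
case Pi: (P i); last exact: IH.
exact: (holD (HF i Pi) IH).
Qed.

Lemma hol_prod (I : Type) (r : seq I) (P : pred I) (F : I -> V -> C) x :
  (forall i, P i -> holomorphic_at (F i) x) ->
  holomorphic_at (fun y => \prod_(i <- r | P i) F i y : C) x.
Proof.
move=> HF; elim: r => [|i r IH].
  under eq_fun do rewrite big_nil; exact: hol_cst.
under eq_fun do rewrite big_cons.
case Pi: (P i); last exact: IH.
exact: (holM (HF i Pi) IH).
Qed.

End Calculus.

Lemma hol_affine (V : normedModType C) (f : V -> C) (y v : V) (z : C) :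
  holomorphic_at f (y + z *: v) -> holomorphic_at (fun k : C => f (y + k *: v)) z.
Proof.
move=> hf.
have da (k : C) : is_diff k (fun k : C => y + k *: v) (fun h => h *: v).
  have D1 := is_diff_scalel k v.
  by apply: is_diff_eq; rewrite funeqE => h /=; rewrite !fctE add0r.
have ca (k : C) : (y + h *: v) @[h --> k] --> y + k *: v.
  by apply: (@cvgD _ V _ (nbhs k) _ (fun=> y) (fun h => h *: v)); [exact: cvg_cst|apply: cvgZr_tmp; exact: cvg_id].
apply: (@holI C (fun k : C => f (y + k *: v)) z (fun k h => 'd f (y + k *: v) (h *: v))).
have : \forall k \near z, differentiable f (y + k *: v) /\
    forall w, {for (y + k *: v), continuous (fun t => 'd f t w)}.
  exact: (ca z _ hf).
apply: filterS => k [df cf].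
have D : is_diff k (fun k : C => f (y + k *: v)) (fun h => 'd f (y + k *: v) (h *: v)).
  exact: (is_diff_comp (da k) (differentiableP df)).
split; first exact: ex_diff.
move=> h; rewrite diff_val; split => //.
exact: (@cvg_comp _ _ _ (fun z : C => y + z *: v) (fun t => 'd f t (h *: v)) _ _ _ (ca k) (cf (h *: v))).
Qed.

Lemma diff_C1 (W : normedModType C) (F : C -> W) z k : 'd F z k = k *: 'd F z (1 : C).
Proof. by rewrite -linearZ; congr ('d F z _); rewrite -[RHS]/(k * 1) mulr1. Qed.

Lemma diff_C1M (F : C -> C) z (k : C) : 'd F z k = k * 'd F z (1 : C).
Proof. exact: diff_C1. Qed.

Lemma hol_c1_C (F : C -> C) z : holomorphic_at F z -> c1 F z.
Proof.
move=> hF; split; first exact: hol_diff.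
move=> e e0; have := @hol_dcont _ F z 1 hF => /cvg_nrmP/(_ e e0) H.
apply: filterS2 hF H => y [dF _] h; split => // k.
have E : 'd F y k - 'd F z k = (k : C) * ('d F y (1 : C) - 'd F z (1 : C)).
  by rewrite mulrBr; congr (_ - _); exact: diff_C1M.
rewrite E.
rewrite nrmB in h. 
have h2 := nrmM k ('d F y (1 : C) - 'd F z (1 : C)).
have h3 := ler_wpM2l (nrm_ge0 k) (ltW h).
rewrite h2.
rewrite (mulrC e); exact: h3.
Qed.

End HolomorphicCalculus.

Section RowVectors.
Context {R : realType}.
Notation C := (Cx R).

Lemma nrm_coord m n (M : 'M[C]_(m, n)) i j : nrm (M i j : C) <= nrm M.
Proof.
rewrite -cr_le -!nrmE [X in _ <= X]/Num.Def.normr /= mx_normE -[X in X <= _]nngE num_le.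
exact: (le_bigmax _ (fun ij => `|M ij.1 ij.2|%:nng) (i, j)).
Qed.

Lemma nrm_mx_le m n (M : 'M[C]_(m, n)) (e : R) : 0 <= e ->
  (forall i j, nrm (M i j : C) <= e) -> nrm M <= e.
Proof.
move=> e0 H; rewrite -cr_le -nrmE [X in X <= _]/Num.Def.normr /=.
have [->|/mx_norm_neq0[ij ->]] := eqVneq (mx_norm M) 0; first by rewrite cr_ge0.
by rewrite nrmE cr_le.
Qed.

Lemma nrm_mx_lt m n (M : 'M[C]_(m, n)) (e : R) : 0 < e ->
  (forall i j, nrm (M i j : C) < e) -> nrm M < e.
Proof.
move=> e0 H; rewrite -cr_lt -nrmE [X in X < _]/Num.Def.normr /=.
have [->|/mx_norm_neq0[ij ->]] := eqVneq (mx_norm M) 0; first by rewrite cr_gt0.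
by rewrite nrmE cr_lt.
Qed.

Lemma diff_rV n (W : normedModType C) (f : 'rV[C]_n -> W) x k :
  'd f x k = \sum_i k 0 i *: 'd f x (delta_mx 0 i).
Proof.
rewrite {1}(row_sum_delta k) linear_sum.
by apply: eq_bigr => i _; rewrite linearZ.
Qed.

Lemma diff_rVM n (f : 'rV[C]_n -> C) x k :
  'd f x k = \sum_i (k 0 i : C) * ('d f x (delta_mx 0 i) : C).
Proof. exact: diff_rV. Qed.

Lemma nrm_sum (V : normedModType C) (I : finType) (F : I -> V) :
  nrm (\sum_i F i) <= \sum_i nrm (F i).
Proof.
elim/big_rec2: _ => [|i a v _ IH]; first by rewrite nrm0.
by apply: le_trans (nrmD _ _) _; rewrite lerD2l.
Qed.

Lemma hol_c1_rV n (f : 'rV[C]_n -> C) x : holomorphic_at f x -> c1 f x.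
Proof.
move=> hf; split; first exact: hol_diff.
move=> e e0.
have n0 : 0 < n.+1%:R :> R by rewrite ltr0n.
have e1 : 0 < e / n.+1%:R by rewrite divr_gt0.
have H : \forall y \near x, forall i : 'I_n,
    nrm ('d f x (delta_mx 0 i) - 'd f y (delta_mx 0 i)) < e / n.+1%:R.
  apply: (@filter_forall _ _ (fun i y => nrm ('d f x (delta_mx 0 i) -
    'd f y (delta_mx 0 i)) < e / n.+1%:R) (nbhs x)) => i.
  by have := @hol_dcont _ _ f x (delta_mx 0 i) hf => /cvg_nrmP; apply.
apply: filterS2 hf H => y [df _] Hy; split => // k.
have E : 'd f y k - 'd f x k = \sum_i (k 0 i : C) *
    (('d f y (delta_mx 0 i) : C) - 'd f x (delta_mx 0 i)).
  have aux (a u v : 'I_n -> C) p q : p = \sum_i a i * u i -> q = \sum_i a i * v i ->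
      p - q = \sum_i a i * (u i - v i).
    by move=> -> ->; rewrite -sumrB; apply: eq_bigr => i _; rewrite mulrBr.
  exact: (aux _ _ _ _ _ (diff_rVM f y k) (diff_rVM f x k)).
rewrite E; apply: le_trans (@nrm_sum C _ _) _.
apply: (@le_trans _ _ (\sum_(i < n) (e / n.+1%:R * nrm k))).
  apply: ler_sum => i _; rewrite nrmM mulrC.
  apply: ler_pM; [exact: nrm_ge0|exact: nrm_ge0| |exact: nrm_coord].
  by rewrite nrmB; exact: ltW.
rewrite sumr_const card_ord -[X in X <= _]mulr_natl.
have -> : e * nrm k = n.+1%:R * (e / n.+1%:R * nrm k).
  by rewrite [in RHS]mulrCA mulrA divfK ?gt_eqF.
by rewrite ler_wpM2r ?ler_nat // mulr_ge0 ?nrm_ge0 // ltW.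
Qed.

Lemma hol_dcont2 n (f : 'rV[C]_n -> C) x (T : Type) (F : set_system T)
    (FF : Filter F) (u v : T -> 'rV[C]_n) w :
  holomorphic_at f x -> u @ F --> x -> v @ F --> w ->
  ('d f (u t) (v t) : C) @[t --> F] --> ('d f x w : C).
Proof. by move=> /hol_c1_rV; exact: c1_dcont. Qed.

End RowVectors.

Section Circle.
Context {R : realType}.
Notation C := (Cx R).

Definition expi (t : R) : C := Complex (cos t) (sin t).

Definition ii : C := Complex 0 1.

Lemma nrm_expi t : nrm (expi t : C) = 1.
Proof.
apply: complexI; rewrite -!/(cr _) -nrmE [LHS]normc_def /= cos2Dsin2.
by rewrite sqrtr1.
Qed.

Lemma expi_neq0 t : expi t != 0.
Proof. by rewrite -nrm_gt0 nrm_expi ltr01. Qed.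

Lemma rder_expi t : rder (V := C) expi t (ii * expi t).
Proof.
move=> e e0; have e2 : 0 < e / 2 by rewrite divr_gt0.
have D (F : R -> R) (l : R) : is_derive t 1 F l ->
    \forall h \near (0 : R), `|F (t + h) - F t - h * l| <= e / 2 * `|h|.
  move=> dF.
  have cF : h^-1 *: ((F \o shift t) (h *: 1) - F t) @[h --> 0^'] --> l.
    have [/derivable_nbhsP _ E] := dF; rewrite -E.
    exact: (@ex_derive _ _ _ _ _ _ _ dF).
  have FF : Filter (dnbhs (0 : R)) by typeclasses eauto.
  have := iffLR (@cvg_absP R R (dnbhs (0 : R)) FF
    (fun h => h^-1 * (F (h * 1 + t) - F t)) l) cF _ e2.
  rewrite near_withinE => H0; have [d d0 Hd] := iffLR (@nbhs_absP R 0 _) H0; apply/nbhs_absP; exists d => // h hd.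
  have [->|h0] := eqVneq h 0; first by rewrite addr0 subrr mul0r subr0 normr0 mulr0.
  have := Hd h hd h0; rewrite /= mulr1 (addrC h) => H.
  have -> : F (t + h) - F t - h * l = - h * (l - h^-1 * (F (t + h) - F t)).
    by field.
  rewrite normrM normrN mulrC ler_wpM2r //; exact: ltW.
apply: filterS2 (D _ _ (is_derive_cos t)) (D _ _ (is_derive_sin t)) => h Hc Hs.
apply: le_trans (nrm_le_ReIm _) _.
rewrite cReB cImB -[cr h *: _]/(cr h * _) cReZ cImZ cReB cImB cReM cImM /=.
rewrite !mul0r !mul1r sub0r add0r; lra.
Qed.

Lemma expi2pi : expi (pi *+ 2) = expi 0.
Proof. by rewrite /expi cos2pi sin2pi cos0 sin0. Qed.

Lemma expi_cont : ccont expi.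
Proof. by move=> t _; exact: (rder_continuous (rder_expi t)). Qed.

End Circle.

Section CauchyFormula.
Context {R : realType}.
Notation C := (Cx R).

Lemma rder0_const (g : R -> C) (a b : R) : a <= b ->
  (forall s, a <= s <= b -> rder (V := C) g s 0) -> g a = g b.
Proof.
move=> ab dg.
pose h (s : R) : C := g (a + s * (b - a)).
have dh s : 0 <= s <= 1 -> rder (V := C) h s 0.
  move=> /andP[s0 s1].
  have ab0 : 0 <= b - a by rewrite subr_ge0.
  have K0 : 0 < b - a + 1 by lra.
  have H1 : 0 <= s * (b - a) by rewrite mulr_ge0.
  have H2 : s * (b - a) <= b - a by rewrite ler_piMl.
  have sab : a <= a + s * (b - a) <= b by apply/andP; split; lra.
  move=> e e0; have e1 : 0 < e / (b - a + 1) by rewrite divr_gt0.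
  have [d d0 Hd] := iffLR (nbhs_absP 0 _) (dg _ sab _ e1).
  apply/nbhs_absP; exists (d / (b - a + 1)); first by rewrite divr_gt0.
  move=> k; rewrite subr0 ltr_pdivlMr // => kd.
  have kk : `|k * (b - a)| <= `|k| * (b - a + 1).
    by rewrite normrM (ger0_norm ab0) ler_wpM2l //; lra.
  have := Hd (k * (b - a)); rewrite subr0 => /(_ (le_lt_trans kk kd)).
  rewrite !scaler0 /h mulrDl addrA => /le_trans; apply.
  have -> : e * `|k| = e / (b - a + 1) * (`|k| * (b - a + 1)).
    by field; rewrite gt_eqF.
  by rewrite ler_pM2l.
have := mvi dh (M := 0); rewrite mul0rn /h mul0r mul1r addr0 (addrC a (b - a)) subrK => H.
apply/esym/subr0_eq/(@nrm0_eq0 R C)/le_anti; rewrite nrm_ge0 andbT; apply: H.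
by move=> s _; rewrite nrm0.
Qed.

Let m1 (F : C -> C) (w : C) : C := Ic (fun t => F (0 + expi t *: w) * 1).

Lemma mean_diff0 (F : C -> C) (s : C) : s != 0 ->
  (forall z, nrm (z : C) = nrm (s : C) -> \forall y \near z, c1 F y) ->
  differentiable (m1 F) s /\ 'd (m1 F) s (1 : C) = 0.
Proof.
move=> s0 HF.
have n t : nrm (0 + expi t *: s : C) = nrm (s : C).
  by rewrite add0r nrmZ nrm_expi mul1r.
have cf t : @circ R t -> c1 F (0 + expi t *: s).
  by move=> _; apply: nbhs_singleton; apply: HF; exact: n.
have cfn t : @circ R t -> \forall y \near (0 + expi t *: s), c1 F y.
  by move=> _; apply: HF; exact: n.
have [D E] := Ic_param_diff (@ccont_cst R 0) (@expi_cont R)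
  (@ccont_cst R 1) cf cfn.
split; first exact: D.
have dt t : rder (V := C) (fun t => F (0 + expi t *: s)) t
    ('d F (0 + expi t *: s) (expi t *: (ii * s : C))).
  have dF : differentiable F (0 + expi t *: s).
    by case: (nbhs_singleton (HF _ (n t))).
  apply: (@rder_comp R C C F (fun t => 0 + expi t *: s)) dF _.
  move=> e e0.
  have e1 : 0 < e / (nrm (s : C) + 1) by rewrite divr_gt0 // ltr_wpDl ?nrm_ge0.
  apply: filterS (rder_expi t e1) => h Hh.
  have aux (p q w : C) : (0 + p * s) - (0 + q * s) - cr h * (w * (ii * s)) =
      (p - q - cr h * (ii * w)) * s by ring.
  have -> : (0 + expi (t + h) *: s) - (0 + expi t *: s) -
      cr h *: (expi t *: (ii * s : C)) =
      (expi (t + h) - expi t - cr h * (ii * expi t)) * s by exact: aux.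
  rewrite nrmM.
  have h1 := ler_wpM2r (nrm_ge0 (s : C)) Hh.
  apply: le_trans h1 _.
  have ns1 : 0 < nrm (s : C) + 1 by rewrite ltr_wpDl ?nrm_ge0.
  have h3 : e * `|h| = e / (nrm (s : C) + 1) * `|h| * (nrm (s : C) + 1).
    by field; rewrite gt_eqF.
  have h4 : nrm (s : C) <= nrm (s : C) + 1 by rewrite lerDl.
  have h5 : 0 <= e / (nrm (s : C) + 1) * `|h| by rewrite mulr_ge0 // ltW.
  by rewrite h3; exact: ler_wpM2l h5 _ _ h4.
have aux1 (X : R -> C) : (fun t => X t * 1) = X.
  by apply/funext => t; rewrite mulr1.
have cd : ccont (fun t => 'd F (0 + expi t *: s) (expi t *: (ii * s : C)) * 1).
  exact: (ccont_dd (@ccont_cst R 0) (@expi_cont R)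
    (@ccont_cst R 1) cf).
have cd' : ccont (fun t => 'd F (0 + expi t *: s) (expi t *: (ii * s : C))).
  exact: (eq_ind _ ccont cd _ (aux1 _)).
have I0 := Ic_der dt cd'.
have g02 : F (0 + expi (pi *+ 2) *: s) = F (0 + expi 0 *: s) by rewrite expi2pi.
have E2 : 'd (m1 F) s (ii * s : C) = 0.
  exact: (etrans (E (ii * s : C)) (etrans (congr1 Ic (aux1 _)) (I0 g02))).
have E3 : ii * s * 'd (m1 F) s (1 : C) = 0 by rewrite -E2; exact/esym/diff_C1M.
have ii0 : ii * s != 0 :> C.
  by rewrite mulf_neq0 // eq_complex /= oner_eq0 andbF.
by apply/eqP; move/eqP: E3; rewrite mulf_eq0 (negPf ii0).
Qed.

Lemma mean_const (F : C -> C) (a : R) : 0 < a <= 1 ->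
  (forall z, nrm (z : C) <= 1 -> z != 0 -> \forall y \near z, c1 F y) ->
  Ic (fun t => F (expi t * cr a)) = Ic (fun t => F (expi t)).
Proof.
move=> /andP[a0 a1] HF.
have H s : a <= s <= 1 -> rder (V := C) (fun s => m1 F (cr s)) s 0.
  move=> /andP[as_ s1]; have s0 : cr s != 0 by rewrite cr_eq0; apply/eqP; lra.
  have [|D E] := @mean_diff0 F (cr s) s0.
    move=> z zs; apply: HF; first by rewrite zs nrm_cr ger0_norm //; lra.
    by rewrite -nrm_gt0 zs nrm_gt0.
  rewrite -E; apply: (@rder_comp R C C (m1 F) (@cr R) s 1) D _.
  move=> e e0; apply/nbhs_absP; exists 1 => // h _.
  have -> : cr (s + h) - cr s - cr h *: (1 : C) = 0.
    by rewrite crD -[_ *: _]/(cr h * 1); ring.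
  by rewrite nrm0 mulr_ge0 // ltW.
have := rder0_const a1 H; rewrite /m1 cr1 => E.
have X (w : C) t : F (0 + expi t *: w) * 1 = F (expi t * w) by rewrite mulr1 add0r.
transitivity (Ic (fun t => F (0 + expi t *: cr a) * 1)).
  by apply: Ic_ext => t _; rewrite X.
by rewrite E; apply: Ic_ext => t _; rewrite X mulr1.
Qed.

Lemma expiV_cont : @ccont R (fun t => (expi t)^-1).
Proof.
move=> t ct; apply: (@cvgV C); [exact: expi_neq0|exact: (@expi_cont R t ct)].
Qed.

Lemma Ic_expiV : Ic (fun t => (expi t)^-1 : C) = 0.
Proof.
have dV t : rder (V := C) (fun t => (expi t)^-1 : C) t (- ii * (expi t)^-1).
  have d1 : differentiable (fun z : C => z) (expi t) by [].
  have dV := differentiableV d1 (expi_neq0 t).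
  have E : 'd (fun z : C => z^-1) (expi t) (ii * expi t) = - ii * (expi t)^-1.
    have E0 : 'd (fun z : C => z) (expi t) (ii * expi t : C) = ii * expi t.
      by have -> : 'd (fun z : C => z) (expi t) = id :> (C -> C) by exact: diff_val.
    have E1 := congr1 (fun h => h (ii * expi t : C)) (diffV d1 (expi_neq0 t)).
    have aux (u w k : C) : u != 0 -> k = w * u -> - u ^- 2 * k = - w * u^-1.
      by move=> u0 ->; field.
    exact: etrans E1 (aux _ _ _ (expi_neq0 t) E0).
  apply: rder_eq E; exact: (@rder_comp R C C (fun z : C => z^-1) expi) dV (rder_expi t).
have cV : @ccont R (fun t => - ii * (expi t)^-1).
  exact: (ccontM (@ccont_cst R (- ii)) expiV_cont).
have := Ic_der dV cV; rewrite expi2pi => /(_ erefl).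
have -> := IcZ (- ii) expiV_cont.
move=> /eqP; rewrite mulf_eq0 oppr_eq0 => /orP[|/eqP //].
by rewrite eq_complex /= oner_eq0 andbF.
Qed.

Lemma hol_id (z : C) : holomorphic_at (fun w : C => w) z.
Proof.
apply: (@holI R C (fun w : C => w) z (fun _ k => k)); apply: filterE => w.
split; first exact: (@ex_diff _ _ _ _ _ _ id (is_diff_id w)).
move=> v; split; last by apply: cst_continuous.
by have -> : 'd (fun z : C => z) w = id :> (C -> C) by exact: diff_val.
Qed.

Lemma nrm_small (x : C) : (forall e : R, 0 < e -> nrm (x : C) <= e) -> x = 0.
Proof.
move=> H; apply: (@nrm0_eq0 R C); apply/le_anti; rewrite nrm_ge0 andbT.
by apply/ler_addgt0Pl => e e0; rewrite addr0; exact: H.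
Qed.

Theorem cauchy_formula (V : normedModType C) (f : V -> C) (y v : V) :
  (forall z : C, nrm (z : C) <= 1 -> holomorphic_at f (y + z *: v)) ->
  Ic (fun t => f (y + expi t *: v) * (expi t)^-1) = cr (pi *+ 2) * 'd f y v.
Proof.
move=> Hf; pose F (z : C) : C := f (y + z *: v) * z^-1.
have HF z : nrm (z : C) <= 1 -> z != 0 -> holomorphic_at F z.
  move=> z1 z0; apply: holM; first exact: hol_affine (Hf z z1).
  exact: (holV (hol_id z) z0).
have HFc z : nrm (z : C) <= 1 -> z != 0 -> \forall y \near z, c1 F y.
  by move=> z1 z0; apply: filterS (hol_near (HF z z1 z0)) => w; exact: hol_c1_C.
apply/subr0_eq/nrm_small => e e0.
have K0 : 0 < pi *+ 4 * (nrm v + 1) :> R.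
  by apply: mulr_gt0; [rewrite pmulrn_lgt0 // pi_gt0|rewrite ltr_wpDl ?nrm_ge0].
have e1 : 0 < e / (pi *+ 4 * (nrm v + 1)) by rewrite divr_gt0.
have hy : holomorphic_at f y.
  by have := Hf 0; rewrite nrm0 scale0r addr0; apply; exact: ler01.
have [d d0 Hd] := iffLR (nbhs_nrmP 0 _) (diff_eps (hol_diff hy) e1).
have nv0 : 0 < nrm v + 1 by rewrite ltr_wpDl ?nrm_ge0.
pose a := Num.min 1 (d / (nrm v + 1)).
have a0 : 0 < a by rewrite lt_min ltr01 divr_gt0.
have a1 : a <= 1 by rewrite ge_min lexx.
have ad : a * nrm v < d.
  have h1 : a * (nrm v + 1) <= d by rewrite -ler_pdivlMr // ge_min lexx orbT.
  have : a * (nrm v + 1) = a * nrm v + a by ring.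
  lra.
have ca0 : cr a != 0 by rewrite cr_eq0 gt_eqF.
have <- : Ic (fun t => F (expi t * cr a)) = Ic (fun t => f (y + expi t *: v) * (expi t)^-1).
  by apply: (@mean_const F); [rewrite a0|exact: HFc].
have nea t : nrm (expi t * cr a : C) = a by rewrite nrmM nrm_expi mul1r nrm_cr gtr0_norm.
have c1' : ccont (fun t => F (expi t * cr a)).
  move=> t ct; apply: (@continuous_comp _ _ _ (fun t => expi t * cr a) F).
    by apply: (@cvgM C); [exact: (@expi_cont R t ct)|exact: cvg_cst].
  by apply: (hol_cont (HF _ _ _)); rewrite ?nea // mulf_neq0 ?expi_neq0.
have c2 := ccontM (@ccont_cst R (f y / cr a)) expiV_cont.
have c3 := @ccont_cst R ('d f y v).
have E1 := IcZ (f y / cr a) expiV_cont; rewrite Ic_expiV mulr0 in E1.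
have E2 := Ic_cst ('d f y v).
have c4 : ccont (fun t => F (expi t * cr a) - 'd f y v).
  by move=> t ct; apply: (@continuousB _ C); [exact: c1'|exact: c3].
have E3 := IcB c1' c3; rewrite E2 in E3.
have E4 := IcB c4 c2; rewrite E1 E3 subr0 in E4.
rewrite -E4.
have -> : e = pi *+ 4 * (e / (pi *+ 4 * (nrm v + 1)) * (nrm v + 1)).
  have X (p q r : R) : 0 < p * r -> p * (q / (p * r) * r) = q.
    by move=> pr; rewrite (mulrC _ r) mulrA mulrC divfK ?gt_eqF.
  by rewrite X.
apply: Ic_bound.
  by move=> t ct; apply: (@continuousB _ C); [exact: c4|exact: c2].
move=> t ct; pose h := (expi t * cr a) *: v.
have nh : nrm h = a * nrm v by rewrite nrmZ nea.
have := Hd h; rewrite subr0 nh => /(_ ad) Hh.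
have dh : 'd f y h = (expi t * cr a) * 'd f y v by exact: linearZ.
have X (A B D u w : C) : u != 0 -> w != 0 ->
    A * (u * w)^-1 - D - (B / w) * u^-1 = (A - B - (u * w) * D) * (u * w)^-1.
  by move=> u0 w0; field; rewrite u0 w0.
rewrite /F.
have -> := X (f (y + h)) (f y) ('d f y v) _ _ (expi_neq0 t) ca0.
rewrite -dh nrmM nrmV nea ler_pdivrMr //.
have e1' := ltW e1.
have : a * nrm v <= a * (nrm v + 1) by rewrite ler_pM2l // lerDl.
move=> /(ler_wpM2l e1'); rewrite mulrA [in X in _ -> X]mulrAC -mulrA => H2.
by apply: le_trans Hh _; apply: le_trans H2 _; rewrite mulrA.
Qed.

End CauchyFormula.

Section Regularity.
Context {R : realType}.
Notation C := (Cx R).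

Lemma diff_near_eq (V W : normedModType C) (f g : V -> W) x :
  (\forall y \near x, f y = g y) -> differentiable f x ->
  differentiable g x /\ 'd g x = 'd f x :> (V -> W).
Proof.
move=> fg df; apply: diffI_eps; first exact: diff_continuous.
move=> e e0; have /nbhs_nrmP[d d0 Hd] := fg.
have fx : f x = g x := nbhs_singleton fg.
have [d1 d10 H1] := iffLR (nbhs_nrmP 0 _) (diff_eps df e0).
apply/nbhs_nrmP; exists (Num.min d d1); first by rewrite lt_min d0.
move=> h; rewrite lt_min => /andP[hd hd1]; have := H1 h hd1.
by rewrite fx Hd // addrAC subrr add0r -(subr0 h).
Qed.

Lemma hol_near_eq (V : normedModType C) (f g : V -> C) x :
  (\forall y \near x, f y = g y) -> holomorphic_at f x -> holomorphic_at g x.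
Proof.
move=> fg hf; apply: (@holI R V g x (fun y v => 'd f y v)).
apply: filterS2 (near_join fg) hf => y fgy [df cf].
have [dg E] := diff_near_eq fgy df.
split; first exact: dg.
by move=> v; split; [exact: (congr1 (fun h => h v) E)|exact: cf].
Qed.

Lemma segment_bound (V : normedModType C) (f : V -> C) (x y : V) (M : R) :
  (forall s : R, 0 <= s <= 1 -> differentiable f (x + cr s *: (y - x)) /\
    nrm ('d f (x + cr s *: (y - x)) (y - x) : C) <= M) ->
  nrm (f y - f x : C) <= M *+ 2.
Proof.
move=> H.
pose g (s : R) : C := f (x + cr s *: (y - x)).
have g1 : g 1 = f y by rewrite /g cr1 scale1r addrC subrK.
have g0 : g 0 = f x by rewrite /g cr0 scale0r addr0.
rewrite -g1 -g0.
apply: (@mvi R g (fun s => 'd f (x + cr s *: (y - x)) (y - x)) M).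
  move=> s /H[df _]; apply: (@rder_comp R V C f (fun s => x + cr s *: (y - x))) df _.
  exact: rder_affine.
by move=> s /H[].
Qed.

Lemma diff0_const (V : normedModType C) (f : V -> C) (x y : V) :
  (forall s : R, 0 <= s <= 1 -> differentiable f (x + cr s *: (y - x)) /\
    'd f (x + cr s *: (y - x)) (y - x) = 0 :> C) -> f y = f x.
Proof.
move=> H; apply/subr0_eq/nrm_small => e e0.
have := @segment_bound V f x y 0; rewrite mul0rn => H1.
apply: le_trans (ltW e0); apply: H1 => s /H[df E]; split; first exact: df.
by rewrite E nrm0.
Qed.

Lemma diff0_near_const (V : normedModType C) (f : V -> C) (x : V) :
  (\forall y \near x, differentiable f y /\ forall v, 'd f y v = 0 :> C) ->
  \forall y \near x, f y = f x.
Proof.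
move=> /nbhs_nrmP[d d0 Hd]; apply/nbhs_nrmP; exists d => // y yd.
apply: diff0_const => s /andP[s0 s1].
have [] := Hd (x + cr s *: (y - x)); last by move=> df E; split; [exact: df|exact: E].
rewrite (addrC x) addrK nrmZ nrm_cr ger0_norm //; apply: le_lt_trans yd.
by rewrite ler_piMl ?nrm_ge0.
Qed.

Section Rn.
Variable n : nat.
Implicit Types (f : 'rV[C]_n -> C) (x v w : 'rV[C]_n).

Let rep (f : 'rV[C]_n -> C) (v : 'rV[C]_n) (y : 'rV[C]_n) : C :=
  Ic (fun t => f (expi t *: v + 1 *: y) * (expi t)^-1).

Lemma rep_hol f x v :
  (forall z : C, nrm (z : C) <= 1 -> holomorphic_at f (x + z *: v)) ->
  differentiable (rep f v) x /\ forall w,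
    'd (rep f v) x w = Ic (fun t => 'd f (expi t *: v + 1 *: x) (1 *: w) * (expi t)^-1) /\
    (Ic (fun t => 'd f (expi t *: v + 1 *: z) (1 *: w) * (expi t)^-1) : C) @[z --> x]
     --> (Ic (fun t => 'd f (expi t *: v + 1 *: x) (1 *: w) * (expi t)^-1) : C).
Proof.
move=> H.
have He t : holomorphic_at f (expi t *: v + (1 : C) *: x).
  by rewrite addrC scale1r; apply: H; rewrite nrm_expi.
have cb t : @circ R t -> {for t, continuous (fun t => expi t *: v)}.
  by move=> ct; apply: cvgZr_tmp; exact: (@expi_cont R t ct).
have ca := @ccont_cst R 1.
have cf t : @circ R t -> c1 f (expi t *: v + (1 : C) *: x).
  by move=> _; exact: hol_c1_rV.
have cfn t : @circ R t -> \forall y \near expi t *: v + (1 : C) *: x, c1 f y.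
  by move=> _; apply: filterS (hol_near (He t)) => w; exact: hol_c1_rV.
have [D E] := Ic_param_diff cb ca (@expiV_cont R) cf cfn.
split; first exact: D.
move=> w; split; first exact: E.
exact: (Ic_dd_param_continuous cb ca (@expiV_cont R) cf cfn).
Qed.

Lemma hol_disc f x v : holomorphic_at f x -> exists2 a : R, 0 < a &
  \forall y \near x, forall z : C, nrm (z : C) <= 1 ->
    holomorphic_at f (y + z *: (cr a *: v)).
Proof.
move=> /hol_near/nbhs_nrmP[d d0 Hd].
have nv0 : 0 < nrm v + 1 by rewrite ltr_wpDl ?nrm_ge0.
exists (d / 2 / (nrm v + 1)); first by rewrite !divr_gt0.
apply/nbhs_nrmP; exists (d / 2); first by rewrite divr_gt0.
move=> y yd z z1; apply: Hd.
rewrite addrAC; apply: le_lt_trans (nrmD _ _) _.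
rewrite !nrmZ nrm_cr gtr0_norm ?divr_gt0 //.
set a := d / 2 / _.
have a0 : 0 < a by rewrite !divr_gt0.
have h1 : a * (nrm v + 1) = d / 2 by rewrite divfK // gt_eqF.
have h2 : a * nrm v <= a * (nrm v + 1) by rewrite ler_pM2l // lerDl.
have h3 : 0 <= a * nrm v by rewrite mulr_ge0 ?nrm_ge0 // ltW.
have := ler_wpM2r h3 z1; rewrite mul1r; lra.
Qed.

Lemma diff_rep f (a : R) y v : 0 < a ->
  (forall z : C, nrm (z : C) <= 1 -> holomorphic_at f (y + z *: (cr a *: v))) ->
  'd f y v = (cr (pi *+ 2) * cr a)^-1 * rep f (cr a *: v) y.
Proof.
move=> a0 H.
have E := cauchy_formula H.
have E1 : rep f (cr a *: v) y = Ic (fun t => f (y + expi t *: (cr a *: v)) * (expi t)^-1).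
  by apply: Ic_ext => t _; rewrite scale1r addrC.
have p0 : cr (pi *+ 2) * cr a != 0 :> C.
  by rewrite mulf_neq0 // cr_eq0 gt_eqF // pi2_gt0.
have X (p k r : C) : p != 0 -> r = p * k -> k = p^-1 * r.
  by move=> q0 ->; rewrite mulKf.
apply: X => //; rewrite E1 E -mulrA; congr (_ * _).
exact: linearZ.
Qed.

Lemma hol_deriv f x v : holomorphic_at f x -> holomorphic_at (fun y => 'd f y v : C) x.
Proof.
move=> hf; have [a a0 Ha] := hol_disc v hf.
pose k : C := (cr (pi *+ 2) * cr a)^-1.
apply: (@hol_near_eq _ (fun y => k * rep f (cr a *: v) y)).
  by apply: filterS Ha => y Hy; exact/esym/diff_rep.
apply: holM; first exact: hol_cst.
apply: (@holI R _ (rep f (cr a *: v)) x (fun y w =>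
   Ic (fun t => 'd f (expi t *: (cr a *: v) + 1 *: y) (1 *: w) * (expi t)^-1))).
by apply: filterS Ha => y Hy; exact: rep_hol.
Qed.

Lemma schwarz f x v w : holomorphic_at f x ->
  'd (fun y => 'd f y v : C) x w = 'd (fun y => 'd f y w : C) x v.
Proof.
move=> hf; have [a a0 Ha] := hol_disc v hf.
pose k : C := (cr (pi *+ 2) * cr a)^-1.
have Hx := nbhs_singleton Ha.
have ne : \forall y \near x, k * rep f (cr a *: v) y = 'd f y v.
  by apply: filterS Ha => y Hy; exact/esym/diff_rep.
have [D E] := rep_hol Hx.
have dk : differentiable (fun y => k * rep f (cr a *: v) y) x.
  exact: (@differentiableZ _ _ _ (rep f (cr a *: v)) k x D).
have [_ E1] := diff_near_eq ne dk.
have E2 : 'd (fun y => k * rep f (cr a *: v) y) x w = k * 'd (rep f (cr a *: v)) x w.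
  exact: (congr1 (fun h => h w) (diffZ k D)).
have [E3 _] := E w.
have H2 (z : C) : nrm (z : C) <= 1 ->
    holomorphic_at (fun y => 'd f y w : C) (x + z *: (cr a *: v)).
  by move=> z1; apply: hol_deriv; exact: Hx.
have E4 := diff_rep a0 H2.
have E6 : rep (fun y => 'd f y w : C) (cr a *: v) x =
   Ic (fun t => 'd f (expi t *: (cr a *: v) + 1 *: x) (1 *: w) * (expi t)^-1).
  by apply: Ic_ext => t _; congr (_ * _); congr ('d f _ _); rewrite scale1r.
have E7 := etrans E4 (congr1 (fun z : C => k * z) E6).
exact: etrans (congr1 (fun h => h w) E1)
  (etrans E2 (etrans (congr1 (fun z : C => k * z) E3) (esym E7))).
Qed.

Theorem liouville f (M : R) : (forall y, holomorphic_at f y) ->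
  (forall y, nrm (f y : C) <= M) -> forall x y, f x = f y.
Proof.
move=> hf bM.
have d0 y v : 'd f y v = 0.
  apply: nrm_small => e e0.
  have M0 : 0 <= M := le_trans (nrm_ge0 _) (bM 0).
  pose a := (M + 1) *+ 4 / e.
  have a0 : 0 < a by rewrite divr_gt0 // pmulrn_lgt0 // ltr_wpDl.
  have E := @cauchy_formula R _ f y (cr a *: v) (fun z _ => hf _).
  have Ea : 'd f y (cr a *: v) = cr a * 'd f y v by exact: linearZ.
  have cI : ccont (fun t => f (y + expi t *: (cr a *: v)) * (expi t)^-1).
    apply: ccontM; last exact: expiV_cont.
    move=> t ct; apply: (@continuous_comp _ _ _ (fun t => y + expi t *: (cr a *: v)) f).
      apply: (@cvgD _ _ _ (nbhs t) _ (fun=> y) (fun t => expi t *: (cr a *: v))).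
        exact: cvg_cst.
      by apply: cvgZr_tmp; exact: (@expi_cont R t ct).
    exact: hol_cont.
  have B : forall t, @circ R t -> nrm (f (y + expi t *: (cr a *: v)) * (expi t)^-1 : C) <= M.
    by move=> t _; rewrite nrmM nrmV nrm_expi invr1 mulr1.
  have := Ic_bound cI B; rewrite E Ea !nrmM !nrm_cr gtr0_norm ?pi2_gt0 // gtr0_norm //.
  move=> H.
  have : pi *+ 2 * (a * nrm ('d f y v : C)) <= pi *+ 2 * (M *+ 2).
    by apply: le_trans H _; lra.
  rewrite ler_pM2l ?pi2_gt0 // => H1.
  rewrite -(ler_pM2l a0); apply: le_trans H1 _.
  rewrite /a divfK ?gt_eqF //; lra.
move=> x y; apply: diff0_const => s _; split; first exact: hol_diff.
exact: d0.
Qed.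

End Rn.

End Regularity.

Section MatrixValued.
Context {R : realType}.
Notation C := (Cx R).

Lemma diff_coord (V : normedModType C) m n (F : V -> 'M[C]_(m, n)) x i j :
  differentiable F x ->
  differentiable (fun y => F y i j : C) x /\
  forall v, 'd (fun y => F y i j : C) x v = ('d F x v) i j :> C.
Proof.
move=> dF.
pose L v : C := ('d F x v) i j.
have lL : linear L by move=> k u v; rewrite /L linearP !mxE.
pose gL : {linear V -> C} := HB.pack L (GRing.isLinear.Build C V C _ _ lL).
have cL : continuous gL.
  move=> v; apply: (@continuous_comp _ _ _ ('d F x) (fun M : 'M[C]_(m, n) => M i j : C) v).
    by apply: diff_continuous.
  exact: coord_continuous.
have [] := @diffI_eps R V C (fun y => F y i j) x gL cL; last first.
  by move=> D E; split; [exact: D|move=> v; exact: (congr1 (fun h => h v) E)].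
move=> e e0; apply: filterS (diff_eps dF e0) => h; apply: le_trans.
have -> : F (x + h) i j - F x i j - gL h = (F (x + h) - F x - 'd F x h) i j.
  by rewrite !mxE.
exact: nrm_coord.
Qed.

Lemma diff_mx (V : normedModType C) m n (F : V -> 'M[C]_(m, n)) x :
  (forall i j, differentiable (fun y => F y i j : C) x) ->
  differentiable F x.
Proof.
move=> dF.
pose L v : 'M[C]_(m, n) := \matrix_(i, j) ('d (fun y => F y i j : C) x v : C).
have lL : linear L.
  move=> k u v; apply/matrixP => i j; rewrite !mxE linearP; congr (_ + _).
pose gL : {linear V -> 'M[C]_(m, n)} := HB.pack L (GRing.isLinear.Build C V 'M[C]_(m, n) _ _ lL).
have cL : continuous gL.
  move=> v; apply/continuous_nrmP => e e0.
  have : \forall t \near v, forall ij : 'I_m * 'I_n, nrm (L t ij.1 ij.2 - L v ij.1 ij.2 : C) < e.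
    apply: (@filter_forall _ _ (fun (ij : 'I_m * 'I_n) t =>
      nrm (L t ij.1 ij.2 - L v ij.1 ij.2 : C) < e) (nbhs v)) => -[i j] /=.
    have : {for v, continuous ('d (fun y => F y i j : C) x)} by exact: diff_continuous.
    by move=> /continuous_nrmP/(_ _ e0); apply: filterS => t; rewrite !mxE.
  apply: filterS => t Ht; apply: nrm_mx_lt => // i j.
  by have := Ht (i, j); rewrite !mxE.
have [] := @diffI_eps R V _ F x gL cL; last by [].
move=> e e0.
have : \forall h \near (0 : V), forall ij : 'I_m * 'I_n,
   nrm (F (x + h) ij.1 ij.2 - F x ij.1 ij.2 - L h ij.1 ij.2 : C) <= e * nrm h.
  apply: (@filter_forall _ _ (fun (ij : 'I_m * 'I_n) h =>
      nrm (F (x + h) ij.1 ij.2 - F x ij.1 ij.2 - L h ij.1 ij.2 : C) <= e * nrm h)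
      (nbhs (0 : V))) => -[i j] /=.
  by apply: filterS (diff_eps (dF i j) e0) => h; rewrite mxE.
apply: filterS => h Hh; apply: nrm_mx_le; first by rewrite mulr_ge0 ?nrm_ge0 // ltW.
by move=> i j; have := Hh (i, j); rewrite !mxE.
Qed.

Lemma hol_coord (V : normedModType C) m n (F : V -> 'M[C]_(m, n)) x i j :
  holomorphic_at F x -> holomorphic_at (fun y => F y i j : C) x.
Proof.
move=> hF; apply: (@holI R V (fun y => F y i j) x (fun y v => ('d F y v) i j)).
apply: filterS hF => y [dF cF].
have [D E] := diff_coord i j dF.
split; first exact: D.
move=> v; split; first exact: E.
apply: (@cvg_comp _ _ _ (fun z => 'd F z v) (fun M : 'M[C]_(m, n) => M i j : C) _ _ _ (cF v)).
exact: coord_continuous.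
Qed.

Lemma cvg_mx (T : Type) (FF : set_system T) (fF : Filter FF) m n (G : T -> 'M[C]_(m, n)) (l : 'M[C]_(m, n)) :
  (forall i j, (G t i j : C) @[t --> FF] --> (l i j : C)) -> G @ FF --> l.
Proof.
move=> H; apply/cvg_nrmP => e e0.
have : \forall t \near FF, forall ij : 'I_m * 'I_n, nrm (l ij.1 ij.2 - G t ij.1 ij.2 : C) < e.
  apply: (@filter_forall _ _ (fun (ij : 'I_m * 'I_n) t =>
      nrm (l ij.1 ij.2 - G t ij.1 ij.2 : C) < e) FF) => -[i j] /=.
  by have /cvg_nrmP/(_ _ e0) := H i j.
apply: filterS => t Ht; apply: nrm_mx_lt => // i j.
by have := Ht (i, j); rewrite !mxE.
Qed.

Lemma hol_mx (V : normedModType C) m n (F : V -> 'M[C]_(m, n)) x :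
  (forall i j, holomorphic_at (fun y => F y i j : C) x) -> holomorphic_at F x.
Proof.
move=> H.
have H' : \forall y \near x, forall ij : 'I_m * 'I_n, differentiable (fun y => F y ij.1 ij.2 : C) y
   /\ forall v, {for y, continuous (fun t => 'd (fun y => F y ij.1 ij.2 : C) t v)}.
  apply: (@filter_forall _ _ (fun (ij : 'I_m * 'I_n) y => differentiable (fun y => F y ij.1 ij.2 : C) y
   /\ forall v, {for y, continuous (fun t => 'd (fun y => F y ij.1 ij.2 : C) t v)}) (nbhs x)).
  by move=> -[i j]; exact: H.
apply: filterS2 H' (near_join H') => y H1 H2; split.
  by apply: diff_mx => i j; case: (H1 (i, j)).
move=> v; rewrite /prop_for /continuous_at; apply: cvg_mx => i j.
have dFy : differentiable F y by apply: diff_mx => a b; case: (H1 (a, b)).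
have E : ('d F y v) i j = 'd (fun y => F y i j : C) y v.
  by have [_ ->] := diff_coord i j dFy.
rewrite E; apply: cvg_trans ((H1 (i, j)).2 v); apply: near_eq_cvg.
apply: filterS H2 => z H2.
have dFz : differentiable F z by apply: diff_mx => a b; case: (H2 (a, b)).
by have [_ ->] := diff_coord i j dFz.
Qed.

Lemma hol_comp (V : normedModType C) n (g : V -> 'rV[C]_n) (f : 'rV[C]_n -> C) x :
  holomorphic_at g x -> holomorphic_at f (g x) -> holomorphic_at (fun y => f (g y)) x.
Proof.
move=> hg hf.
have cg : {for x, continuous g}.
  by apply: differentiable_continuous; case: (nbhs_singleton hg).
have hf' : \forall y \near x, holomorphic_at f (g y).
  exact: (cg (fun z => holomorphic_at f z) (hol_near hf)).
apply: (@holI R V (fun y => f (g y)) x (fun y v => 'd f (g y) ('d g y v))).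
apply: filterS2 hf' hg => y hfy [dg cdg].
have dfy := hol_diff hfy.
split; first exact: (differentiable_comp dg dfy).
move=> v; split; first exact: (congr1 (fun h => h v) (diff_comp dg dfy)).
have cgy : g z @[z --> y] --> g y by exact: differentiable_continuous.
exact: (@hol_dcont2 R n f (g y) V (nbhs y) _ g (fun z => 'd g z v) ('d g y v) hfy cgy (cdg v)).
Qed.

Lemma hol_comp_mx (V : normedModType C) n p q (g : V -> 'rV[C]_n) (F : 'rV[C]_n -> 'M[C]_(p, q)) x :
  holomorphic_at g x -> holomorphic_at F (g x) -> holomorphic_at (fun y => F (g y)) x.
Proof.
move=> hg hF; apply: hol_mx => i j.
exact: (@hol_comp V n g (fun z => F z i j) x hg (@hol_coord _ _ _ F (g x) i j hF)).
Qed.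

Lemma linear_rV_continuous n (V : normedModType C) (L : {linear 'rV[C]_n -> V}) :
  continuous L.
Proof.
pose K := \sum_i nrm (L (delta_mx 0 i)).
have K0 : 0 < K + 1 by rewrite ltr_wpDl ?sumr_ge0 // => i _; exact: nrm_ge0.
have B k : nrm (L k) <= (K + 1) * nrm k.
  rewrite {1}(row_sum_delta k) linear_sum.
  apply: le_trans (nrm_sum _) _.
  apply: (@le_trans _ _ (K * nrm k)); last by rewrite ler_wpM2r ?nrm_ge0 ?lerDl.
  rewrite mulr_suml; apply: ler_sum => i _; rewrite linearZ nrmZ mulrC.
  by apply: ler_wpM2l; [exact: nrm_ge0|exact: nrm_coord].
move=> v; apply/continuous_nrmP => e e0; apply/nbhs_nrmP.
exists (e / (K + 1)); first by rewrite divr_gt0.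
move=> y yv; rewrite -linearB; apply: le_lt_trans (B _) _.
by rewrite mulrC -ltr_pdivlMr.
Qed.

Lemma hol_linear n (V : normedModType C) (L : {linear 'rV[C]_n -> V}) x :
  holomorphic_at L x.
Proof.
apply: filterE => y; split.
  exact: linear_differentiable (@linear_rV_continuous _ _ L).
move=> v.
have E0 z : 'd L z v = L v.
  exact: (congr1 (fun h => h v) (diff_lin z (@linear_rV_continuous _ _ L))).
have -> : (fun t => 'd L t v) = (fun=> L v) by apply/funext => t; exact: E0.
exact: cst_continuous.
Qed.

End MatrixValued.

(** * Lattices and periodic functions *)

Section Lattices.
Context {R : realType}.
Notation C := (Cx R).

Lemma nrm_lip (V : normedModType C) (u v : V) : `|nrm u - nrm v| <= nrm (u - v).
Proof.
have t1 := nrmD (u - v) v; have t2 := nrmD (v - u) u.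
rewrite subrK in t1; rewrite subrK nrmB in t2.
by rewrite ler_norml; apply/andP; split; lra.
Qed.

Section Periods.
Variables (n : nat) (T : Type) (p : 'rV[C]_n -> T).

Lemma periods0 : periods p 0. Proof. by move=> z; rewrite addr0. Qed.

Lemma periodsD l k : periods p l -> periods p k -> periods p (l + k).
Proof. by move=> pl pk z; rewrite addrA pk pl. Qed.

Lemma periodsN l : periods p l -> periods p (- l).
Proof. by move=> pl z; have := pl (z - l); rewrite subrK => ->. Qed.

Lemma periodsZ l (m : int) : periods p l -> periods p (m%:~R *: l).
Proof.
move=> pl; have H k : periods p ((k%:R : C) *: l).
  elim: k => [|k IH]; first by rewrite scale0r; exact: periods0.
  by rewrite -natr1 scalerDl scale1r; exact: periodsD.
case: m => k; first exact: H.
by rewrite NegzE mulrNz scaleNr; apply: periodsN; exact: H.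
Qed.

Lemma periods_int m (Z : 'M[C]_(m, n)) (k : 'rV[int]_m) :
  (forall a, periods p (row a Z)) -> periods p (map_mx intr k *m Z).
Proof.
move=> H; rewrite mulmx_sum_row.
elim/big_rec: _ => [|i x _ IH]; first exact: periods0.
by apply: periodsD IH; rewrite mxE; exact: periodsZ.
Qed.

End Periods.

Definition rbasis n (Z : 'M[C]_(n + n, n)) : Prop :=
  forall a : 'rV[R]_(n + n), map_mx cr a *m Z = 0 -> a = 0.

Section Coordinates.
Variables (n : nat) (Z : 'M[C]_(n + n, n)).
Hypothesis rZ : rbasis Z.

Let ReIm m (v : 'M[C]_(m, n)) : 'M[R]_(m, n + n) :=
  row_mx (map_mx (fun z : C => Re z) v) (map_mx (fun z : C => Im z) v).

Lemma ReIm_inj m (u v : 'M[C]_(m, n)) : ReIm u = ReIm v -> u = v.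
Proof.
move=> /eq_row_mx[/matrixP hR /matrixP hI]; apply/matrixP => i j.
by have := hR i j; have := hI i j; rewrite !mxE; case: (u i j) (v i j) => a b [c d] /= -> ->.
Qed.

Lemma Re_sum (I : finType) (F : I -> C) : Re (\sum_i F i) = \sum_i Re (F i).
Proof. exact: (big_morph (fun z : C => Re z) cReD erefl). Qed.

Lemma Im_sum (I : finType) (F : I -> C) : Im (\sum_i F i) = \sum_i Im (F i).
Proof. exact: (big_morph (fun z : C => Im z) cImD erefl). Qed.

Lemma ReIm_mul m (a : 'M[R]_(m, n + n)) : ReIm (map_mx cr a *m Z) = a *m ReIm Z.
Proof.
rewrite mul_mx_row; congr row_mx; apply/matrixP => i j; rewrite !mxE.
  by rewrite Re_sum; apply: eq_bigr => k _; rewrite !mxE cReZ.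
by rewrite Im_sum; apply: eq_bigr => k _; rewrite !mxE cImZ.
Qed.

Lemma ReIm0 m : ReIm (0 : 'M[C]_(m, n)) = 0.
Proof.
by rewrite /ReIm -[RHS]row_mx0; congr row_mx; apply/matrixP => i j; rewrite !mxE.
Qed.

Lemma ReIm_unit : ReIm Z \in unitmx.
Proof.
rewrite -row_free_unit; apply/inj_row_free => v vZ; apply: rZ.
by apply: ReIm_inj; rewrite ReIm_mul vZ ReIm0.
Qed.

Definition rcoord (v : 'rV[C]_n) : 'rV[R]_(n + n) := ReIm v *m invmx (ReIm Z).

Lemma rcoordK v : map_mx cr (rcoord v) *m Z = v.
Proof. by apply: ReIm_inj; rewrite ReIm_mul mulmxKV // ReIm_unit. Qed.

Lemma mul_rcoord a : rcoord (map_mx cr a *m Z) = a.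
Proof. by rewrite /rcoord ReIm_mul mulmxK // ReIm_unit. Qed.

Lemma rcoord_bound : exists2 K : R, 0 < K & forall v i, `|rcoord v 0 i| <= K * nrm v.
Proof.
pose S := \sum_i \sum_j `|invmx (ReIm Z) i j|.
have S0 : 0 <= S by apply: sumr_ge0 => i _; apply: sumr_ge0.
exists (S + 1); first by rewrite ltr_wpDl.
move=> v i; rewrite mxE; apply: le_trans (ler_norm_sum _ _ _) _.
apply: (@le_trans _ _ (\sum_j nrm v * `|invmx (ReIm Z) j i|)).
  apply: ler_sum => j _; rewrite normrM ler_wpM2r //.
  rewrite mxE; case: (fintype.split j) => k; rewrite mxE.
    by apply: le_trans (cr_Re_normr _) _; exact: nrm_coord.
  by apply: le_trans (cr_Im_normr _) _; exact: nrm_coord.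
rewrite -mulr_sumr mulrC ler_wpM2r ?nrm_ge0 //.
apply: (@le_trans _ _ S); last by rewrite lerDl.
apply: ler_sum => j _; rewrite (bigD1 i) //= lerDl.
by apply: sumr_ge0.
Qed.

End Coordinates.

Lemma rbasis_discrete n (Z0 : 'M[C]_(n + n, n)) : rbasis Z0 ->
  exists2 d : R, 0 < d & forall (Z : 'M[C]_(n + n, n)) (m : 'rV[int]_(n + n)),
    nrm (Z - Z0) < d -> nrm (map_mx intr m *m Z) < d -> m = 0.
Proof.
move=> rZ; have [K K0 HK] := rcoord_bound Z0.
pose N : R := (n + n).+1%:R.
have N0 : 0 < N by rewrite ltr0n.
have N1 : (n + n)%:R <= N by rewrite ler_nat.
have N2 : 1 <= N by rewrite ler1n.
pose d := 1 / (4 * N * K).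
have d0 : 0 < d by rewrite divr_gt0 // !mulr_gt0.
have dE : N * K * d = 4^-1 by rewrite /d; field; rewrite !gt_eqF.
exists d => // Z m Zd md.
pose a : 'rV[R]_(n + n) := map_mx intr m.
have aE : map_mx cr a = map_mx intr m.
  by apply/matrixP => i j; rewrite !mxE; exact: (rmorph_int (real_complex R)).
pose S := \sum_i `|a 0 i|.
have S0 : 0 <= S by apply: sumr_ge0.
have h1 : nrm (map_mx cr a *m (Z - Z0)) <= S * d.
  rewrite mulmx_sum_row; apply: le_trans (nrm_sum _) _.
  rewrite mulr_suml; apply: ler_sum => i _; rewrite nrmZ mxE nrm_cr ler_wpM2l //.
  apply: le_trans (ltW Zd); apply: nrm_mx_le; first exact: nrm_ge0.
  by move=> j k; rewrite mxE; exact: nrm_coord.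
have h2 i : `|a 0 i| <= K * (d + S * d).
  rewrite -{1}(mul_rcoord rZ a); apply: le_trans (HK _ _) _.
  rewrite ler_pM2l //.
  have -> : map_mx cr a *m Z0 = map_mx cr a *m Z - map_mx cr a *m (Z - Z0).
    by rewrite mulmxBr opprB addrC subrK.
  apply: le_trans (nrmBD _ _) _; apply: lerD => //.
  by rewrite aE; exact: ltW.
have h3 : S <= N * (K * (d + S * d)).
  apply: (@le_trans _ _ (\sum_(i < n + n) (K * (d + S * d)))).
    by apply: ler_sum => i _; exact: h2.
  rewrite sumr_const card_ord -[X in X <= _]mulr_natl ler_wpM2r //.
  by apply: mulr_ge0; [exact: ltW|apply: addr_ge0; [exact: ltW|apply: mulr_ge0 => //; exact: ltW]].
have h4 : N * (K * (d + S * d)) = N * K * d * (1 + S) by ring.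
rewrite h4 dE in h3.
have h5 : S < 1 by lra.
apply/rowP => i; rewrite mxE.
have : `|a 0 i| < 1.
  by apply: le_lt_trans h5; rewrite /S (bigD1 i) //= lerDl; exact: sumr_ge0.
by rewrite mxE -intr_norm ltrz1 => h; apply/eqP; move: h; case: (m 0 i) => // -[].
Qed.

Lemma rbasis_periodic_const n (Z : 'M[C]_(n + n, n)) (g : 'rV[C]_n -> C) :
  rbasis Z -> (forall z, holomorphic_at g z) ->
  (forall a, periods g (row a Z)) -> forall x y, g x = g y.
Proof.
move=> rZ hg pg.
pose h (a : 'rV[R]_(n + n)) : R := nrm (g (map_mx cr a *m Z) : C).
have ch : continuous h.
  move=> a; apply/(@cvg_absP R _ (nbhs a)) => e e0.
  have cg := hol_cont (hg (map_mx cr a *m Z)).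
  have [d d0 Hd] := iffLR (nbhs_nrmP _ _) (iffLR (continuous_nrmP _ _) cg _ e0).
  pose K := \sum_i nrm (row i Z).
  have K0 : 0 < K + 1 by rewrite ltr_wpDl ?sumr_ge0 // => i _; exact: nrm_ge0.
  apply/(@nbhs_normP R 'rV[R]_(n + n)); exists (d / (K + 1)); first by rewrite /= divr_gt0.
  move=> b; rewrite /ball_ /= => ab.
  have hb : nrm (map_mx cr b *m Z - map_mx cr a *m Z) < d.
    rewrite -mulmxBl mulmx_sum_row; apply: le_lt_trans (nrm_sum _) _.
    apply: (@le_lt_trans _ _ (`|a - b| * K)).
      rewrite mulr_sumr; apply: ler_sum => i _; rewrite nrmZ !mxE -crB nrm_cr.
      rewrite ler_wpM2r ?nrm_ge0 // distrC.
      rewrite [X in _ <= X]/Num.Def.normr /= mx_normrE.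
      apply/bigmax_geP; right; exists (0, i) => //=; by rewrite !mxE.
    move: ab; rewrite ltr_pdivlMr //; apply: le_lt_trans.
    by rewrite ler_wpM2l // lerDl.
  have := Hd _ hb; rewrite nrmB; apply: le_lt_trans.
  exact: (@nrm_lip C).
pose A := [set v : 'rV[R]_(n + n) | forall i, [set` `[0, 1]] (v ord0 i)].
have [|||c _ Hc] := @EVT_max_rV R (n + n) h A.
- by exists 0 => i /=; rewrite mxE in_itv /= lexx ler01.
- exact: (@rV_compact R (n + n) (fun=> [set` `[0, 1]]) (fun=> @segment_compact R 0 1)).
- exact: continuous_subspaceT.
apply: (liouville hg (M := h c)) => z.
pose a := rcoord Z z.
pose m : 'rV[int]_(n + n) := \row_i (- Num.floor (a 0 i)).
have := periods_int m pg z => <-.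
have -> : z + map_mx intr m *m Z = map_mx cr (a + map_mx intr m) *m Z.
  rewrite -{1}(rcoordK rZ z) -mulmxDl; congr (_ *m _).
  apply/matrixP => i j; rewrite !mxE crD; congr (_ + _).
  exact/esym/(rmorph_int (real_complex R)).
apply: Hc; rewrite inE => i /=.
have -> : (a + map_mx intr m) ord0 i = a 0 i - (Num.floor (a 0 i))%:~R.
  by rewrite [LHS]mxE; congr (_ + _); rewrite [LHS]mxE [m _ _]mxE mulrNz.
rewrite in_itv /=.
have f1 := real_floor_le (num_real (a 0 i)).
have f2 := real_floorD1_gt (num_real (a 0 i)); rewrite intrD in f2.
by apply/andP; split; lra.
Qed.

End Lattices.

Section RowMx.
Context {R : realType}.
Notation C := (Cx R).

Lemma hol_rV_id n (x : 'rV[C]_n) : holomorphic_at (fun y : 'rV[C]_n => y) x.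
Proof. exact: (hol_linear (idfun : {linear 'rV[C]_n -> 'rV[C]_n})). Qed.

Lemma diff_rV_id n (x v : 'rV[C]_n) : 'd (fun y : 'rV[C]_n => y) x v = v.
Proof.
by have -> : 'd (fun y : 'rV[C]_n => y) x = id :> ('rV[C]_n -> 'rV[C]_n) by exact: diff_val.
Qed.

Lemma diff_cstE (V W : normedModType C) (c : W) (x v : V) : 'd (fun=> c) x v = 0.
Proof. exact: (congr1 (fun h => h v) (diff_cst c x)). Qed.

Lemma hol_cst_mx (V : normedModType C) m n (M : 'M[C]_(m, n)) (x : V) :
  holomorphic_at (fun=> M) x.
Proof. by apply: hol_mx => i j; exact: hol_cst. Qed.

Lemma hol_cont_mx (V : normedModType C) m n (F : V -> 'M[C]_(m, n)) x :
  holomorphic_at F x -> {for x, continuous F}.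
Proof. by move=> /nbhs_singleton [dF _]; exact: differentiable_continuous. Qed.

Lemma hol_row_mx (V : normedModType C) p m n (F : V -> 'M[C]_(p, m)) (G : V -> 'M[C]_(p, n)) x :
  holomorphic_at F x -> holomorphic_at G x -> holomorphic_at (fun y => row_mx (F y) (G y)) x.
Proof.
move=> hF hG; apply: hol_mx => i j.
have [k jk|k jk] := splitP j.
  have -> : (fun y => row_mx (F y) (G y) i j) = (fun y => F y i k).
    apply/funext => y; have -> : j = lshift n k by apply: val_inj.
    by rewrite row_mxEl.
  exact: hol_coord.
have -> : (fun y => row_mx (F y) (G y) i j) = (fun y => G y i k).
  apply/funext => y; have -> : j = rshift m k by apply: val_inj.
  by rewrite row_mxEr.
exact: hol_coord.
Qed.

Lemma diff_row_mx (V : normedModType C) p m n (F : V -> 'M[C]_(p, m)) (G : V -> 'M[C]_(p, n)) x v :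
  holomorphic_at F x -> holomorphic_at G x ->
  'd (fun y => row_mx (F y) (G y)) x v = row_mx ('d F x v) ('d G x v).
Proof.
move=> hF hG; have hFG := hol_row_mx hF hG.
have dF : differentiable F x by case: (nbhs_singleton hF).
have dG : differentiable G x by case: (nbhs_singleton hG).
have dFG : differentiable (fun y => row_mx (F y) (G y)) x by case: (nbhs_singleton hFG).
apply/matrixP => i j.
have [_ /(_ v) <-] := diff_coord i j dFG.
have [k jk|k jk] := splitP j.
  have jE : j = lshift n k by apply: val_inj.
  have -> : (fun y => row_mx (F y) (G y) i j : C) = (fun y => F y i k).
    by apply/funext => y; rewrite jE row_mxEl.
  by have [_ ->] := diff_coord i k dF; rewrite jE row_mxEl.
have jE : j = rshift m k by apply: val_inj.
have -> : (fun y => row_mx (F y) (G y) i j : C) = (fun y => G y i k).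
  by apply/funext => y; rewrite jE row_mxEr.
by have [_ ->] := diff_coord i k dG; rewrite jE row_mxEr.
Qed.

Lemma diff_comp_coord (V : normedModType C) n p q (g : V -> 'rV[C]_n)
    (F : 'rV[C]_n -> 'M[C]_(p, q)) x v i j :
  holomorphic_at g x -> holomorphic_at F (g x) ->
  'd (fun y => F (g y) i j : C) x v = ('d F (g x) ('d g x v)) i j.
Proof.
move=> hg hF.
have dg : differentiable g x by case: (nbhs_singleton hg).
have dF : differentiable F (g x) by case: (nbhs_singleton hF).
have dFg : differentiable (fun y => F (g y)) x := differentiable_comp dg dF.
have [_ ->] := diff_coord i j dFg.
by have -> := congr1 (fun h => h v) (diff_comp dg dF).
Qed.

End RowMx.

Lemma diff_shift (R : realType) (V W : normedModType (Cx R)) (g : V -> W) w z :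
  differentiable g (z + w) -> differentiable (fun x => g (x + w)) z /\
    'd (fun x => g (x + w)) z = 'd g (z + w) :> (V -> W).
Proof.
move=> dg; apply: diffI_eps; first exact: diff_continuous.
by move=> e e0; apply: filterS (diff_eps dg e0) => h; rewrite (addrAC z w h).
Qed.

Section DerivC.
Context {R : realType}.
Notation C := (Cx R).
Variable V : normedModType C.
Implicit Types (f g : V -> C) (x v : V).

Lemma diffDE f g x v : holomorphic_at f x -> holomorphic_at g x ->
  'd (fun y => f y + g y : C) x v = ('d f x v : C) + 'd g x v.
Proof.
by move=> /hol_diff df /hol_diff dg; exact: (congr1 (fun h => h v) (diffD df dg)).
Qed.

Lemma diffBE f g x v : holomorphic_at f x -> holomorphic_at g x ->
  'd (fun y => f y - g y : C) x v = ('d f x v : C) - 'd g x v.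
Proof.
by move=> /hol_diff df /hol_diff dg; exact: (congr1 (fun h => h v) (diffB df dg)).
Qed.

Lemma diffME f g x v : holomorphic_at f x -> holomorphic_at g x ->
  'd (fun y => f y * g y : C) x v = f x * ('d g x v : C) + g x * ('d f x v : C).
Proof.
by move=> /hol_diff df /hol_diff dg; exact: (congr1 (fun h => h v) (diffM df dg)).
Qed.

Lemma diff_sumE (I : Type) (s : seq I) (F : I -> V -> C) x v :
  (forall i, holomorphic_at (F i) x) ->
  'd (fun y => \sum_(i <- s) F i y : C) x v = \sum_(i <- s) ('d (F i) x v : C).
Proof.
move=> HF; elim: s => [|i s IH].
  have -> : (fun y => \sum_(i <- [::]) F i y) = (fun=> 0 : C).
    by apply/funext => y; rewrite big_nil.
  by rewrite big_nil; exact: diff_cstE.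
have -> : (fun y => \sum_(i <- i :: s) F i y) = (fun y => F i y + \sum_(i <- s) F i y : C).
  by apply/funext => y; rewrite big_cons.
rewrite big_cons -IH.
exact: (diffDE v (HF i) (@hol_sum R V I s xpredT F x (fun j _ => HF j))).
Qed.

End DerivC.

(** * Periods of a primitive of the form *)

Section PeriodLemma.
Context {R : realType}.
Notation C := (Cx R).
Variables (r : nat) (D1 : set 'rV[C]_r) (Z : 'rV[C]_r -> 'M[C]_(r + r, r)).
Variables (eta : 'rV[C]_(r + r) -> 'rV[C]_(r + r)) (S : 'rV[C]_(r + r) -> 'M[C]_(r + r)).
Hypothesis hZ : forall u, D1 u -> holomorphic_at Z u.
Hypothesis rZ : forall u, D1 u -> rbasis (Z u).
Hypothesis heta : forall y, D1 (lsubmx y) -> holomorphic_at eta y.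
Hypothesis deta : forall y, D1 (lsubmx y) -> forall i j : 'I_(r + r),
  ('d eta y (delta_mx 0 i)) 0 j - ('d eta y (delta_mx 0 j)) 0 i = S y i j.
Hypothesis uS : forall y, D1 (lsubmx y) -> S y \in unitmx.
Hypothesis teta : forall a (y v : 'rV[C]_(r + r)), D1 (lsubmx y) ->
  \sum_j eta y 0 j * v 0 j =
  \sum_j eta (row_mx (lsubmx y) (rsubmx y + row a (Z (lsubmx y)))) 0 j *
    row_mx (lsubmx v) (rsubmx v + row a ('d Z (lsubmx y) (lsubmx v))) 0 j.

(* By eta_fibre_const, eta (row_mx u z) 0 (rshift r j) does not depend on z:
   0 is an arbitrary base point of the fibre. *)
Definition base_form u j : C := eta (row_mx u 0) 0 (rshift r j).
Definition period a u : C := \sum_j base_form u j * Z u a j.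
Definition mixed u : 'M[C]_r :=
  \matrix_(i, j) S (row_mx u 0) (lshift r i) (rshift r j).

Let hfib (u z : 'rV[C]_r) : D1 u -> holomorphic_at (fun z : 'rV[C]_r => row_mx u z) z.
Proof. by move=> _; apply: hol_row_mx; [exact: hol_cst_mx|exact: hol_rV_id]. Qed.

Let hetaF (u z : 'rV[C]_r) : D1 u -> holomorphic_at eta (row_mx u z).
Proof. by move=> Du; apply: heta; rewrite row_mxKl. Qed.

Let dfib (u z v : 'rV[C]_r) : 'd (fun z : 'rV[C]_r => row_mx u z) z v = row_mx 0 v.
Proof.
apply: (etrans (diff_row_mx v (hol_cst_mx u z) (hol_rV_id z))).
by congr row_mx; [exact: diff_cstE|exact: diff_rV_id].
Qed.

Let dbase (u z v : 'rV[C]_r) : 'd (fun u : 'rV[C]_r => row_mx u z) u v = row_mx v 0.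
Proof.
apply: (etrans (diff_row_mx v (hol_rV_id u) (hol_cst_mx z u))).
by congr row_mx; [exact: diff_rV_id|exact: diff_cstE].
Qed.

Let hbase (u z : 'rV[C]_r) : holomorphic_at (fun u : 'rV[C]_r => row_mx u z) u.
Proof. by apply: hol_row_mx; [exact: hol_rV_id|exact: hol_cst_mx]. Qed.

Lemma eta_fibre_hol u z k : D1 u -> holomorphic_at (fun z => eta (row_mx u z) 0 k : C) z.
Proof.
move=> Du; apply: (hol_comp (g := fun z => row_mx u z) (f := fun y => eta y 0 k)).
  exact: hfib.
by apply: hol_coord; exact: hetaF.
Qed.

Lemma eta_fibre_periodic u j : D1 u -> forall a,
  periods (fun z => eta (row_mx u z) 0 (rshift r j)) (row a (Z u)).
Proof.
move=> Du a z.
have := @teta a (row_mx u z) (delta_mx 0 (rshift r j)).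
rewrite row_mxKl row_mxKr => /(_ Du).
have E : delta_mx 0 (rshift r j) = row_mx 0 (delta_mx 0 j) :> 'rV[C]_(r + r).
  apply/rowP => k; rewrite !mxE; case: (fintype.splitP k) => l kl; rewrite !mxE.
    by rewrite -(val_eqE k) /= kl ltn_eqF // ltn_addr.
  by rewrite -(val_eqE k) -?(val_eqE l) /= kl eqn_add2l.
have El : lsubmx (delta_mx 0 (rshift r j) : 'rV[C]_(r + r)) = 0 by rewrite E row_mxKl.
have Er : rsubmx (delta_mx 0 (rshift r j) : 'rV[C]_(r + r)) = delta_mx 0 j by rewrite E row_mxKr.
rewrite El Er linear0 row0 addr0 -E.
rewrite (bigD1 (rshift r j)) //= [X in _ + X]big1; last first.
  by move=> k kj; rewrite mxE (negPf kj) andbF mulr0.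
rewrite (bigD1 (rshift r j)) //= [X in _ = _ + X]big1; last first.
  by move=> k kj; rewrite mxE (negPf kj) andbF mulr0.
by rewrite mxE !eqxx !mulr1 !addr0.
Qed.

Lemma eta_fibre_const u z j : D1 u ->
  eta (row_mx u z) 0 (rshift r j) = base_form u j.
Proof.
move=> Du; have rZu := rZ Du.
apply: (@rbasis_periodic_const R r (Z u) (fun z => eta (row_mx u z) 0 (rshift r j)) rZu).
  by move=> w; exact: eta_fibre_hol.
exact: eta_fibre_periodic.
Qed.

Lemma base_form_hol u j : D1 u -> holomorphic_at (fun u => base_form u j) u.
Proof.
move=> Du.
apply: (hol_comp (g := fun u => row_mx u 0) (f := fun y => eta y 0 (rshift r j))).
  exact: hbase.
by apply: hol_coord; exact: hetaF.
Qed.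

Lemma period_hol a u : D1 u -> holomorphic_at (period a) u.
Proof.
move=> Du; apply: (@hol_sum R _ _ _ _ (fun j u => base_form u j * Z u a j)) => j _.
by apply: holM; [exact: base_form_hol|apply: hol_coord; exact: hZ].
Qed.

Let delta_l (i : 'I_r) : delta_mx 0 (lshift r i) = row_mx (delta_mx 0 i) 0 :> 'rV[C]_(r + r).
Proof.
apply/rowP => k; rewrite !mxE; case: (fintype.splitP k) => l kl; rewrite !mxE.
  by rewrite -(val_eqE k) -?(val_eqE l) /= kl.
by rewrite -(val_eqE k) /= kl gtn_eqF // ltn_addr.
Qed.

Let delta_r (i : 'I_r) : delta_mx 0 (rshift r i) = row_mx 0 (delta_mx 0 i) :> 'rV[C]_(r + r).
Proof.
apply/rowP => k; rewrite !mxE; case: (fintype.splitP k) => l kl; rewrite !mxE.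
  by rewrite -(val_eqE k) /= kl ltn_eqF // ltn_addr.
by rewrite -(val_eqE k) -?(val_eqE l) /= kl eqn_add2l.
Qed.

(* The base components of eta change by a constant under a lattice translation
   of the fibre, so their increments are periodic and, by Liouville, constant. *)
Lemma eta_fibre_affine u a i : D1 u ->
  'd (fun z => eta (row_mx u z) 0 (lshift r i) : C) 0 (row a (Z u)) =
  - \sum_j base_form u j * ('d Z u (delta_mx 0 i)) a j.
Proof.
move=> Du; pose g z : C := eta (row_mx u z) 0 (lshift r i).
have hg z : holomorphic_at g z by exact: eta_fibre_hol.
pose c b : C := \sum_j base_form u j * ('d Z u (delta_mx 0 i)) b j.
have gZ b z : g (z + row b (Z u)) = g z - c b.
  have := @teta b (row_mx u z) (delta_mx 0 (lshift r i)).
  rewrite row_mxKl row_mxKr => /(_ Du).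
  have El : lsubmx (delta_mx 0 (lshift r i) : 'rV[C]_(r + r)) = delta_mx 0 i by rewrite delta_l row_mxKl.
  have Er : rsubmx (delta_mx 0 (lshift r i) : 'rV[C]_(r + r)) = 0 by rewrite delta_l row_mxKr.
  rewrite El Er add0r.
  rewrite (bigD1 (lshift r i)) //= [X in _ + X]big1; last first.
    by move=> k kj; rewrite mxE (negPf kj) andbF mulr0.
  rewrite mxE !eqxx mulr1 addr0 big_split_ord /= => E.
  apply/eqP; rewrite eq_sym subr_eq; apply/eqP; rewrite /g E; congr (_ + _).
    rewrite (bigD1 i) //= row_mxEl mxE !eqxx mulr1 big1 ?addr0 // => k kj.
    by rewrite row_mxEl mxE (negPf kj) andbF mulr0.
  by apply: eq_bigr => j _; rewrite row_mxEr eta_fibre_const // mxE.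
have hshift w z : holomorphic_at (fun z => g (z + w)) z.
  apply: (hol_comp (g := fun z => z + w) (f := g)); last exact: hg.
  apply: hol_mx => p q.
  have -> : (fun y : 'rV[C]_r => (y + w) p q) = (fun y => y p q + w p q : C).
    by apply/funext => y; rewrite mxE.
  by apply: holD; [apply: hol_coord; exact: hol_rV_id|exact: hol_cst].
have dshift w z v : 'd (fun z => g (z + w)) z v = 'd g (z + w) v.
  have [_ E] := diff_shift (hol_diff (hg (z + w))).
  exact: (congr1 (fun h => h v) E).
have incr w z : g (z + w) - g z = g w - g 0.
  have H1 x : holomorphic_at (fun z => g (z + w) - g z) x.
    by apply: holB; [exact: hshift|exact: hg].
  have H2 b : periods (fun z => g (z + w) - g z) (row b (Z u)).
    move=> x; have -> : x + row b (Z u) + w = x + w + row b (Z u) by rewrite addrAC.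
    have aux (p q k : C) : (p - k) - (q - k) = p - q by ring.
    by rewrite !gZ; exact: aux.
  have := @rbasis_periodic_const R r (Z u) (fun z => g (z + w) - g z) (rZ Du) H1 H2 z 0.
  by rewrite add0r.
have dconst z v : 'd g z v = 'd g 0 v.
  have E : (fun x => g (x + z)) = (fun x => g x + (g z - g 0)).
    by apply/funext => x; rewrite -(incr z x); ring.
  have e0 : 'd g z v = 'd g (0 + z) v by rewrite add0r.
  apply: (etrans e0); apply: (etrans (esym (dshift z 0 v))).
  apply: (etrans (congr1 (fun h : 'rV[C]_r -> C => 'd h 0 v) E)).
  apply: (etrans (diffDE v (hg 0) (hol_cst (g z - g 0) 0))).
  apply: (etrans (f_equal2 (fun a b : C => a + b) erefl (diff_cstE _ _ _))).
  exact: addr0.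
pose L : {linear 'rV[C]_r -> C} := 'd g 0.
have lin w : g w - g 0 = L w.
  have hL z : holomorphic_at L z by exact: hol_linear.
  have dL z v : 'd L z v = L v.
    exact: (congr1 (fun h => h v) (diff_lin z (@linear_rV_continuous _ _ _ L))).
  have H : g w - L w = g 0 - L 0.
    apply: (@diff0_const R _ (fun z => g z - L z)) => s _; split.
      by apply: hol_diff; apply: holB; [exact: hg|exact: hL].
    apply: (etrans (diffBE (w - 0) (hg (0 + cr s *: (w - 0))) (hL (0 + cr s *: (w - 0))))).
    apply: (etrans (f_equal2 (fun a b : C => a - b) (dconst _ _) (dL _ _))).
    exact: subrr.
  have L0 : L 0 = 0 by exact: linear0.
  by move: H; rewrite L0 subr0 => <-; ring.
have h1 : g (row a (Z u)) = g 0 - c a by have := gZ a 0; rewrite add0r.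
apply: (etrans (esym (lin (row a (Z u))))); rewrite h1.
have aux (p q : C) : p - q - p = - q by ring.
exact: aux.
Qed.

Lemma mixedE u i j : D1 u -> mixed u i j =
  'd (fun u => base_form u j) u (delta_mx 0 i) -
  'd (fun z => eta (row_mx u z) 0 (lshift r i) : C) 0 (delta_mx 0 j).
Proof.
move=> Du; rewrite mxE -deta ?row_mxKl //; congr (_ - _).
  have := diff_comp_coord (delta_mx 0 i) 0 (rshift r j) (@hbase u 0) (hetaF 0 Du).
  move=> E; apply: etrans (esym E).
  by have -> := dbase u 0 (delta_mx 0 i); rewrite delta_l.
have := diff_comp_coord (delta_mx 0 j) 0 (lshift r i) (@hfib u 0 Du) (hetaF 0 Du).
move=> E; apply: etrans (esym E).
by have -> := dfib u 0 (delta_mx 0 j); rewrite delta_r.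
Qed.

Lemma period_diff u a i : D1 u ->
  'd (period a) u (delta_mx 0 i) = \sum_j mixed u i j * Z u a j.
Proof.
move=> Du.
have hb j : holomorphic_at (fun u => base_form u j) u by exact: base_form_hol.
have hz j : holomorphic_at (fun u => Z u a j : C) u by apply: hol_coord; exact: hZ.
have hbz j : holomorphic_at (fun u => base_form u j * Z u a j : C) u by exact: holM.
have dz j v : 'd (fun u => Z u a j : C) u v = ('d Z u v) a j.
  have dZ : differentiable Z u by case: (nbhs_singleton (hZ Du)).
  by have [_ ->] := diff_coord a j dZ.
apply: (etrans (diff_sumE _ _ hbz)).
have E1 j : 'd (fun u => base_form u j * Z u a j : C) u (delta_mx 0 i) =
   base_form u j * ('d Z u (delta_mx 0 i)) a j +
   Z u a j * ('d (fun u => base_form u j) u (delta_mx 0 i) : C).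
  by rewrite -dz; exact: (diffME (delta_mx 0 i) (hb j) (hz j)).
rewrite (eq_bigr _ (fun j _ => E1 j)) big_split /=.
have E2 := eta_fibre_affine a i Du.
have E3 := diff_rVM (fun z => eta (row_mx u z) 0 (lshift r i) : C) 0 (row a (Z u)).
have E4 : \sum_j base_form u j * ('d Z u (delta_mx 0 i)) a j =
    - \sum_j Z u a j * ('d (fun z => eta (row_mx u z) 0 (lshift r i) : C) 0 (delta_mx 0 j) : C).
  have E5 := etrans (esym E2) E3.
  rewrite -[LHS]opprK E5; congr (- _).
  by apply: eq_bigr => j _; rewrite mxE.
rewrite E4 -sumrN -big_split /=; apply: eq_bigr => j _.
have E6 := mixedE i j Du.
have aux (p q z m : C) : m = p - q -> - (z * q) + z * p = m * z by move=> ->; ring.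
exact: aux E6.
Qed.

Lemma mixed_unit u : D1 u -> mixed u \in unitmx.
Proof.
move=> Du; have Dy : D1 (lsubmx (row_mx u (0 : 'rV[C]_r))) by rewrite row_mxKl.
rewrite -unitmx_tr -row_free_unit; apply/inj_row_free => w wK.
have S22 j k : S (row_mx u 0) (rshift r j) (rshift r k) = 0.
  have D0 (j' k' : 'I_r) : ('d eta (row_mx u 0) (delta_mx 0 (rshift r j'))) 0 (rshift r k') = 0.
    have := diff_comp_coord (delta_mx 0 j') 0 (rshift r k') (@hfib u 0 Du) (hetaF 0 Du).
    have -> := dfib u 0 (delta_mx 0 j'); rewrite -delta_r => <-.
    have -> : (fun y => eta (row_mx u y) 0 (rshift r k')) = (fun=> base_form u k').
      by apply/funext => z; exact: eta_fibre_const.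
    exact: diff_cstE.
  by rewrite -deta // !D0 subrr.
have S21 i j : S (row_mx u 0) (rshift r j) (lshift r i) = - mixed u i j.
  by rewrite mxE -deta // -[in RHS]deta // opprB.
have wS : row_mx 0 w *m S (row_mx u 0) = 0.
  apply/rowP => k; rewrite !mxE big_split_ord /= big1 ?add0r; last first.
    by move=> i _; rewrite row_mxEl mxE mul0r.
  case: (fintype.splitP k) => l kl.
    have -> : k = lshift r l by apply: val_inj.
    have /rowP/(_ l) := wK; rewrite !mxE => E.
    apply: (etrans _ (etrans (congr1 -%R E) (oppr0 _))); rewrite -sumrN; apply: eq_bigr => i _.
    by rewrite row_mxEr S21 mulrN [in RHS]mxE.
  have -> : k = rshift r l by apply: val_inj.
  by rewrite big1 // => i _; rewrite row_mxEr S22 mulr0.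
have : row_mx 0 w = 0 :> 'rV[C]_(r + r).
  by rewrite -[LHS](mulmxK (uS Dy)) wS mul0mx.
by move=> /(congr1 rsubmx); rewrite row_mxKr linear0.
Qed.

Definition period_comb (m : 'rV[C]_(r + r)) u : C :=
  \sum_j base_form u j * (m *m Z u) 0 j.

Let period_combE m : period_comb m = (fun u => \sum_a m 0 a * period a u).
Proof.
apply/funext => u; rewrite /period_comb.
have -> : \sum_j base_form u j * (m *m Z u) 0 j =
    \sum_j \sum_a m 0 a * (base_form u j * Z u a j).
  apply: eq_bigr => j _; rewrite mxE mulr_sumr; apply: eq_bigr => a _.
  by rewrite mulrCA.
by rewrite exchange_big /=; apply: eq_bigr => a _; rewrite -mulr_sumr.
Qed.

Let hcomb (m : 'rV[C]_(r + r)) u a : D1 u -> holomorphic_at (fun u => m 0 a * period a u : C) u.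
Proof. by move=> Du; exact: (holM (hol_cst (m 0 a) u) (period_hol a Du)). Qed.

Lemma period_comb_hol m u : D1 u -> holomorphic_at (period_comb m) u.
Proof.
move=> Du; rewrite period_combE.
by apply: (@hol_sum R _ _ _ _ (fun a u => m 0 a * period a u)) => a _; exact: hcomb.
Qed.

Lemma period_comb_diff m u i : D1 u ->
  'd (period_comb m) u (delta_mx 0 i) = \sum_j mixed u i j * (m *m Z u) 0 j.
Proof.
move=> Du; rewrite period_combE.
apply: (etrans (diff_sumE _ _ (fun a => hcomb m a Du))).
have E1 a : 'd (fun u => m 0 a * period a u : C) u (delta_mx 0 i) =
    \sum_j m 0 a * (mixed u i j * Z u a j).
  apply: (etrans (diffME (delta_mx 0 i) (hol_cst (m 0 a) u) (period_hol a Du))).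
  apply: (etrans (f_equal2 (fun x y : C => m 0 a * x + period a u * y)
     (period_diff a i Du) (diff_cstE _ _ _))).
  by rewrite mulr0 addr0 mulr_sumr.
rewrite (eq_bigr _ (fun a _ => E1 a)) exchange_big /=; apply: eq_bigr => j _.
rewrite [X in _ = _ * X]mxE mulr_sumr; apply: eq_bigr => a _.
by rewrite mulrCA.
Qed.

End PeriodLemma.

Lemma sum_delta_r (K : pzRingType) n (a : 'I_n -> K) j : \sum_l a l * (j == l)%:R = a j.
Proof.
rewrite (bigD1 j) //= eqxx mulr1 big1 ?addr0 // => l lj.
by rewrite eq_sym (negPf lj) mulr0.
Qed.

Lemma sum_delta_l (K : pzRingType) n (a : 'I_n -> K) j : \sum_l (j == l)%:R * a l = a j.
Proof.
rewrite (bigD1 j) //= eqxx mul1r big1 ?addr0 // => l lj.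
by rewrite eq_sym (negPf lj) mul0r.
Qed.

Lemma hol_mulmx (R : realType) (V : normedModType (Cx R)) m n p (F : V -> 'M[Cx R]_(m, n)) (G : V -> 'M[Cx R]_(n, p)) x :
  holomorphic_at F x -> holomorphic_at G x -> holomorphic_at (fun y => F y *m G y) x.
Proof.
move=> hF hG; apply: hol_mx => i j.
have -> : (fun y => (F y *m G y) i j : Cx R) = (fun y => \sum_k F y i k * G y k j).
  by apply/funext => y; rewrite mxE.
apply: (@hol_sum R V _ _ _ (fun k y => F y i k * G y k j)) => k _.
by apply: holM; exact: hol_coord.
Qed.

Lemma hol_deriv_mx (R : realType) n p q (F : 'rV[Cx R]_n -> 'M[Cx R]_(p, q)) x v :
  holomorphic_at F x -> holomorphic_at (fun y => 'd F y v) x.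
Proof.
move=> hF; apply: hol_mx => i j.
apply: hol_near_eq (hol_deriv v (hol_coord i j hF)).
apply: filterS hF => y [dF _].
by have [_ ->] := diff_coord i j dF.
Qed.

Lemma diff_deriv_coord (R : realType) n p q (F : 'rV[Cx R]_n -> 'M[Cx R]_(p, q)) x v w i j :
  holomorphic_at F x ->
  ('d (fun y => 'd F y w) x v) i j =
  'd (fun y => 'd (fun y => F y i j : Cx R) y w : Cx R) x v.
Proof.
move=> hF; have hw := hol_deriv_mx w hF.
have dw : differentiable (fun y => 'd F y w) x by case: (nbhs_singleton hw).
have [dw0 f1] := diff_coord i j dw.
apply: (etrans (esym (f1 v))).
have ne : \forall y \near x, ('d F y w) i j = 'd (fun y => F y i j : Cx R) y w.
  by apply: filterS hF => y [dF _]; have [_ ->] := diff_coord i j dF.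
have [_ f2] := diff_near_eq ne dw0.
exact: esym (congr1 (fun h => h v) f2).
Qed.

Lemma schwarz_mx (R : realType) n p q (F : 'rV[Cx R]_n -> 'M[Cx R]_(p, q)) x v w :
  holomorphic_at F x ->
  'd (fun y => 'd F y v) x w = 'd (fun y => 'd F y w) x v.
Proof.
move=> hF; apply/matrixP => i j.
apply: (etrans (diff_deriv_coord w v i j hF)).
apply: etrans (esym (diff_deriv_coord v w i j hF)).
by apply: schwarz; exact: hol_coord.
Qed.

(** * The primitive defined by the Euler field *)

Section LieDerivative.
Context {R : realType}.
Notation C := (Cx R).
Variables (N : nat) (Phi : 'rV[C]_(1 + N) -> 'rV[C]_N) (Om : 'rV[C]_N -> 'M[C]_N).
Variable xi : 'rV[C]_N.

Definition at_time (t : C) (x : 'rV[C]_N) : 'rV[C]_(1 + N) := row_mx (t%:M : 'M[C]_1) x.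

Definition velocity (x : 'rV[C]_N) : 'rV[C]_N :=
  'd Phi (at_time 1 x) (row_mx (1%:M : 'M[C]_1) 0).

Hypothesis hPhi : holomorphic_at Phi (at_time 1 xi).
Hypothesis hOm : holomorphic_at Om xi.
Hypothesis skew : \forall x \near xi, (Om x)^T = - Om x.
Hypothesis closed : forall i j k : 'I_N,
  let D (a b d : 'I_N) := 'd (fun y => Om y b d : C) xi (delta_mx 0 a) : C in
  D i j k + D j k i + D k i j = 0.
Hypothesis Phi1 : \forall x \near xi, Phi (at_time 1 x) = x.
Hypothesis scaling : \forall t \near (1 : C), forall i j : 'I_N,
  \sum_k \sum_l ('d Phi (at_time t xi) (row_mx 0 (delta_mx 0 i))) 0 k *
     Om (Phi (at_time t xi)) k l * ('d Phi (at_time t xi) (row_mx 0 (delta_mx 0 j))) 0 l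
  = t * Om xi i j.

Lemma at_time_hol1 t x : holomorphic_at (fun x => at_time t x) x.
Proof. by apply: hol_row_mx; [exact: hol_cst_mx|exact: hol_rV_id]. Qed.

Lemma at_time_diff1 t x v : 'd (fun x => at_time t x) x v = row_mx 0 v.
Proof.
apply: (etrans (diff_row_mx v (hol_cst_mx (t%:M : 'M[C]_1) x) (hol_rV_id x))).
by congr row_mx; [exact: diff_cstE|exact: diff_rV_id].
Qed.

Lemma hol_scalar1 (t : C) : holomorphic_at (fun t : C => t%:M : 'M[C]_1) t.
Proof.
apply: hol_mx => i j; have -> : (fun t : C => (t%:M : 'M[C]_1) i j : C) = (fun t => t).
  by apply/funext => s; rewrite !ord1 mxE eqxx mulr1n.
exact: hol_id.
Qed.

Lemma diff_scalar1 (t v : C) : 'd (fun t : C => t%:M : 'M[C]_1) t v = v%:M.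
Proof.
have dS : differentiable (fun t : C => t%:M : 'M[C]_1) t by case: (nbhs_singleton (hol_scalar1 t)).
apply/matrixP => i j; have [_ /(_ v) <-] := diff_coord i j dS.
have -> : (fun t : C => (t%:M : 'M[C]_1) i j : C) = (fun t => t).
  by apply/funext => s; rewrite !ord1 mxE eqxx mulr1n.
rewrite !ord1 mxE eqxx mulr1n.
by have -> : 'd (fun z : C => z) t = id :> (C -> C) by exact: diff_val.
Qed.

Lemma at_time_hol0 t x : holomorphic_at (fun t => at_time t x) t.
Proof. by apply: hol_row_mx; [exact: hol_scalar1|exact: hol_cst_mx]. Qed.

Lemma at_time_diff0 t x (v : C) : 'd (fun t => at_time t x) t v = row_mx (v%:M : 'M[C]_1) 0.
Proof.
apply: (etrans (diff_row_mx v (hol_scalar1 t) (hol_cst_mx x t))).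
by congr row_mx; [exact: diff_scalar1|exact: diff_cstE].
Qed.

Lemma velocity_hol : holomorphic_at velocity xi.
Proof.
apply: (@hol_comp_mx R _ _ _ _ (fun x => at_time 1 x)
   (fun y => 'd Phi y (row_mx (1%:M : 'M[C]_1) 0))).
  exact: at_time_hol1.
exact: hol_deriv_mx.
Qed.

Definition potential x : 'rV[C]_N := velocity x *m Om x.

Lemma potential_hol : holomorphic_at potential xi.
Proof. by apply: hol_mulmx; [exact: velocity_hol|exact: hOm]. Qed.

Let dP (i : 'I_N) y (k : 'I_N) : C := ('d Phi y (row_mx 0 (delta_mx 0 i))) 0 k.

Let dPhol (i k : 'I_N) : holomorphic_at (fun t => dP i (at_time t xi) k) (1 : C).
Proof.
apply: (@hol_comp R _ _ (fun t => at_time t xi) (fun y => dP i y k)).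
  exact: at_time_hol0.
by apply: hol_coord; exact: hol_deriv_mx.
Qed.

Let dP1 (i k : 'I_N) : dP i (at_time 1 xi) k = (i == k)%:R.
Proof.
have E := diff_comp_coord (delta_mx 0 i) 0 k (at_time_hol1 1 xi) hPhi.
have e2 := at_time_diff1 1 xi (delta_mx 0 i).
have e3 : dP i (at_time 1 xi) k =
    'd (fun y => Phi (at_time 1 y) 0 k : C) xi (delta_mx 0 i).
  by rewrite /dP -e2; exact: esym E.
apply: (etrans e3).
have ne : \forall x \near xi, (x : 'rV[C]_N) 0 k = Phi (at_time 1 x) 0 k :> C.
  by apply: filterS Phi1 => x ->.
have hk : holomorphic_at (fun x : 'rV[C]_N => x 0 k : C) xi by apply: hol_coord; exact: hol_rV_id.
have [_ e4] := diff_near_eq ne (hol_diff hk).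
apply: (etrans (congr1 (fun h => h (delta_mx 0 i)) e4)).
have did : differentiable (fun y : 'rV[C]_N => y) xi by case: (nbhs_singleton (hol_rV_id xi)).
have [_ e5] := diff_coord 0 k did.
apply: (etrans (e5 _)).
have e6 := diff_rV_id xi (delta_mx 0 i : 'rV[C]_N).
by apply: (etrans (congr1 (fun v : 'rV[C]_N => v 0 k) e6)); rewrite mxE eqxx eq_sym.
Qed.

(* Schwarz: the time derivative of the Jacobian is the Jacobian of the velocity. *)
Let dtdP (i k : 'I_N) : 'd (fun t => dP i (at_time t xi) k) (1 : C) (1 : C) =
  ('d velocity xi (delta_mx 0 i)) 0 k.
Proof.
have hk : holomorphic_at (fun y => Phi y 0 k : C) (at_time 1 xi) by exact: hol_coord.
have hdP : holomorphic_at (fun y => 'd Phi y (row_mx 0 (delta_mx 0 i))) (at_time 1 xi).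
  exact: hol_deriv_mx.
have hdt : holomorphic_at (fun y => 'd Phi y (row_mx (1%:M : 'M[C]_1) 0)) (at_time 1 xi).
  exact: hol_deriv_mx.
have e1 := diff_comp_coord (1 : C) 0 k (at_time_hol0 1 xi) hdP.
apply: (etrans e1).
have e2 := diff_comp_coord (delta_mx 0 i) 0 k (at_time_hol1 1 xi) hdt.
have dv : differentiable velocity xi by case: (nbhs_singleton velocity_hol).
have [_ e3] := diff_coord 0 k dv.
apply: etrans (e3 (delta_mx 0 i)); apply: etrans (esym e2).
apply: (etrans (diff_deriv_coord _ _ 0 k hPhi)).
apply: etrans (esym (diff_deriv_coord _ _ 0 k hPhi)).
have d0 := at_time_diff0 1 xi 1; have d1 := at_time_diff1 1 xi (delta_mx 0 i).
apply: (etrans (congr1 (fun v => 'd (fun y => 'd (fun y => Phi y 0 k : C) y _ : C) (at_time 1 xi) v) d0)).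
apply: etrans (esym (congr1 (fun v => 'd (fun y => 'd (fun y => Phi y 0 k : C) y _ : C) (at_time 1 xi) v) d1)).
exact: schwarz.
Qed.

Let Omh k l : holomorphic_at (fun y => Om y k l : C) xi.
Proof. exact: hol_coord. Qed.

Let Phixi : Phi (at_time 1 xi) = xi. Proof. exact: (nbhs_singleton Phi1). Qed.

Let traj_hol : holomorphic_at (fun t => Phi (at_time t xi)) (1 : C).
Proof.
by apply: (@hol_comp_mx R _ _ _ _ (fun t => at_time t xi) Phi); first exact: at_time_hol0.
Qed.

Let traj_diff k : 'd (fun t => Phi (at_time t xi) 0 k : C) (1 : C) (1 : C) = velocity xi 0 k.
Proof.
have E := diff_comp_coord (1 : C) 0 k (at_time_hol0 1 xi) hPhi.
apply: (etrans E); have d0 := at_time_diff0 1 xi 1.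
exact: (congr1 (fun v => ('d Phi (at_time 1 xi) v) 0 k) d0).
Qed.

Let Omt_hol k l : holomorphic_at (fun t => Om (Phi (at_time t xi)) k l : C) (1 : C).
Proof.
apply: (@hol_comp R _ _ (fun t => Phi (at_time t xi)) (fun y => Om y k l)); first exact: traj_hol.
by rewrite Phixi; exact: Omh.
Qed.

Let Omt_diff k l : 'd (fun t => Om (Phi (at_time t xi)) k l : C) (1 : C) (1 : C) =
  \sum_m velocity xi 0 m * ('d (fun y => Om y k l : C) xi (delta_mx 0 m) : C).
Proof.
have hOm' : holomorphic_at Om (Phi (at_time 1 xi)) by rewrite Phixi.
have E := diff_comp_coord (1 : C) k l traj_hol hOm'.
apply: (etrans E).
have dO : differentiable Om (Phi (at_time 1 xi)) by case: (nbhs_singleton hOm').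
have [_ e1] := diff_coord k l dO.
apply: (etrans (esym (e1 _))); rewrite Phixi.
apply: (etrans (diff_rVM _ _ _)); apply: eq_bigr => m _; congr (_ * _).
have dT : differentiable (fun t => Phi (at_time t xi)) (1 : C) by case: (nbhs_singleton traj_hol).
have [_ e2] := diff_coord 0 m dT.
exact: (etrans (esym (e2 _)) (traj_diff m)).
Qed.

Lemma lie_scaling (i j : 'I_N) :
  (\sum_k ('d velocity xi (delta_mx 0 i)) 0 k * Om xi k j) +
  (\sum_m velocity xi 0 m * ('d (fun y => Om y i j : C) xi (delta_mx 0 m) : C)) +
  (\sum_l Om xi i l * ('d velocity xi (delta_mx 0 j)) 0 l) = Om xi i j.
Proof.
pose T k l (t : C) : C := dP i (at_time t xi) k * Om (Phi (at_time t xi)) k l * dP j (at_time t xi) l.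
have hT k l : holomorphic_at (T k l) (1 : C).
  by apply: holM; [apply: holM; [exact: dPhol|exact: Omt_hol]|exact: dPhol].
pose F (t : C) : C := \sum_k \sum_l T k l t.
have hT2 k : holomorphic_at (fun t => \sum_l T k l t : C) (1 : C).
  by apply: (@hol_sum R C _ _ _ (fun l t => T k l t)) => l _; exact: hT.
have ne : \forall t \near (1 : C), t * Om xi i j = F t.
  by apply: filterS scaling => t /(_ i j) <-.
have hlin : holomorphic_at (fun t : C => t * Om xi i j : C) (1 : C).
  by apply: holM; [exact: hol_id|exact: hol_cst].
have [_ e1] := diff_near_eq ne (hol_diff hlin).
have e2 : 'd (fun t : C => t * Om xi i j : C) (1 : C) (1 : C) = Om xi i j.
  apply: (etrans (diffME (1 : C) (hol_id 1) (hol_cst (Om xi i j) (1 : C)))).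
  have a1 := diff_cstE (Om xi i j : C) (1 : C) (1 : C).
  have a2 : 'd (fun z : C => z) (1 : C) (1 : C) = 1.
    by have -> : 'd (fun z : C => z) (1 : C) = id :> (C -> C) by exact: diff_val.
  have aux (a b c : C) : a = 0 -> b = 1 -> 1 * a + c * b = c by move=> -> ->; ring.
  exact: aux a1 a2.
apply: etrans e2; apply: etrans (congr1 (fun h => h (1 : C)) e1).
apply: etrans (esym (diff_sumE (index_enum _) (1 : C) hT2)).
have dT k l : 'd (T k l) (1 : C) (1 : C) =
    ('d velocity xi (delta_mx 0 i)) 0 k * (Om xi k l * (j == l)%:R) +
    (i == k)%:R * ((\sum_m velocity xi 0 m * ('d (fun y => Om y k l : C) xi (delta_mx 0 m) : C)) * (j == l)%:R) +
    (i == k)%:R * (Om xi k l * ('d velocity xi (delta_mx 0 j)) 0 l).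
  have h1 := holM (dPhol i k) (Omt_hol k l).
  apply: (etrans (diffME (1 : C) h1 (dPhol j l))).
  have b1 := diffME (1 : C) (dPhol i k) (Omt_hol k l).
  have b2 := Omt_diff k l.
  have b3 := dtdP i k.
  have b4 := dtdP j l.
  rewrite -b2 -b3 -b4 !dP1 Phixi.
  have aux (x y z u p q o : C) : x = p * y + o * z ->
      p * o * u + q * x = z * (o * q) + p * (y * q) + p * (o * u) by move=> ->; ring.
  by apply: aux; apply: (etrans b1); rewrite dP1 Phixi.
have dT2 k : 'd (fun t => \sum_l T k l t : C) (1 : C) (1 : C) =
    ('d velocity xi (delta_mx 0 i)) 0 k * Om xi k j +
    (i == k)%:R * (\sum_m velocity xi 0 m * ('d (fun y => Om y k j : C) xi (delta_mx 0 m) : C)) +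
    (i == k)%:R * (\sum_l Om xi k l * ('d velocity xi (delta_mx 0 j)) 0 l).
  apply: (etrans (diff_sumE (index_enum _) (1 : C) (hT k))).
  rewrite (eq_bigr _ (fun l _ => dT k l)) !big_split /= -!mulr_sumr.
  by rewrite !sum_delta_r.
apply/esym; rewrite (eq_bigr _ (fun k _ => dT2 k)) !big_split /=.
by rewrite !sum_delta_l.
Qed.

Lemma potential_diff (i j : 'I_N) :
  ('d potential xi (delta_mx 0 i)) 0 j - ('d potential xi (delta_mx 0 j)) 0 i = Om xi i j.
Proof.
pose dO a b d : C := 'd (fun y => Om y b d : C) xi (delta_mx 0 a).
pose dv a k : C := ('d velocity xi (delta_mx 0 a)) 0 k.
pose v k : C := velocity xi 0 k.
have dp : differentiable potential xi by case: (nbhs_singleton potential_hol).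
have dvel : differentiable velocity xi by case: (nbhs_singleton velocity_hol).
have E a b : ('d potential xi (delta_mx 0 a)) 0 b = \sum_k (v k * dO a k b + Om xi k b * dv a k).
  have [_ e1] := diff_coord 0 b dp.
  apply: (etrans (esym (e1 _))).
  have hvk k : holomorphic_at (fun y => velocity y 0 k : C) xi by apply: hol_coord; exact: velocity_hol.
  have hk k : holomorphic_at (fun y => velocity y 0 k * Om y k b : C) xi.
    by apply: holM; [exact: hvk|exact: Omh].
  have -> : (fun y => potential y 0 b : C) = (fun y => \sum_k velocity y 0 k * Om y k b).
    by apply/funext => y; rewrite mxE.
  apply: (etrans (diff_sumE (index_enum _) _ hk)); apply: eq_bigr => k _.
  apply: (etrans (diffME _ (hvk k) (Omh k b))).
  have [_ e2] := diff_coord 0 k dvel.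
  exact: (congr1 (fun z : C => v k * dO a k b + Om xi k b * z) (e2 (delta_mx 0 a))).
have sk a b d : dO a b d = - dO a d b.
  have ne : \forall y \near xi, Om y b d = - Om y d b.
    apply: filterS skew => y /matrixP/(_ d b); rewrite !mxE => ->.
    by [].
  have hN : holomorphic_at (fun y => - Om y d b : C) xi by apply: holN; exact: Omh.
  have ne' : \forall y \near xi, - Om y d b = Om y b d by apply: filterS ne => y ->.
  have [_ e1] := diff_near_eq ne' (hol_diff hN).
  apply: (etrans (congr1 (fun h => h (delta_mx 0 a)) e1)).
  exact: (congr1 (fun h => h (delta_mx 0 a)) (diffN (hol_diff (Omh d b)))).
have sk0 b d : Om xi b d = - Om xi d b.
  by have /matrixP/(_ d b) := nbhs_singleton skew; rewrite !mxE.
apply: (etrans (f_equal2 (fun a b : C => a - b) (E i j) (E j i))).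
apply: etrans (lie_scaling i j).
rewrite -sumrB -!big_split /=; apply: eq_bigr => k _.
have aux (a1 a2 b1 b2 b3 b4 d1 d2 w : C) : a1 = - a2 -> b1 = - b2 -> b1 + b3 + b4 = 0 ->
    forall o : C,
    (w * b2 + o * d1) - (w * b3 + a2 * d2) = d1 * o + w * b4 + a1 * d2.
  move=> -> -> cl o.
  have -> : b4 = b2 - b3 by rewrite -[LHS]subr0 -cl; ring.
  ring.
apply: (aux _ _ (dO i j k) _ _ _ _ _ _ (sk0 i k) (sk i j k) (closed i j k)).
Qed.

End LieDerivative.

Section Pullback.
Context {R : realType}.
Notation C := (Cx R).
Variables (N : nat) (phi eta : 'rV[C]_N -> 'rV[C]_N).

Definition pull (y : 'rV[C]_N) : 'rV[C]_N :=
  \row_i \sum_k eta (phi y) 0 k * ('d phi y (delta_mx 0 i)) 0 k.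

Lemma pull_pair y (v : 'rV[C]_N) :
  \sum_i pull y 0 i * v 0 i = \sum_k eta (phi y) 0 k * ('d phi y v) 0 k.
Proof.
have E k : ('d phi y v) 0 k = \sum_i v 0 i * ('d phi y (delta_mx 0 i)) 0 k.
  rewrite {1}(diff_rV phi y v) summxE; apply: eq_bigr => i _; by rewrite mxE.
under [RHS]eq_bigr do rewrite E mulr_sumr.
rewrite exchange_big /=; apply: eq_bigr => i _; rewrite mxE mulr_suml.
by apply: eq_bigr => k _; ring.
Qed.

Variable y : 'rV[C]_N.
Hypothesis hphi : holomorphic_at phi y.
Hypothesis heta : holomorphic_at eta (phi y).

Let hek k : holomorphic_at (fun y => eta (phi y) 0 k : C) y.
Proof. by apply: (@hol_comp R _ _ phi (fun z => eta z 0 k)) => //; exact: hol_coord. Qed.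

Let hdk i k : holomorphic_at (fun y => ('d phi y (delta_mx 0 i)) 0 k : C) y.
Proof. by apply: hol_coord; exact: hol_deriv_mx. Qed.

Let hT i k : holomorphic_at (fun y => eta (phi y) 0 k * ('d phi y (delta_mx 0 i)) 0 k : C) y.
Proof. by apply: holM; [exact: hek|exact: hdk]. Qed.

Let pullE i : (fun y => pull y 0 i : C) =
  (fun y => \sum_k eta (phi y) 0 k * ('d phi y (delta_mx 0 i)) 0 k).
Proof. by apply/funext => z; rewrite mxE. Qed.

Lemma pull_hol : holomorphic_at pull y.
Proof.
apply: hol_mx => a i; rewrite ord1 pullE.
by apply: (@hol_sum R _ _ _ _ (fun k y => eta (phi y) 0 k * ('d phi y (delta_mx 0 i)) 0 k)) => k _.
Qed.

Lemma pull_diff (Om : 'M[C]_N) :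
  (forall i j, ('d eta (phi y) (delta_mx 0 i)) 0 j - ('d eta (phi y) (delta_mx 0 j)) 0 i = Om i j) ->
  forall i j, ('d pull y (delta_mx 0 i)) 0 j - ('d pull y (delta_mx 0 j)) 0 i =
  \sum_k \sum_l ('d phi y (delta_mx 0 i)) 0 k * Om k l * ('d phi y (delta_mx 0 j)) 0 l.
Proof.
move=> HOm.
pose dp i k : C := ('d phi y (delta_mx 0 i)) 0 k.
pose ddp i j k : C := ('d (fun z => 'd phi z (delta_mx 0 j)) y (delta_mx 0 i)) 0 k.
pose de l k : C := ('d eta (phi y) (delta_mx 0 l)) 0 k.
have dpull : differentiable pull y by case: (nbhs_singleton pull_hol).
have E i j : ('d pull y (delta_mx 0 i)) 0 j =
    \sum_k (eta (phi y) 0 k * ddp i j k + dp j k * \sum_l dp i l * de l k).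
  have [_ e1] := diff_coord 0 j dpull.
  apply: (etrans (esym (e1 _))); rewrite pullE.
  apply: (etrans (diff_sumE (index_enum _) _ (hT j))); apply: eq_bigr => k _.
  apply: (etrans (diffME _ (hek k) (hdk j k))).
  have dw : differentiable (fun z => 'd phi z (delta_mx 0 j)) y.
    by case: (nbhs_singleton (hol_deriv_mx (delta_mx 0 j) hphi)).
  have [_ e2] := diff_coord 0 k dw.
  have e3 := diff_comp_coord (delta_mx 0 i) 0 k hphi heta.
  have e4 : ('d eta (phi y) ('d phi y (delta_mx 0 i))) 0 k = \sum_l dp i l * de l k.
    rewrite {1}(diff_rV eta (phi y)) summxE; apply: eq_bigr => l _.
    by rewrite mxE.
  exact: (f_equal2 (fun a b : C => eta (phi y) 0 k * a + dp j k * b) (e2 _) (etrans e3 e4)).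
move=> i j.
apply: (etrans (f_equal2 (fun a b : C => a - b) (E i j) (E j i))).
have sw k : ddp i j k = ddp j i k.
  exact: (congr1 (fun v : 'rV[C]_N => v 0 k) (schwarz_mx (delta_mx 0 j) (delta_mx 0 i) hphi)).
rewrite !big_split /= opprD addrACA.
rewrite (eq_bigr _ (fun k _ => congr1 (fun z => eta (phi y) 0 k * z) (sw k))) subrr add0r.
have e1 : \sum_k dp j k * (\sum_l dp i l * de l k) = \sum_k \sum_l dp i k * dp j l * de k l.
  rewrite [RHS]exchange_big /=; apply: eq_bigr => k _; rewrite mulr_sumr.
  by apply: eq_bigr => l _; ring.
have e2 : \sum_k dp i k * (\sum_l dp j l * de l k) = \sum_k \sum_l dp i k * dp j l * de l k.
  by apply: eq_bigr => k _; rewrite mulr_sumr; apply: eq_bigr => l _; ring.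
rewrite e1 e2 -sumrB; apply: eq_bigr => k _; rewrite -sumrB; apply: eq_bigr => l _.
rewrite -HOm -/(dp i k) -/(dp j l) -/(de k l) -/(de l k); ring.
Qed.

End Pullback.

Section Charts.
Context {R : realType}.
Notation C := (Cx R).
Variables (n : nat) (Y : cmanifold R n).

Lemma cinv_near (k : chart Y) (x : Y) : cdom k x ->
  \forall z \near cmap k x, cdom k (cinv k z) /\ cmap k (cinv k z) = z.
Proof.
move=> kx; have : nbhs (cmap k x) (cmap k @` cdom k).
  by apply: open_nbhs_nbhs; split; [exact: cimg_open|exists x].
by apply: filterS => z [x' kx' <-]; rewrite cmapK.
Qed.

Lemma cmap_image_nbhs (k : chart Y) (U : set Y) (x : Y) : open U -> cdom k x -> U x ->
  nbhs (cmap k x) (cmap k @` (cdom k `&` U)).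
Proof.
move=> oU kx Ux.
have : \forall z \near cmap k x, U (cinv k z).
  apply: (cinv_continuous kx); rewrite cmapK //; exact: open_nbhs_nbhs.
move=> H; apply: filterS2 (cinv_near kx) H => z [kz zE] Uz.
by exists (cinv k z).
Qed.

End Charts.

Section Frame.
Context {R : realType}.
Notation C := (Cx R).
Variables (m n : nat) (M : cmanifold R m) (X : torus_family M n).
Notation unifX := (@unif R m M n X).
Notation projX := (@Defs.proj R m M n X).
Variables (c : chart M) (W : set M) (G : M -> 'M[C]_n).
Hypothesis oW : open W.
Hypothesis hF : holo_frame unifX W G.

Notation q := (frame_map unifX G c).
Definition frame_dom : set 'rV[C]_m := cmap c @` (cdom c `&` W).

Lemma proj_unif u z : projX (unifX u z) = u.
Proof.
have [rg _ _] := @fibre_torus R m M n X u.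
have : range (unifX u) (unifX u z) by exists z.
by rewrite rg.
Qed.

Lemma proj_frame y : projX (q y) = cinv c (lsubmx y).
Proof. exact: proj_unif. Qed.

Lemma frame_dom_nbhs u : cdom c u -> W u -> nbhs (cmap c u) frame_dom.
Proof. by move=> cu Wu; exact: cmap_image_nbhs. Qed.

Lemma frame_dom_near (y : 'rV[C]_(m + n)) : frame_dom (lsubmx y) ->
  \forall z \near y, frame_dom (lsubmx z).
Proof.
move=> [u [cu Wu] uy]; have : nbhs (lsubmx y) frame_dom.
  by rewrite -uy; exact: frame_dom_nbhs.
have cl : {for y, continuous (fun z : 'rV[C]_(m + n) => lsubmx z)}.
  exact: (@linear_rV_continuous _ _ _ (lsubmx : {linear 'rV[C]_(m + n) -> 'rV[C]_m})).
by move=> H; exact: (cl _ H).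
Qed.

Lemma frame_hol (y : 'rV[C]_(m + n)) k : frame_dom (lsubmx y) -> cdom k (q y) ->
  holomorphic_at (cmap k \o q) y.
Proof. by move=> Dy ky; have [_ /(_ c)[/(_ y Dy)[_ H] _]] := hF; exact: H. Qed.

Lemma frame_cont (y : 'rV[C]_(m + n)) : frame_dom (lsubmx y) -> {for y, continuous q}.
Proof. by move=> Dy; have [_ /(_ c)[/(_ y Dy)[H _] _]] := hF. Qed.

Lemma frame_inverse (y : 'rV[C]_(m + n)) k : frame_dom (lsubmx y) -> cdom k (q y) ->
  exists psi : 'rV[C]_(m + n) -> 'rV[C]_(m + n),
  [/\ holomorphic_at psi (cmap k (q y)),
      \forall z \near y, psi (cmap k (q z)) = z
    & \forall x \near cmap k (q y), q (psi x) = cinv k x /\ frame_dom (lsubmx (psi x))].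
Proof.
move=> Dy ky; have [_ /(_ c)[_ /(_ y Dy)[V [g [[oV Vy] VD oqV hg gq]]]]] := hF.
exists (g \o cinv k).
have qVy : (q @` V) (q y) by exists y.
split; first exact: hg.
  have H1 : \forall z \near y, V z by apply: open_nbhs_nbhs.
  have H2 : \forall z \near y, cdom k (q z).
    by apply: (frame_cont Dy); apply: open_nbhs_nbhs; split; [exact: cdom_open|].
  by apply: filterS2 H1 H2 => z Vz kz; rewrite /= cmapK // gq.
have : \forall x \near cmap k (q y), (q @` V) (cinv k x).
  apply: (cinv_continuous ky); rewrite cmapK //; exact: open_nbhs_nbhs.
apply: filterS => x [z Vz zx]; rewrite /= -zx gq //; split => //.
exact: VD.
Qed.

Lemma frame_diff_inj (y v : 'rV[C]_(m + n)) k : frame_dom (lsubmx y) -> cdom k (q y) ->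
  'd (cmap k \o q) y v = 0 -> v = 0.
Proof.
move=> Dy ky v0; have [psi [hpsi Hpsi _]] := frame_inverse Dy ky.
have hphi := frame_hol Dy ky.
have dphi : differentiable (cmap k \o q) y by case: (nbhs_singleton hphi).
have dpsi : differentiable psi ((cmap k \o q) y) by case: (nbhs_singleton hpsi).
have e1 := congr1 (fun h => h v) (diff_comp dphi dpsi).
have did : differentiable (fun z : 'rV[C]_(m + n) => z) y by case: (nbhs_singleton (hol_rV_id y)).
have ne : \forall z \near y, z = psi ((cmap k \o q) z) by apply: filterS Hpsi => z ->.
have [_ e2] := diff_near_eq ne did.
have e3 : v = 'd psi ((cmap k \o q) y) ('d (cmap k \o q) y v).
  apply: etrans e1; apply: etrans (esym (congr1 (fun h => h v) e2)).
  exact: esym (diff_rV_id y v).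
apply: (etrans e3); apply: (etrans (congr1 ('d psi ((cmap k \o q) y)) v0)).
exact: linear0.
Qed.

Lemma proj_near (U : set M) (y : 'rV[C]_(m + n)) k : open U -> U (projX (q y)) ->
  frame_dom (lsubmx y) -> cdom k (q y) ->
  \forall x \near cmap k (q y), U (projX (cinv k x)).
Proof.
move=> oU Uy Dy ky; have [psi [hpsi Hpsi1 Hpsi]] := frame_inverse Dy ky.
have psiy : psi (cmap k (q y)) = y := nbhs_singleton Hpsi1.
have [u [cu Wu] uy] := Dy.
have cl : {for y, continuous (fun z : 'rV[C]_(m + n) => lsubmx z)}.
  exact: (@linear_rV_continuous _ _ _ (lsubmx : {linear 'rV[C]_(m + n) -> 'rV[C]_m})).
have cpsi : {for cmap k (q y), continuous psi}.
  by apply: differentiable_continuous; case: (nbhs_singleton hpsi).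
have H1 : \forall z \near lsubmx y, U (cinv c z).
  rewrite -uy; apply: (cinv_continuous cu); apply: open_nbhs_nbhs; split => //.
  by move: Uy; rewrite proj_frame -uy.
have H2 : \forall z \near y, U (cinv c (lsubmx z)) by exact: (cl _ H1).
have H3 : \forall x \near cmap k (q y), U (cinv c (lsubmx (psi x))).
  have H2' : nbhs (psi (cmap k (q y))) [set z | U (cinv c (lsubmx z))] by rewrite psiy.
  exact: (cpsi _ H2').
by apply: filterS2 H3 Hpsi => x Ux [qx _]; rewrite -qx proj_frame.
Qed.

End Frame.

Section EulerPotential.
Context {R : realType}.
Notation C := (Cx R).
Variables (r : nat) (M : cmanifold R r) (X : SK_geometry M).
Notation unifX := (@unif R r M r X).
Notation projX := (@Defs.proj R r M r X).
Notation Y := (@Defs.total R r M r X).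
Notation L := (sk_L X).
Notation form := Defs.form.
Notation N := (r + r)%N.
Variables (actX : C -> Y -> Y) (e : C) (U : set M).
Hypothesis e0 : 0 < e.
Hypothesis oU : open U.
Hypothesis hA : holo_action actX e (projX @^-1` U).
Hypothesis hA1 : forall x, U (projX x) -> actX 1 x = x.
Hypothesis hS : forall t (x : Y), `|t - 1| < e -> U (projX x) ->
  forall k k', cdom k x -> cdom k' (actX t x) ->
  form_pullback L (actX t \o cinv k) k' (cmap k x) = t *: form L k (cmap k x).

Definition traj (k : chart Y) (y : 'rV[C]_(1 + N)) : 'rV[C]_N :=
  cmap k (actX (lsubmx y 0 0) (cinv k (rsubmx y))).

(* The contraction of L with the Euler field (the velocity of actX at t = 1). *)
Definition eta_chart (k : chart Y) : 'rV[C]_N -> 'rV[C]_N :=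
  potential (traj k) (form L k).

Lemma traj_at_time k t x : traj k (at_time t x) = cmap k (actX t (cinv k x)).
Proof. by rewrite /traj /at_time row_mxKl row_mxKr mxE eqxx mulr1n. Qed.

Section AtPoint.
Variables (k : chart Y) (x : Y).
Hypothesis kx : cdom k x.
Hypothesis Ux : U (projX x).
Hypothesis near_U : \forall z \near cmap k x, U (projX (cinv k z)).
Notation xi := (cmap k x).

Lemma action_into : holo_into [set y : 'rV[C]_(1 + N) |
        `|lsubmx y 0 0 - 1| < e /\ (cmap k @` (cdom k `&` projX @^-1` U)) (rsubmx y)]
      (fun y => actX (lsubmx y 0 0) (cinv k (rsubmx y))).
Proof. exact: hA. Qed.

Lemma at_time1_dom : `|lsubmx (at_time 1 xi) 0 0 - 1| < e /\
  (cmap k @` (cdom k `&` projX @^-1` U)) (rsubmx (at_time 1 xi)).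
Proof.
rewrite /at_time row_mxKl row_mxKr mxE eqxx mulr1n subrr normr0; split=> //.
by exists x.
Qed.

Lemma act1_cinv : actX (lsubmx (at_time 1 xi) 0 0) (cinv k (rsubmx (at_time 1 xi))) = x.
Proof. by rewrite /at_time row_mxKl row_mxKr mxE eqxx mulr1n cmapK // hA1. Qed.

Lemma traj_hol_at : holomorphic_at (traj k) (at_time 1 xi).
Proof.
have [_ H] := action_into at_time1_dom.
by apply: H; rewrite act1_cinv.
Qed.

Lemma act_dom_near (k' : chart Y) : cdom k' x -> \forall t \near (1 : C), cdom k' (actX t x).
Proof.
move=> k'x; have [H _] := action_into at_time1_dom.
have H1 : \forall y \near at_time 1 xi, cdom k' (actX (lsubmx y 0 0) (cinv k (rsubmx y))).
  apply: H; rewrite act1_cinv; apply: open_nbhs_nbhs; split=> //; exact: cdom_open.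
have ct := hol_cont_mx (at_time_hol0 1 xi).
have H2 : \forall t \near (1 : C),
   cdom k' (actX (lsubmx (at_time t xi) 0 0) (cinv k (rsubmx (at_time t xi)))).
  exact: (ct _ H1).
by apply: filterS H2 => t; rewrite /at_time row_mxKl row_mxKr mxE eqxx mulr1n cmapK.
Qed.

Lemma traj1 : \forall z \near xi, traj k (at_time 1 z) = z.
Proof.
apply: filterS2 near_U (cinv_near kx) => z Uz [kz zE].
by rewrite traj_at_time hA1.
Qed.

Lemma form_skew_near : \forall z \near xi, (form L k z)^T = - form L k z.
Proof. by apply: filterS (cinv_near kx) => z [kz zE]; rewrite -zE form_skew. Qed.

Lemma form_closed_diff : forall i j l : 'I_N,
  let D (a b d : 'I_N) := 'd (fun y => form L k y b d : C) xi (delta_mx 0 a) : C in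
  D i j l + D j l i + D l i j = 0.
Proof.
move=> i j l; have := sk_closed kx i j l; rewrite /=.
have dE b d v : 'D_v (fun y => form L k y b d : C) xi = 'd (fun y => form L k y b d : C) xi v.
  apply: deriveE; apply: hol_diff; apply: hol_coord; exact: form_holo.
by move=> H; apply: etrans H; congr (_ + _ + _); exact: esym (dE _ _ _).
Qed.

Lemma traj_scaling : \forall t \near (1 : C), forall i j : 'I_N,
  \sum_a \sum_b ('d (traj k) (at_time t xi) (row_mx 0 (delta_mx 0 i))) 0 a *
     form L k (traj k (at_time t xi)) a b *
     ('d (traj k) (at_time t xi) (row_mx 0 (delta_mx 0 j))) 0 b
  = t * form L k xi i j.
Proof.
have ct := hol_cont_mx (at_time_hol0 1 xi).
have H1 : \forall t \near (1 : C), holomorphic_at (traj k) (at_time t xi).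
  exact: (ct (fun y => holomorphic_at (traj k) y) (near_join traj_hol_at)).
have H2 : \forall t \near (1 : C), `|t - 1| < e.
  have [d d0 ->] := gt0_cr e0.
  by apply/(@nbhs_nrmP R C); exists d => // y; rewrite nrmE cr_lt.
apply: filterS3 H1 H2 (act_dom_near kx) => t ht te kt i j.
have := hS te Ux kx kt; rewrite /form_pullback /= cmapK // => /matrixP/(_ i j).
rewrite [in RHS]mxE => <-.
have dE v : v *m 'J (cmap k \o (actX t \o cinv k)) xi = 'd (traj k) (at_time t xi) (row_mx 0 v).
  rewrite mul_rV_lin1.
  have -> : cmap k \o (actX t \o cinv k) = traj k \o at_time t.
    by apply/funext => z; rewrite /= traj_at_time.
  have dt : differentiable (at_time t) xi by case: (nbhs_singleton (at_time_hol1 t xi)).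
  have dT : differentiable (traj k) (at_time t xi) by case: (nbhs_singleton ht).
  apply: (etrans (congr1 (fun h => h v) (diff_comp dt dT))).
  exact: (congr1 ('d (traj k) (at_time t xi)) (at_time_diff1 t xi v)).
rewrite traj_at_time cmapK //.
set A := 'J _ _ in dE *.
rewrite mxE; apply: etrans (exchange_big _ _ _ _ _ _) _ => /=.
apply: eq_bigr => b _; rewrite [(A *m _) i b]mxE mulr_suml; apply: eq_bigr => a _.
by rewrite -!dE -!rowE !mxE.
Qed.

Lemma eta_chart_hol : holomorphic_at (eta_chart k) xi.
Proof. by apply: potential_hol; [exact: traj_hol_at|exact: form_holo]. Qed.

Lemma eta_chart_diff i j :
  ('d (eta_chart k) xi (delta_mx 0 i)) 0 j - ('d (eta_chart k) xi (delta_mx 0 j)) 0 i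
  = form L k xi i j.
Proof.
exact: (potential_diff traj_hol_at (form_holo L kx) form_skew_near form_closed_diff traj1 traj_scaling).
Qed.

End AtPoint.

Lemma velocity_curve k x : cdom k x -> U (projX x) ->
  'd (fun t => traj k (at_time t (cmap k x))) (1 : C) (1 : C) =
  velocity (traj k) (cmap k x).
Proof.
move=> kx Ux; have hT := traj_hol_at kx Ux.
have dt : differentiable (fun t => at_time t (cmap k x)) (1 : C).
  by case: (nbhs_singleton (at_time_hol0 1 (cmap k x))).
have dT : differentiable (traj k) (at_time 1 (cmap k x)) by case: (nbhs_singleton hT).
apply: (etrans (congr1 (fun h => h (1 : C)) (diff_comp dt dT))).
exact: (congr1 ('d (traj k) (at_time 1 (cmap k x))) (at_time_diff0 1 (cmap k x) 1)).
Qed.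

Lemma velocity_change k k' x : cdom k x -> cdom k' x -> U (projX x) ->
  velocity (traj k') (cmap k' x) =
  velocity (traj k) (cmap k x) *m 'J (cmap k' \o cinv k) (cmap k x).
Proof.
move=> kx k'x Ux.
pose tau t := traj k (at_time t (cmap k x)).
have htau : holomorphic_at tau (1 : C).
  by apply: (@hol_comp_mx R _ _ _ _ (fun t => at_time t (cmap k x)) (traj k));
    [exact: at_time_hol0|exact: traj_hol_at].
have tau1 : tau 1 = cmap k x by rewrite /tau traj_at_time cmapK // hA1.
have hg : holomorphic_at (cmap k' \o cinv k) (tau 1) by rewrite tau1; exact: chart_change.
have dtau : differentiable tau (1 : C) by case: (nbhs_singleton htau).
have dg : differentiable (cmap k' \o cinv k) (tau 1) by case: (nbhs_singleton hg).
have ne : \forall t \near (1 : C), (cmap k' \o cinv k) (tau t) = traj k' (at_time t (cmap k' x)).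
  apply: filterS (act_dom_near kx Ux kx) => t kt.
  by rewrite /tau !traj_at_time /= !cmapK.
have [_ e1] := diff_near_eq ne (differentiable_comp dtau dg).
apply: (etrans (esym (velocity_curve k'x Ux))).
apply: (etrans (congr1 (fun h => h (1 : C)) e1)).
apply: (etrans (congr1 (fun h => h (1 : C)) (diff_comp dtau dg))).
have e2 := velocity_curve kx Ux.
apply: (etrans (congr1 ('d (cmap k' \o cinv k) (tau 1)) e2)).
by rewrite tau1 mul_rV_lin1.
Qed.

Lemma sum_mul_tr n (u w : 'rV[C]_n) : \sum_j u 0 j * w 0 j = (u *m w^T) 0 0.
Proof. by rewrite mxE; apply: eq_bigr => j _; rewrite mxE. Qed.

Lemma pull_coord n (phi eta : 'rV[C]_n -> 'rV[C]_n) y i :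
  pull phi eta y 0 i = (eta (phi y) *m ('d phi y (delta_mx 0 i))^T) 0 0.
Proof. by rewrite mxE; exact: sum_mul_tr. Qed.

Section Global.
Variables (c : chart M) (W : set M) (G : M -> 'M[C]_r).
Hypothesis oW : open W.
Hypothesis hF : holo_frame unifX W G.
Notation q := (frame_map unifX G c).

Definition chart_at (x : Y) : chart Y := projT1 (cid (cdom_cover x)).
Lemma chart_atP x : cdom (chart_at x) x.
Proof. by rewrite /chart_at; case: cid. Qed.

(* The chart chosen at q y is irrelevant by pull_chart_indep. *)
Definition eta_frame (y : 'rV[C]_N) : 'rV[C]_N :=
  pull (cmap (chart_at (q y)) \o q) (eta_chart (chart_at (q y))) y.

Definition form_frame (y : 'rV[C]_N) : 'M[C]_N := \matrix_(i, j)
  \sum_a \sum_b ('d (cmap (chart_at (q y)) \o q) y (delta_mx 0 i)) 0 a *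
    form L (chart_at (q y)) (cmap (chart_at (q y)) (q y)) a b *
    ('d (cmap (chart_at (q y)) \o q) y (delta_mx 0 j)) 0 b.

Lemma pull_chart_indep k k' y : frame_dom c W (lsubmx y) -> U (projX (q y)) ->
  cdom k (q y) -> cdom k' (q y) ->
  pull (cmap k \o q) (eta_chart k) y = pull (cmap k' \o q) (eta_chart k') y.
Proof.
move=> Dy Uy ky k'y; apply/rowP => i.
apply: (etrans (pull_coord _ _ _ _)); apply: etrans (esym (pull_coord _ _ _ _)).
apply: (congr1 (fun z : 'M[C]_1 => z 0 0)).
rewrite /eta_chart /potential.
have hphi := frame_hol hF Dy ky.
have dphi : differentiable (cmap k \o q) y by case: (nbhs_singleton hphi).
have hg : holomorphic_at (cmap k' \o cinv k) (cmap k (q y)) by exact: chart_change.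
have dg : differentiable (cmap k' \o cinv k) ((cmap k \o q) y) by case: (nbhs_singleton hg).
have ne : \forall z \near y, (cmap k' \o cinv k) ((cmap k \o q) z) = (cmap k' \o q) z.
  have : \forall z \near y, cdom k (q z).
    by apply: (frame_cont hF Dy); apply: open_nbhs_nbhs; split; [exact: cdom_open|].
  by apply: filterS => z kz; rewrite /= cmapK.
have [_ e1] := diff_near_eq ne (differentiable_comp dphi dg).
set v := delta_mx 0 i.
have e2 : 'd (cmap k' \o q) y v =
    'd (cmap k \o q) y v *m 'J (cmap k' \o cinv k) (cmap k (q y)).
  apply: (etrans (congr1 (fun h => h v) e1)).
  apply: (etrans (congr1 (fun h => h v) (diff_comp dphi dg))).
  by rewrite mul_rV_lin1.
have e3 := velocity_change ky k'y Uy.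
have := form_change L ky k'y; rewrite /= => e4.
rewrite e4; apply: etrans (esym (congr1 (fun z => velocity (traj k') (cmap k' (q y)) *m
  form L k' (cmap k' (q y)) *m z^T) e2)).
rewrite trmx_mul; apply: etrans (esym (congr1 (fun z => z *m form L k' (cmap k' (q y)) *m
  (('J (cmap k' \o cinv k) (cmap k (q y)))^T *m ('d (cmap k \o q) y v)^T)) e3)).
by rewrite !mulmxA.
Qed.

Definition base_dom : set 'rV[C]_r := cmap c @` (cdom c `&` (W `&` U)).

Lemma base_dom_frame u : base_dom u -> frame_dom c W u.
Proof. by move=> [x [cx [Wx Ux]] <-]; exists x. Qed.

Lemma base_dom_proj (y : 'rV[C]_N) : base_dom (lsubmx y) -> U (projX (q y)).
Proof. by move=> [x [cx [Wx Ux]] xy]; rewrite proj_frame -xy cmapK. Qed.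

Lemma base_dom_nbhs x : cdom c x -> W x -> U x -> nbhs (cmap c x) base_dom.
Proof. by move=> cx Wx Ux; apply: cmap_image_nbhs => //; exact: openI. Qed.

Lemma base_dom_near (y : 'rV[C]_N) : base_dom (lsubmx y) ->
  \forall z \near y, base_dom (lsubmx z).
Proof. by move=> Dy; apply: (@frame_dom_near R r r M c (W `&` U)) => //; exact: openI. Qed.

Lemma eta_frame_near y : base_dom (lsubmx y) ->
  \forall z \near y, pull (cmap (chart_at (q y)) \o q) (eta_chart (chart_at (q y))) z = eta_frame z.
Proof.
move=> Dy; have ky := chart_atP (q y).
have H : \forall z \near y, cdom (chart_at (q y)) (q z).
  apply: (frame_cont hF (base_dom_frame Dy)).
  by apply: open_nbhs_nbhs; split; [exact: cdom_open|].
apply: filterS2 (base_dom_near Dy) H => z Dz kz.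
by apply: pull_chart_indep; [exact: base_dom_frame|exact: base_dom_proj|exact: kz|exact: chart_atP].
Qed.

Lemma eta_frame_hol y : base_dom (lsubmx y) -> holomorphic_at eta_frame y.
Proof.
move=> Dy; have ky := chart_atP (q y); have Fy := base_dom_frame Dy.
have Uy := base_dom_proj Dy.
have h : holomorphic_at (pull (cmap (chart_at (q y)) \o q) (eta_chart (chart_at (q y)))) y.
  apply: pull_hol; first exact: (frame_hol hF Fy ky).
  exact: eta_chart_hol.
apply: hol_mx => i j; apply: hol_near_eq (hol_coord i j h).
by apply: filterS (eta_frame_near Dy) => z ->.
Qed.

Lemma eta_frame_diff y : base_dom (lsubmx y) -> forall i j : 'I_N,
  ('d eta_frame y (delta_mx 0 i)) 0 j - ('d eta_frame y (delta_mx 0 j)) 0 i = form_frame y i j.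
Proof.
move=> Dy i j; have ky := chart_atP (q y); have Fy := base_dom_frame Dy.
have Uy := base_dom_proj Dy.
have hphi := frame_hol hF Fy ky.
have nU := proj_near hF oU Uy Fy ky.
have h := pull_hol hphi (eta_chart_hol ky Uy).
have dpull : differentiable (pull (cmap (chart_at (q y)) \o q) (eta_chart (chart_at (q y)))) y.
  by case: (nbhs_singleton h).
have [_ e1] := diff_near_eq (eta_frame_near Dy) dpull.
have E := pull_diff hphi (eta_chart_hol ky Uy) (eta_chart_diff ky Uy nU) i j.
rewrite mxE; apply: etrans E.
exact: (f_equal2 (fun a b : 'rV[C]_N => a 0 j - b 0 i)
  (congr1 (fun h => h (delta_mx 0 i)) e1) (congr1 (fun h => h (delta_mx 0 j)) e1)).
Qed.

Lemma form_frame_unit y : base_dom (lsubmx y) -> form_frame y \in unitmx.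
Proof.
move=> Dy; have ky := chart_atP (q y); have Fy := base_dom_frame Dy.
pose J := 'J (cmap (chart_at (q y)) \o q) y.
have -> : form_frame y = J *m form L (chart_at (q y)) (cmap (chart_at (q y)) (q y)) *m J^T.
  apply/matrixP => i j; rewrite !mxE exchange_big /=; apply: eq_bigr => b _.
  rewrite [(J *m _) i b]mxE mulr_suml; apply: eq_bigr => a _.
  by rewrite -!mul_rV_lin1 -!rowE !mxE.
have uJ : J \in unitmx.
  rewrite -row_free_unit; apply/inj_row_free => v; rewrite mul_rV_lin1.
  exact: (frame_diff_inj hF Fy ky).
by rewrite !unitmx_mul uJ unitmx_tr uJ sk_nondegenerate.
Qed.

Lemma eta_frame_period (Z : 'rV[C]_r -> 'M[C]_(r + r, r)) (y v : 'rV[C]_N) a :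
  base_dom (lsubmx y) -> holomorphic_at Z (lsubmx y) ->
  (\forall u \near lsubmx y, periods (unifX (cinv c u)) (row a (Z u) *m G (cinv c u))) ->
  \sum_j eta_frame y 0 j * v 0 j =
  \sum_j eta_frame (row_mx (lsubmx y) (rsubmx y + row a (Z (lsubmx y)))) 0 j *
    row_mx (lsubmx v) (rsubmx v + row a ('d Z (lsubmx y) (lsubmx v))) 0 j.
Proof.
move=> Dy hZ hper; have ky := chart_atP (q y); have Fy := base_dom_frame Dy.
pose T (z : 'rV[C]_N) : 'rV[C]_N := row_mx (lsubmx z) (rsubmx z + row a (Z (lsubmx z))).
have qT z : periods (unifX (cinv c (lsubmx z))) (row a (Z (lsubmx z)) *m G (cinv c (lsubmx z))) ->
    q (T z) = q z.
  by move=> pz; rewrite /frame_map /T row_mxKl row_mxKr mulmxDl pz.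
have hl : holomorphic_at (fun z : 'rV[C]_N => lsubmx z) y.
  exact: (hol_linear (lsubmx : {linear 'rV[C]_N -> 'rV[C]_r})).
have hr : holomorphic_at (fun z : 'rV[C]_N => rsubmx z) y.
  exact: (hol_linear (rsubmx : {linear 'rV[C]_N -> 'rV[C]_r})).
have hZl : holomorphic_at (fun z : 'rV[C]_N => Z (lsubmx z)) y.
  exact: (@hol_comp_mx R _ _ _ _ (fun z => lsubmx z) Z y hl hZ).
have hsum : holomorphic_at (fun z : 'rV[C]_N => rsubmx z + row a (Z (lsubmx z))) y.
  apply: hol_mx => i j.
  have -> : (fun z : 'rV[C]_N => (rsubmx z + row a (Z (lsubmx z))) i j : C) =
      (fun z => rsubmx z i j + Z (lsubmx z) a j).
    by apply/funext => z; rewrite !mxE.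
  by apply: holD; exact: hol_coord.
have hT : holomorphic_at T y := hol_row_mx hl hsum.
have dT w : 'd T y w = row_mx (lsubmx w) (rsubmx w + row a ('d Z (lsubmx y) (lsubmx w))).
  have dl : 'd (fun z : 'rV[C]_N => lsubmx z) y w = lsubmx w.
    exact: (congr1 (fun h => h w) (diff_lin y (@linear_rV_continuous _ _ _
      (lsubmx : {linear 'rV[C]_N -> 'rV[C]_r})))).
  have dr : 'd (fun z : 'rV[C]_N => rsubmx z) y w = rsubmx w.
    exact: (congr1 (fun h => h w) (diff_lin y (@linear_rV_continuous _ _ _
      (rsubmx : {linear 'rV[C]_N -> 'rV[C]_r})))).
  apply: (etrans (diff_row_mx w hl hsum)).
  apply: (f_equal2 (fun a b : 'rV[C]_r => row_mx a b)); first exact: dl.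
  have dsum : differentiable (fun z : 'rV[C]_N => rsubmx z + row a (Z (lsubmx z))) y.
    by case: (nbhs_singleton hsum).
  apply/rowP => j; have [_ e1] := diff_coord 0 j dsum.
  apply: (etrans (esym (e1 w))).
  have -> : (fun z : 'rV[C]_N => (rsubmx z + row a (Z (lsubmx z))) 0 j : C) =
      (fun z => rsubmx z 0 j + Z (lsubmx z) a j).
    by apply/funext => z; rewrite !mxE.
  apply: (etrans (diffDE w (hol_coord 0 j hr) (hol_coord a j hZl))).
  rewrite 2!mxE; have drr : differentiable (fun z : 'rV[C]_N => rsubmx z) y.
    by case: (nbhs_singleton hr).
  have [_ e2] := diff_coord 0 j drr.
  have e3 := diff_comp_coord w a j hl hZ.
  have e4 := etrans (e2 w) (congr1 (fun z : 'rV[C]_r => z 0 j) dr).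
  have e5 := etrans e3 (congr1 (fun z : 'rV[C]_r => ('d Z (lsubmx y) z) a j) dl).
  apply: (etrans (f_equal2 (fun a b : C => a + b) e4 e5)).
  by rewrite [in RHS]mxE [in LHS]mxE.
have hper0 := nbhs_singleton hper.
have qTy := qT y hper0.
apply: etrans (congr1 (fun z : 'rV[C]_N => \sum_j eta_frame (T y) 0 j * z 0 j) (dT v)).
apply: (etrans (pull_pair _ _ y v)).
apply: etrans (esym (pull_pair _ _ (T y) ('d T y v))).
pose Fn (x : Y) : C := \sum_j eta_chart (chart_at x) (cmap (chart_at x) x) 0 j *
  ('d (cmap (chart_at x) \o q) (T y) ('d T y v)) 0 j.
apply: etrans (esym (congr1 Fn qTy)); rewrite {}/Fn.
pose k := chart_at (q y); rewrite -/k in ky *.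
apply: eq_bigr => j _.
apply: (congr1 (fun z : 'rV[C]_N => eta_chart k (cmap k (q y)) 0 j * z 0 j)).
have FT : frame_dom c W (lsubmx (T y)) by rewrite /T row_mxKl.
have kT : cdom k (q (T y)) by rewrite qTy.
have hphi := frame_hol hF FT kT.
have dphi : differentiable (cmap k \o q) (T y) by case: (nbhs_singleton hphi).
have dTy : differentiable T y by case: (nbhs_singleton hT).
have cl := hol_cont_mx hl.
have ne : \forall z \near y, (cmap k \o q) (T z) = (cmap k \o q) z.
  have : \forall z \near y, periods (unifX (cinv c (lsubmx z)))
     (row a (Z (lsubmx z)) *m G (cinv c (lsubmx z))) by exact: (cl _ hper).
  by apply: filterS => z pz; rewrite /= qT.
have [_ e1] := diff_near_eq ne (differentiable_comp dTy dphi).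
apply: (etrans (congr1 (fun h => h v) e1)).
exact: (congr1 (fun h => h v) (diff_comp dTy dphi)).
Qed.

End Global.

End EulerPotential.

(** * Flat frames of the homology *)

Section Comparison.
Context {R : realType}.
Notation C := (Cx R).

Lemma cvg_mulmx (T : Type) (F : set_system T) (FF : Filter F) m n p
    (f : T -> 'M[C]_(m, n)) (g : T -> 'M[C]_(n, p)) (a : 'M[C]_(m, n)) (b : 'M[C]_(n, p)) :
  f @ F --> a -> g @ F --> b -> f t *m g t @[t --> F] --> a *m b.
Proof.
move=> fa gb; apply: cvg_mx => i j.
have H k : (f t i k * g t k j : C) @[t --> F] --> (a i k * b k j : C).
  apply: (@cvgM C).
    exact: (@cvg_comp _ _ _ f (fun M : 'M[C]_(m, n) => M i k : C) _ _ _ fa (@coord_continuous C m n i k a)).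
  exact: (@cvg_comp _ _ _ g (fun M : 'M[C]_(n, p) => M k j : C) _ _ _ gb (@coord_continuous C n p k j b)).
have -> : (fun t => (f t *m g t) i j) = (fun t => \sum_k f t i k * g t k j).
  by apply/funext => t; rewrite mxE.
rewrite mxE; elim: (index_enum _) => [|k s IH].
  have -> : (fun t => \sum_(k <- [::]) f t i k * g t k j) = (fun=> 0 : C).
    by apply/funext => t; rewrite big_nil.
  by rewrite big_nil; exact: cvg_cst.
have -> : (fun t => \sum_(k0 <- k :: s) f t i k0 * g t k0 j) =
    (fun t => f t i k * g t k j + \sum_(k0 <- s) f t i k0 * g t k0 j).
  by apply/funext => t; rewrite big_cons.
by rewrite big_cons; apply: (@cvgD _ C); [exact: H|exact: IH].
Qed.

Variables (m n : nat) (M : cmanifold R m) (X : torus_family M n).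
Notation unifX := (@unif R m M n X).
Notation projX := (@Defs.proj R m M n X).

Lemma unif_eq u z z' : unifX u z = unifX u z' -> periods (unifX u) (z' - z).
Proof. by have [_ H _] := @fibre_torus R m M n X u; exact: H. Qed.

Section TwoFrames.
Variables (u0 : M) (c : chart M) (W0 W1 : set M) (G0 G1 : M -> 'M[C]_n)
  (B0 : M -> 'M[C]_(n + n, n)).
Hypothesis cu0 : cdom c u0.
Hypothesis oW0 : open W0.
Hypothesis W0u : W0 u0.
Hypothesis W1u : W1 u0.
Hypothesis hF0 : holo_frame unifX W0 G0.
Hypothesis hF1 : holo_frame unifX W1 G1.
Hypothesis lB0 : forall u, W0 u -> lattice_basis (periods (unifX u)) (B0 u).
Hypothesis hZ0 : holo_from W0 (fun u => B0 u *m invmx (G0 u)).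
Notation q0 := (frame_map unifX G0 c).
Notation q1 := (frame_map unifX G1 c).
Notation Z0 := (fun v => B0 (cinv c v) *m invmx (G0 (cinv c v))).
Notation y0 := (row_mx (cmap c u0) 0 : 'rV[C]_(m + n)).

Lemma frame_rbasis u : W0 u -> rbasis (B0 u *m invmx (G0 u)).
Proof.
move=> Wu a; have [H _] := lB0 Wu; have [uG _] := hF0.
by rewrite mulmxA => /(congr1 (mulmx^~ (G0 u))); rewrite mulmxKV ?uG // mul0mx; exact: H.
Qed.

Lemma ref_cont : {for cmap c u0, continuous Z0}.
Proof. by apply: hol_cont_mx; exact: hZ0. Qed.

Lemma transition_local : exists2 s : 'rV[C]_(m + n) -> 'rV[C]_n,
  \forall y \near y0, holomorphic_at s y &
  s y0 = 0 /\ \forall y \near y0, exists k : 'rV[int]_(n + n),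
    rsubmx y *m (G1 (cinv c (lsubmx y)) *m invmx (G0 (cinv c (lsubmx y)))) - s y =
    map_mx intr k *m Z0 (lsubmx y).
Proof.
have [uG0 _] := hF0; have [uG1 _] := hF1.
have D0 : frame_dom c W0 (lsubmx y0) by rewrite row_mxKl; exists u0.
have D1 : frame_dom c W1 (lsubmx y0) by rewrite row_mxKl; exists u0.
pose x0 := q0 y0.
have q10 : q1 y0 = x0 by rewrite /x0 /frame_map row_mxKl row_mxKr !mul0mx.
have [k kx] := cdom_cover x0.
have [psi [hpsi Hpsi1 Hpsi]] := frame_inverse hF0 D0 kx.
have kx1 : cdom k (q1 y0) by rewrite q10.
have hq1 := frame_hol hF1 D1 kx1.
pose st (y : 'rV[C]_(m + n)) := psi (cmap k (q1 y)).
have hst : holomorphic_at st y0.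
  have hpsi' : holomorphic_at psi ((cmap k \o q1) y0).
    rewrite /comp q10; exact: hpsi.
  exact: (@hol_comp_mx R _ _ _ _ (cmap k \o q1) psi y0 hq1 hpsi').
have hl : forall y, holomorphic_at (fun z : 'rV[C]_(m + n) => rsubmx z) y.
  by move=> y; exact: (hol_linear (rsubmx : {linear 'rV[C]_(m + n) -> 'rV[C]_n})).
exists (fun y => rsubmx (st y)).
  apply: filterS (near_join hst) => y hy.
  exact: (@hol_comp_mx R _ _ _ _ st (fun z => rsubmx z) y hy (hl _)).
have st0 : st y0 = y0 by rewrite /st q10; exact: (nbhs_singleton Hpsi1).
split; first by rewrite st0 row_mxKr.
have N1 : \forall y \near y0, cdom k (q1 y).
  by apply: (frame_cont hF1 D1); apply: open_nbhs_nbhs; split; [exact: cdom_open|].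
have Hpsi' : \forall x \near cmap k (q1 y0), q0 (psi x) = cinv k x /\ frame_dom c W0 (lsubmx (psi x)).
  by rewrite q10.
have N2 : \forall y \near y0, q0 (st y) = cinv k (cmap k (q1 y)) /\ frame_dom c W0 (lsubmx (st y)).
  exact: (hol_cont_mx hq1 Hpsi').
have N3 := frame_dom_near oW0 D0.
apply: filterS3 N1 N2 N3 => y ky [qst Dst] Dy.
rewrite cmapK // in qst.
have El : lsubmx (st y) = lsubmx y.
  have : projX (q0 (st y)) = projX (q1 y) by rewrite qst.
  rewrite !proj_frame; move: Dst Dy => [a [ca _] <-] [b [cb _] <-].
  by rewrite !cmapK // => ->.
move: qst; rewrite /frame_map El => /unif_eq.
have [a [ca Wa] ay] := Dy.
have Wu : W0 (cinv c (lsubmx y)) by rewrite -ay cmapK.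
set u := cinv c (lsubmx y) in Wu *.
have [_ ->] := lB0 Wu; move=> [l _ lE]; exists l.
by rewrite /= -/u !mulmxA lE mulmxBl mulmxK ?uG0.
Qed.

(* The discrepancy is additive in the fibre variable, so a nonzero lattice
   vector would be divisible by every power of two. *)
Lemma transition_cont :
  {for u0, continuous (fun u => G1 u *m invmx (G0 u))}.
Proof.
have [s hs [s0 Hs]] := transition_local.
pose K v := G1 (cinv c v) *m invmx (G0 (cinv c v)).
have rZ : rbasis (Z0 (cmap c u0)) by rewrite /= cmapK //; exact: frame_rbasis.
have [d d0 Hd] := rbasis_discrete rZ.
have d4 : 0 < d / 4 by rewrite divr_gt0.
have NZ : \forall v \near cmap c u0, nrm (Z0 v - Z0 (cmap c u0)) < d.
  by have /continuous_nrmP := ref_cont; apply.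
have cs : {for y0, continuous s} by apply: hol_cont_mx; exact: nbhs_singleton hs.
have Ns : \forall y \near y0, nrm (s y) < d / 4.
  by have /continuous_nrmP/(_ _ d4) := cs; apply: filterS => y; rewrite s0 subr0.
have [a a0 Ha] := iffLR (nbhs_nrmP _ _) NZ.
have [b b0 Hb] := iffLR (nbhs_nrmP _ _) (filterI Hs (filterI hs Ns)).
pose p := Num.min a b.
have p0 : 0 < p by rewrite lt_min a0.
have near_y v (w : 'rV[C]_n) : nrm (v - cmap c u0) < p -> nrm w < p ->
    nrm (row_mx v w - y0) < b.
  move=> vp wp; apply: nrm_mx_lt => // i j.
  rewrite opp_row_mx add_row_mx subr0.
  have pb : p <= b by rewrite ge_min lexx orbT.
  rewrite mxE; case: (fintype.split j) => l.
    by apply: le_lt_trans (nrm_coord _ _ _) _; apply: lt_le_trans vp pb.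
  by apply: le_lt_trans (nrm_coord _ _ _) _; apply: lt_le_trans wp pb.
have exact_s v (w : 'rV[C]_n) : nrm (v - cmap c u0) < p -> nrm w < p ->
    w *m K v = s (row_mx v w).
  move=> vp wp.
  have va : nrm (v - cmap c u0) < a by apply: lt_le_trans vp _; rewrite ge_min lexx.
  have ex j : forall w : 'rV[C]_n, nrm w < p -> exists k : 'rV[int]_(n + n),
      w *m K v - s (row_mx v w) = map_mx intr (((2 ^+ j)%:Z) *: k) *m Z0 v.
    elim: j => [|j IH] w' w'p.
      have [[k kE] _] := Hb _ (near_y v w' vp w'p).
      by exists k; rewrite row_mxKl row_mxKr in kE; rewrite expr0 scale1r.
    pose h := (2^-1 : C) *: w'.
    have nh : nrm h = 2^-1 * nrm w'.
      by rewrite nrmZ -(crn 2) -crV nrm_cr ger0_norm // invr_ge0.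
    have hp : nrm h < p by rewrite nh; have := nrm_ge0 w'; lra.
    have [k kE] := IH h hp; exists k.
    have [[k' kE'] [_ sw]] := Hb _ (near_y v w' vp w'p).
    have [_ [_ sh]] := Hb _ (near_y v h vp hp).
    rewrite row_mxKl row_mxKr -/(K v) in kE'.
    rewrite kE'; congr (map_mx _ _ *m _).
    pose z := (2 ^+ j.+1)%:Z *: k - k'.
    suff z0 : z = 0 by apply/esym/subr0_eq.
    apply: (Hd (Z0 v)); first exact: Ha.
    have -> : map_mx intr z *m Z0 v = s (row_mx v w') - 2 *: s (row_mx v h).
      have -> : map_mx intr z = 2 *: map_mx intr ((2 ^+ j)%:Z *: k) - map_mx intr k' :> 'rV[C]_(n + n).
        apply/rowP => i; rewrite !mxE intrB !intrM; congr (_ - _).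
        by rewrite mulrA exprS PoszM intrM.
      rewrite mulmxBl -scalemxAl -kE -kE' /h scalerBr -scalemxAl scalerA divff ?scale1r ?pnatr_eq0 //.
      by rewrite opprB addrC addrA subrK.
    apply: le_lt_trans (nrmBD _ _) _.
    have -> : nrm (2 *: s (row_mx v h)) = 2 * nrm (s (row_mx v h)).
      by rewrite nrmZ -(crn 2) nrm_cr ger0_norm.
    lra.
  have [[k kE] _] := Hb _ (near_y v w vp wp).
  rewrite row_mxKl row_mxKr -/(K v) in kE.
  suff k0 : k = 0 by apply/subr0_eq; rewrite kE k0 map_mx0 mul0mx.
  have rZv : forall z : 'rV[int]_(n + n), map_mx intr z *m Z0 v = 0 -> z = 0.
    by move=> z zZ; apply: (Hd (Z0 v)); [exact: Ha|rewrite zZ nrm0].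
  apply/rowP => i; rewrite mxE; apply/eqP/negPn/negP => ki.
  have [k' k'E] := ex (absz (k 0 i)) w wp.
  have kk : k = (2 ^+ (absz (k 0 i)))%:Z *: k'.
    apply/subr0_eq/rZv; rewrite map_mxB mulmxBl -kE k'E subrr //.
  have : (2 ^ (absz (k 0%R i)) %| absz (k 0%R i))%N.
    by rewrite {2}kk mxE abszM dvdn_mulr // abszX.
  move=> /dvdn_leq; rewrite lt0n absz_eq0 ki => /(_ isT).
  by rewrite leqNgt ltn_expl.
have cK : {for cmap c u0, continuous K}.
  apply: (@cvg_mx R _ (nbhs (cmap c u0)) _ n n K (K (cmap c u0))) => i j.
  pose w : 'rV[C]_n := cr (p / 2) *: delta_mx 0 i.
  have p2 : 0 < p / 2 by rewrite divr_gt0.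
  have wp : nrm w < p.
    rewrite nrmZ nrm_cr gtr0_norm //.
    have : nrm (delta_mx 0 i : 'rV[C]_n) <= 1.
      apply: nrm_mx_le => // x y; rewrite mxE; case: (_ && _).
        by rewrite -[true%:R]cr1 nrm_cr normr1.
      by rewrite nrm0.
    move=> h; have : p / 2 * nrm (delta_mx 0 i : 'rV[C]_n) <= p / 2 * 1 by rewrite ler_pM2l.
    lra.
  have [_ [hsw _]] := Hb _ (near_y (cmap c u0) w (ltac:(by rewrite subrr nrm0)) wp).
  have hv : holomorphic_at (fun v : 'rV[C]_m => row_mx v w) (cmap c u0).
    by apply: hol_row_mx; [exact: hol_rV_id|exact: hol_cst_mx].
  have hsv := @hol_comp_mx R _ _ _ _ (fun v : 'rV[C]_m => row_mx v w) s (cmap c u0) hv hsw.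
  have hij := holM (hol_cst (cr (p / 2))^-1 (cmap c u0)) (hol_coord 0 j hsv).
  have E v : nrm (v - cmap c u0) < p -> K v i j = (cr (p / 2))^-1 * s (row_mx v w) 0 j.
    move=> vp; rewrite -exact_s // /w -scalemxAl -rowE !mxE mulKf // cr_eq0 gt_eqF //.
  have ne : \forall v \near cmap c u0, (cr (p / 2))^-1 * s (row_mx v w) 0 j = K v i j.
    by apply/nbhs_nrmP; exists p => // v vp; rewrite E.
  have -> : K (cmap c u0) i j = (cr (p / 2))^-1 * s (row_mx (cmap c u0) w) 0 j.
    by rewrite E // subrr nrm0.
  exact: cvg_trans (near_eq_cvg ne) (hol_cont hij).
have cE : \forall u \near u0, K (cmap c u) = G1 u *m invmx (G0 u).
  have : \forall u \near u0, cdom c u by apply: open_nbhs_nbhs; split=> //; exact: cdom_open.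
  by apply: filterS => u cu; rewrite /K cmapK.
have cK2 : {for u0, continuous (fun u => K (cmap c u))}.
  exact: (continuous_comp (cmap_continuous cu0) cK).
apply: cvg_trans (near_eq_cvg cE) _.
by rewrite -(nbhs_singleton cE).
Qed.

End TwoFrames.
End Comparison.

Section FlatFrames.
Context {R : realType}.
Notation C := (Cx R).

Lemma map_cr_intr m n (k : 'M[int]_(m, n)) :
  map_mx cr (map_mx intr k : 'M[R]_(m, n)) = map_mx intr k :> 'M[C]_(m, n).
Proof. by apply/matrixP => i j; rewrite !mxE; exact: (rmorph_int (real_complex R)). Qed.

Lemma int_mx_unit m n (k : 'M[int]_m) (Z : 'M[C]_(m, n)) :
  (forall a : 'rV[R]_m, map_mx cr a *m (map_mx intr k *m Z) = 0 -> a = 0) ->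
  (map_mx intr k : 'M[C]_m) \in unitmx.
Proof.
move=> H.
have kR : (map_mx intr k : 'M[R]_m) \in unitmx.
  rewrite -row_free_unit; apply/inj_row_free => a ak; apply: H.
  have -> : map_mx intr k = map_mx cr (map_mx intr k : 'M[R]_m) :> 'M[C]_m.
    exact: esym (map_cr_intr k).
  have e1 : map_mx cr a *m map_mx cr (map_mx intr k : 'M[R]_m) = 0 :> 'M[C]_(1, m).
    have e2 := map_mxM (real_complex R) a (map_mx intr k : 'M[R]_m).
    rewrite ak map_mx0 in e2; exact: esym e2.
  by rewrite mulmxA e1 mul0mx.
rewrite -map_cr_intr; have := map_unitmx (real_complex R) (map_mx intr k : 'M[R]_m).
by move=> E; exact: etrans E kR.
Qed.

Lemma lattice_int n m (Lam : set 'rV[C]_n) (B : 'M[C]_(n + n, n)) (D : 'M[C]_(m, n)) :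
  lattice_basis Lam B -> (forall i, Lam (row i D)) ->
  exists k : 'M[int]_(m, n + n), D = map_mx intr k *m B.
Proof.
move=> [_ E] H.
have H' i : exists k : 'rV[int]_(n + n), row i D = map_mx intr k *m B.
  by have := H i; rewrite E => -[k _ kE]; exists k.
have [k kE] := choice H'; exists (\matrix_i k i).
apply/row_matrixP => i; rewrite row_mul kE; congr (_ *m _).
by apply/rowP => j; rewrite !mxE.
Qed.

Lemma lattice_row n (Lam : set 'rV[C]_n) (B : 'M[C]_(n + n, n)) i :
  lattice_basis Lam B -> Lam (row i B).
Proof.
move=> [_ ->]; exists (delta_mx 0 i) => //=.
by rewrite map_delta_mx -rowE.
Qed.

Variables (m n : nat) (M : cmanifold R m) (X : torus_family M n).
Notation unifX := (@unif R m M n X).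

Lemma flat_frame_int (U : set M) (B : M -> 'M[C]_(n + n, n)) (u0 : M) (W0 : set M)
    (G0 : M -> 'M[C]_n) (B0 : M -> 'M[C]_(n + n, n)) :
  flat_frame X U B -> U u0 -> open W0 -> W0 u0 -> holo_frame unifX W0 G0 ->
  (forall u, W0 u -> lattice_basis (periods (unifX u)) (B0 u)) ->
  holo_from W0 (fun u => B0 u *m invmx (G0 u)) ->
  exists2 k : 'M[int]_(n + n), (map_mx intr k : 'M[C]_(n + n)) \in unitmx &
    \forall u \near u0, U u /\ W0 u /\ B u = map_mx intr k *m B0 u.
Proof.
move=> [oU lB /(_ u0)fB] Uu0 oW0 W0u hF0 lB0 hZ0.
have [W1 [G1 [[oW1 W1u] hF1 cB]]] := fB Uu0.
have [c cu0] := cdom_cover u0.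
have NU : \forall u \near u0, U u by exact: open_nbhs_nbhs.
have NW0 : \forall u \near u0, W0 u by exact: open_nbhs_nbhs.
have NW1 : \forall u \near u0, W1 u by exact: open_nbhs_nbhs.
have Nc : \forall u \near u0, cdom c u by apply: open_nbhs_nbhs; split=> //; exact: cdom_open.
have [uG0 _] := hF0; have [uG1 _] := hF1.
have H u : exists k : 'M[int]_(n + n), U u -> W0 u -> B u = map_mx intr k *m B0 u.
  have [[Uu Wu]|nUW] := pselect (U u /\ W0 u).
    have [k kE] := lattice_int (lB0 u Wu) (fun i => lattice_row i (lB u Uu)).
    by exists k.
  by exists 0 => Uu Wu; exfalso; apply: nUW.
have [k kE] := choice H.
exists (k u0).
  apply: (@int_mx_unit _ n (k u0) (B0 u0)) => a.
  by rewrite -kE //; exact: (lB _ Uu0).1.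
pose Z0 u := B0 u *m invmx (G0 u).
have cZ0 : {for u0, continuous Z0}.
  have c1 : {for cmap c u0, continuous (fun v => Z0 (cinv c v))} by exact: (ref_cont (c := c) cu0 W0u hZ0).
  have c2 : {for u0, continuous (fun u => Z0 (cinv c (cmap c u)))}.
    exact: (continuous_comp (cmap_continuous cu0) c1).
  have ne : \forall u \near u0, Z0 (cinv c (cmap c u)) = Z0 u.
    by apply: filterS Nc => u cu; rewrite cmapK.
  by apply: cvg_trans (near_eq_cvg ne) _; rewrite -(nbhs_singleton ne).
have cT := transition_cont cu0 oW0 W0u W1u hF0 hF1 lB0 hZ0.
have cB0 : {for u0, continuous (fun u => B u *m invmx (G0 u))}.
  have ne : \forall u \near u0, (B u *m invmx (G1 u)) *m (G1 u *m invmx (G0 u)) = B u *m invmx (G0 u).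
    by apply: filterS NW1 => u Wu; rewrite mulmxA mulmxKV ?uG1.
  apply: cvg_trans (near_eq_cvg ne) _; rewrite -(nbhs_singleton ne).
  exact: cvg_mulmx cB cT.
have [d d0 Hd] := rbasis_discrete (frame_rbasis hF0 lB0 W0u).
pose E (u : M) : 'M[C]_(n + n, n) := B u *m invmx (G0 u) - map_mx intr (k u0) *m Z0 u.
have cE : {for u0, continuous E}.
  have cK : (map_mx intr (k u0) : 'M[C]_(n + n)) @[_ --> u0] --> (map_mx intr (k u0) : 'M[C]_(n + n)).
    exact: cvg_cst.
  have cKZ := @cvg_mulmx R M (nbhs u0) (nbhs_filter u0) _ _ _ _ _ _ _ cK cZ0.
  exact: (@cvgB C _ M (nbhs u0) (nbhs_filter u0) _ _ _ _ cB0 cKZ).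
have E0 : E u0 = 0 by rewrite /E /Z0 (kE u0) // mulmxA subrr.
have NE : \forall u \near u0, nrm (E u) < d.
  have /continuous_nrmP/(_ _ d0) := cE.
  by apply: filterS => u; rewrite E0 subr0.
have NZ : \forall u \near u0, nrm (Z0 u - Z0 u0) < d.
  by have /continuous_nrmP/(_ _ d0) := cZ0.
apply: filterS2 (filterI NU NW0) (filterI NE NZ) => u [Uu Wu] [Eu Zu].
split=> //; split=> //; rewrite kE //; congr (map_mx _ _ *m _).
apply/row_matrixP => i; apply/eqP; rewrite -subr_eq0 -raddfB; apply/eqP.
apply: (Hd (Z0 u)) => //.
apply: le_lt_trans Eu.
have -> : map_mx intr (row i (k u - k u0)) *m Z0 u = row i (E u).
  rewrite /E (kE u) // -mulmxA -mulmxBl row_mul; congr (_ *m _).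
  by rewrite map_row; congr row; apply/matrixP => x y; rewrite !mxE intrB.
apply: nrm_mx_le; first exact: nrm_ge0.
by move=> x y; rewrite mxE; exact: nrm_coord.
Qed.

End FlatFrames.

(** * Split tori and the modulus *)

Section Splitting.
Context {R : realType}.
Notation C := (Cx R).

(* A vector w with w *m F = 0 would give infinitely many points of the kernel,
   the images of w / k. *)
Lemma finite_kernel_lift_unit n (S T : Type) (A : set S) (p : 'rV[C]_n -> S)
    (q : 'rV[C]_n -> T) (f : S -> T) (F : 'M[C]_n) :
  torus_cover A p -> lift_of p q f F ->
  finite_set [set x | A x /\ f x = q 0] -> F \in unitmx.
Proof.
move=> [rg pq [B [rB LB]]] lF fin.
rewrite -row_free_unit; apply/inj_row_free => w wF.
apply/eqP/negPn/negP => w0.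
have [d d0 Hd] := rbasis_discrete rB.
have nw : 0 < nrm w by rewrite nrm_gt0.
pose s : R := d / nrm w.
have s0 : 0 < s by rewrite divr_gt0.
pose c (k : nat) : R := s / k.+2%:R.
have c0 k : 0 < c k by rewrite divr_gt0 // ltr0n.
have cs k : c k < s.
  by rewrite /c ltr_pdivrMr ?ltr0n // ltr_pMr // ltr1n.
pose x k := p (cr (c k) *: w).
have xA k : [set y | A y /\ f y = q 0] (x k).
  split; first by rewrite -rg; exists (cr (c k) *: w).
  by rewrite /x lF -scalemxAl wF scaler0.
have xI j k : x j = x k -> j = k.
  move=> /pq; rewrite -scalerBl LB => -[m _ mE].
  have m0 : m = 0.
    apply: (Hd B); first by rewrite subrr nrm0.
    rewrite mE -crB nrmZ nrm_cr.
    have h : `|c k - c j| < s.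
      have := c0 j; have := c0 k; have := cs j; have := cs k => *.
      by rewrite ltr_norml; apply/andP; split; lra.
    by rewrite -ltr_pdivlMr.
  move: mE; rewrite m0 map_mx0 mul0mx => /esym/eqP.
  rewrite scaler_eq0 (negPf w0) orbF -crB cr_eq0 subr_eq0 => /eqP.
  rewrite /c => /(mulfI (lt0r_neq0 s0)) /invr_inj /eqP.
  by rewrite eqr_nat => /eqP [].
apply: infinite_nat.
have f1 : finite_set (range x) by apply: sub_finite_set fin => y [k _ <-]; exact: xA.
have : finite_set (x @^-1` range x) by apply: finite_preimage f1 => j k _ _; exact: xI.
by apply: sub_finite_set => k _ /=; exists k.
Qed.

Lemma factor_period_neq0 (Lam : set 'rV[C]_1) n (a b : 'rV[C]_n) i :
  lattice_basis Lam (col_mx (col i a) (col i b)) -> a 0 i != 0.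
Proof.
move=> [H _]; apply/eqP => ai.
have := H (row_mx 1%:M 0) => E.
have : row_mx (1%:M : 'M[R]_1) 0 = 0 :> 'rV[R]_(1 + 1).
  apply: E; rewrite map_row_mx mul_row_col map_mx0 mul0mx addr0.
  have -> : col i a = 0 by apply/matrixP => x y; rewrite !mxE !ord1.
  by rewrite mulmx0.
move=> /(congr1 lsubmx); rewrite row_mxKl linear0 => /matrixP/(_ 0 0)/eqP.
by rewrite !mxE eqxx oner_eq0.
Qed.

Lemma split_normal_form n (Z' : 'M[C]_(n + n, n)) (H : 'M[C]_n) (a b : 'rV[C]_n) :
  H \in unitmx -> (forall i, a 0 i != 0) ->
  Z' *m H = col_mx (diag_mx a) (diag_mx b) ->
  usubmx Z' \in unitmx /\
  exists t : 'rV[C]_n, dsubmx Z' = diag_mx t *m usubmx Z'.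
Proof.
move=> uH a0 E.
have Ea : usubmx Z' *m H = diag_mx a by rewrite mul_usub_mx E col_mxKu.
have Eb : dsubmx Z' *m H = diag_mx b by rewrite mul_dsub_mx E col_mxKd.
have ua : diag_mx a \in unitmx.
  rewrite unitmxE det_diag unitfE; apply/prodf_neq0 => i _; exact: a0.
split; first by have := unitmx_mul (usubmx Z') H; rewrite Ea ua uH andbT => <-.
exists (\row_i (b 0 i / a 0 i)).
have uHr := uH; apply: (can_inj (mulmxK uH)).
rewrite Eb -mulmxA Ea mulmx_diag; congr diag_mx.
by apply/rowP => i; rewrite !mxE divfK.
Qed.

Lemma split_lattice_unit n (B : 'M[C]_(n + n, n)) (F : 'M[C]_n) (N : 'M[int]_(n + n))
    (P : 'M[C]_(n + n, n)) :
  rbasis B -> F \in unitmx -> B *m F = map_mx intr N *m P ->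
  (map_mx intr N : 'M[C]_(n + n)) \in unitmx.
Proof.
move=> rB uF E; apply: (@int_mx_unit R _ n N P) => a.
rewrite -E mulmxA => /(congr1 (mulmx^~ (invmx F))).
by rewrite mulmxK // mul0mx; exact: rB.
Qed.

End Splitting.

Section Ratio.
Context {R : realType}.
Notation C := (Cx R).

Lemma near_neq0 (T : topologicalType) (f : T -> C) (x : T) :
  {for x, continuous f} -> f x != 0 -> \forall y \near x, f y != 0.
Proof.
move=> /continuous_nrmP/(_ (nrm (f x))); rewrite nrm_gt0 => H fx.
apply: filterS (H fx) => y; apply: contraTneq => ->.
by rewrite sub0r nrmN ltxx.
Qed.

Variables (r : nat) (v0 : 'rV[C]_r) (p q : 'rV[C]_r -> 'rV[C]_r)
  (s1 s2 : 'rV[C]_r -> C) (b : 'rV[C]_r -> 'I_r -> C) (K : 'rV[C]_r -> 'M[C]_r).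
Hypothesis hp : \forall v \near v0, holomorphic_at p v.
Hypothesis hq : \forall v \near v0, holomorphic_at q v.
Hypothesis hs1 : \forall v \near v0, holomorphic_at s1 v.
Hypothesis p0 : \forall v \near v0, p v != 0.
Hypothesis pq : \forall v \near v0, exists t : C, q v = t *: p v.
Hypothesis s1E : forall v, s1 v = \sum_j b v j * p v 0 j.
Hypothesis s2E : forall v, s2 v = \sum_j b v j * q v 0 j.
Hypothesis ds1 : \forall v \near v0, forall i, 'd s1 v (delta_mx 0 i) = \sum_j K v i j * p v 0 j.
Hypothesis ds2 : \forall v \near v0, forall i, 'd s2 v (delta_mx 0 i) = \sum_j K v i j * q v 0 j.
Hypothesis uK : \forall v \near v0, K v \in unitmx.

(* Differentiating s2 = t * s1 gives s1 * dt = 0, and s1 vanishes on no open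
   set because ds1 does not. *)
Lemma period_ratio_const : exists T : C, \forall v \near v0, q v = T *: p v.
Proof.
have [j0 pj0] : exists j, p v0 0 j != 0.
  apply: contrapT => H; move/eqP: (nbhs_singleton p0); apply.
  by apply/rowP => j; rewrite mxE; apply/eqP/negPn/negP => h; apply: H; exists j.
have hpj : holomorphic_at (fun v => p v 0 j0 : C) v0 by apply: hol_coord; exact: nbhs_singleton hp.
have pj : \forall v \near v0, p v 0 j0 != 0 by exact: near_neq0 (hol_cont hpj) pj0.
pose t v : C := q v 0 j0 * (p v 0 j0)^-1.
have qE : \forall v \near v0, q v = t v *: p v.
  apply: filterS2 pj pq => v pv [k qk]; rewrite [LHS]qk; congr (_ *: _).
  by rewrite /t qk mxE mulfK.
have ht : \forall v \near v0, holomorphic_at t v.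
  apply: filterS3 pj hp hq => v pv hpv hqv.
  exact: (holM (hol_coord 0 j0 hqv) (holV (hol_coord 0 j0 hpv) pv)).
pose good v := [/\ holomorphic_at t v, holomorphic_at s1 v, q v = t v *: p v, p v != 0
  & [/\ forall i, 'd s1 v (delta_mx 0 i) = \sum_j K v i j * p v 0 j,
     forall i, 'd s2 v (delta_mx 0 i) = \sum_j K v i j * q v 0 j & K v \in unitmx]].
have aux (a c d e : C) : c = e * d -> a * c = e * (a * d) by move=> ->; ring.
have qj v j : good v -> q v 0 j = t v * p v 0 j.
  by move=> [_ _ qv _ _]; apply: (etrans (congr1 (fun z : 'rV[C]_r => z 0 j) qv)); rewrite mxE.
have Ng : \forall v \near v0, good v.
  apply: filterS3 (filterI ht (filterI hs1 (filterI qE p0))) (filterI ds1 ds2) uK => v [h1 [h2 [h3 h4]]] [h5 h6] h7.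
  by split.
have dt0 : \forall v \near v0, differentiable t v /\ forall w, 'd t v w = 0 :> C.
  apply: filterS (near_join Ng) => v Nv.
  have [htv hsv _ pv [dsv _ uKv]] := nbhs_singleton Nv.
  split; first exact: hol_diff.
  move=> w; apply/eqP/negPn/negP => tw.
  have Nt : \forall y \near v, ('d t y w : C) != 0.
    have cdt : {for v, continuous (fun y => 'd t y w : C)} by exact: hol_cont (hol_deriv w htv).
    exact: near_neq0 cdt tw.
  have Ns : \forall y \near v, s1 y = 0.
    apply: filterS2 Nt (near_join Nv) => y ty Ny.
    have [hty hsy _ _ [d1 d2 _]] := nbhs_singleton Ny.
    have E1 : 'd s2 y w = t y * ('d s1 y w : C).
      have E2 i : 'd s2 y (delta_mx 0 i) = t y * ('d s1 y (delta_mx 0 i) : C).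
        apply: (etrans (d2 i)); apply: etrans (congr1 (fun z : C => t y * z) (esym (d1 i))).
        rewrite mulr_sumr; apply: eq_bigr => j _.
        exact: (aux _ _ _ _ (qj y j (nbhs_singleton Ny))).
      apply: (etrans (diff_rVM s2 y w)).
      apply: etrans (congr1 (fun z : C => t y * z) (esym (diff_rVM s1 y w))).
      rewrite mulr_sumr; apply: eq_bigr => i _.
      exact: (aux _ _ _ _ (E2 i)).
    have ne : \forall z \near y, t z * s1 z = s2 z.
      apply: filterS Ny => z qz; rewrite s1E s2E mulr_sumr; apply: eq_bigr => j _.
      exact: (esym (aux _ _ _ _ (qj z j qz))).
    have [_ e2] := diff_near_eq ne (hol_diff (holM hty hsy)).
    have e3 := etrans (congr1 (fun h => h w) e2) (diffME w hty hsy).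
    have aux' (a c d : C) : a = a + d * c -> c != 0 -> d = 0.
      move=> H c0; have : d * c = 0 by apply: (addrI a); rewrite -H addr0.
      by move=> /eqP; rewrite mulf_eq0 (negPf c0) orbF => /eqP.
    exact: (aux' _ _ _ (etrans (esym E1) e3) ty).
  have ds0 u : 'd s1 v u = 0 :> C.
    have ne : \forall y \near v, s1 y = (fun=> 0 : C) y by exact: Ns.
    have [_ e1] := diff_near_eq ne (hol_diff hsv).
    apply: (etrans (esym (congr1 (fun h => h u) e1))); exact: diff_cstE.
  move/eqP: pv; apply.
  have Kp : K v *m (p v)^T = 0.
    apply/colP => i; rewrite mxE [RHS]mxE; apply: etrans (ds0 (delta_mx 0 i)).
    rewrite dsv; apply: eq_bigr => j _; congr (_ * _); by rewrite mxE.
  have : (p v)^T = 0 by rewrite -(mulKmx uKv (p v)^T) Kp mulmx0.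
  by move=> /(congr1 trmx); rewrite trmxK trmx0.
exists (t v0); apply: filterS2 qE (diff0_near_const dt0) => v qv tv.
by rewrite qv tv.
Qed.

End Ratio.

Section LocalSplitting.
Context {R : realType}.
Notation C := (Cx R).
Variables (r : nat) (M : cmanifold R r) (X : SK_geometry M).
Notation unifX := (@unif R r M r X).
Hypothesis scaleX : scale_invariant X.
Variables (u0 : M) (c : chart M) (W : set M) (G : M -> 'M[C]_r)
  (B : M -> 'M[C]_(r + r, r)).
Hypothesis cu0 : cdom c u0.
Hypothesis oW : open W.
Hypothesis Wu0 : W u0.
Hypothesis hF : holo_frame unifX W G.
Hypothesis lB : forall u, W u -> lattice_basis (periods (unifX u)) (B u).
Hypothesis hZ : holo_from W (fun u => B u *m invmx (G u)).
Notation Z := (fun v => B (cinv c v) *m invmx (G (cinv c v))).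
Notation v0 := (cmap c u0).

Lemma period_relation_const (m1 m2 : 'rV[C]_(r + r)) :
  (\forall v \near v0, m1 *m Z v != 0) ->
  (\forall v \near v0, exists t : C, m2 *m Z v = t *: (m1 *m Z v)) ->
  exists T : C, \forall v \near v0, m2 *m Z v = T *: (m1 *m Z v).
Proof.
move=> n1 n2.
have [dom [act [actX [_ Hs _ _ _]]]] := scaleX.
have [U [e [[oU Uu0] e0 _ _ [_ _ hA hA1 hS]]]] := Hs u0.
pose D := base_dom U c W.
have D0 : \forall v \near v0, D v by exact: base_dom_nbhs.
have hZD u : D u -> holomorphic_at Z u.
  by move=> [x [cx [Wx _]] <-]; exact: hZ.
have inW u : D u -> W (cinv c u) by move=> [x [cx [Wx _]] <-]; rewrite cmapK.
have rZ u : D u -> rbasis (Z u).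
  by move=> Du; exact: (frame_rbasis hF lB (inW u Du)).
have heta y : D (lsubmx y) -> holomorphic_at (eta_frame actX c G) y.
  exact: (eta_frame_hol e0 oU hA hA1 oW hF).
have deta (y : 'rV[C]_(r + r)) : D (lsubmx y) -> forall i j : 'I_(r + r),
    ('d (eta_frame actX c G) y (delta_mx 0 i)) 0 j - ('d (eta_frame actX c G) y (delta_mx 0 j)) 0 i =
    form_frame X c G y i j.
  exact: (eta_frame_diff e0 oU hA hA1 hS oW hF).
have uS (y : 'rV[C]_(r + r)) : D (lsubmx y) -> form_frame X c G y \in unitmx.
  exact: (form_frame_unit hF).
have teta a (y v : 'rV[C]_(r + r)) (Dy : D (lsubmx y)) :
    \sum_j eta_frame actX c G y 0 j * v 0 j =
    \sum_j eta_frame actX c G (row_mx (lsubmx y) (rsubmx y + row a (Z (lsubmx y)))) 0 j *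
      row_mx (lsubmx v) (rsubmx v + row a ('d Z (lsubmx y) (lsubmx v))) 0 j.
  apply: (@eta_frame_period R r M X actX U c W G hF Z y v a Dy (hZD _ Dy)).
  have [x [cx [Wx Ux]] xy] := Dy; rewrite -xy.
  apply: filterS (base_dom_nbhs oU oW cx Wx Ux) => u Du.
  have Wu := inW u Du; have [uG _] := hF.
  rewrite row_mul mulmxKV ?uG //; exact: lattice_row (lB Wu).
have hp (m : 'rV[C]_(r + r)) : \forall v \near v0, holomorphic_at (fun v => m *m Z v) v.
  apply: filterS D0 => v Dv.
  exact: (hol_mulmx (hol_cst_mx m v) (hZD v Dv)).
apply: (@period_ratio_const R r v0 (fun v => m1 *m Z v) (fun v => m2 *m Z v)
  (period_comb Z (eta_frame actX c G) m1) (period_comb Z (eta_frame actX c G) m2)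
  (base_form (eta_frame actX c G)) (mixed (form_frame X c G)) (hp m1) (hp m2) _ n1 n2).
- by apply: filterS D0 => v Dv; exact: (period_comb_hol hZD heta m1 Dv).
- by [].
- by [].
- by apply: filterS D0 => v Dv i; exact: (period_comb_diff hZD rZ heta deta teta m1 i Dv).
- by apply: filterS D0 => v Dv i; exact: (period_comb_diff hZD rZ heta deta teta m2 i Dv).
- by apply: filterS D0 => v Dv; exact: (mixed_unit rZ heta deta uS teta Dv).
Qed.

Lemma split_frame_const (T : M -> Type) (q : forall u, 'rV[C]_r -> T u)
    (f : forall u, X -> T u) (U : set M) (D : M -> 'M[C]_(r + r, r)) (F : M -> 'M[C]_r)
    (a b : M -> 'rV[C]_r) (N : 'M[int]_(r + r)) :
  U u0 -> flat_frame X U D ->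
  (forall u, U u -> lift_of (unifX u) (q u) (f u) (F u)) ->
  (forall u, U u -> finite_set [set x | (@Defs.proj R r M r X @^-1` [set u]) x /\ f u x = q u 0]) ->
  (forall u i, U u -> a u 0 i != 0) ->
  (forall u, U u -> D u *m F u = map_mx intr N *m col_mx (diag_mx (a u)) (diag_mx (b u))) ->
  exists (M0 : 'M[C]_(r + r)) (t : 'rV[C]_r), M0 \in unitmx /\
    \forall v \near v0, usubmx (M0 *m Z v) \in unitmx /\
      dsubmx (M0 *m Z v) = diag_mx t *m usubmx (M0 *m Z v).
Proof.
move=> Uu0 fD lF fin a0 DF.
have [k uk Nk] := flat_frame_int fD Uu0 oW Wu0 hF lB hZ.
have [uG _] := hF.
have uF u : U u -> F u \in unitmx.
  by move=> Uu; exact: (finite_kernel_lift_unit (@fibre_torus R r M r X u) (lF u Uu) (fin u Uu)).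
have uN : (map_mx intr N : 'M[C]_(r + r)) \in unitmx.
  have [_ lD _] := fD.
  exact: (split_lattice_unit (lD _ Uu0).1 (uF _ Uu0) (DF _ Uu0)).
pose M0 : 'M[C]_(r + r) := invmx (map_mx intr N) *m map_mx intr k.
have uM0 : M0 \in unitmx by rewrite unitmx_mul unitmx_inv uN uk.
exists M0.
have Nk' : \forall v \near v0, U (cinv c v) /\ W (cinv c v) /\
    D (cinv c v) = map_mx intr k *m B (cinv c v).
  have N0 : nbhs (cinv c v0) [set u | U u /\ W u /\ D u = map_mx intr k *m B u] by rewrite cmapK.
  exact: (cinv_continuous cu0 N0).
have nf : \forall v \near v0, usubmx (M0 *m Z v) \in unitmx /\
    exists t : 'rV[C]_r, dsubmx (M0 *m Z v) = diag_mx t *m usubmx (M0 *m Z v).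
  apply: filterS Nk' => v [Uv [Wv Dv]].
  apply: (@split_normal_form R r _ (G (cinv c v) *m F (cinv c v)) (a (cinv c v)) (b (cinv c v))).
  - by rewrite unitmx_mul uG ?uF.
  - by move=> i; exact: a0.
  rewrite !mulmxA mulmxKV ?uG // -[X in X *m F _]mulmxA.
  by rewrite -Dv -mulmxA DF // mulKmx.
have rowu v i : row (lshift r i) M0 *m Z v = row i (usubmx (M0 *m Z v)).
  by rewrite -row_mul; apply/rowP => j; rewrite !mxE.
have rowd v i : row (rshift r i) M0 *m Z v = row i (dsubmx (M0 *m Z v)).
  by rewrite -row_mul; apply/rowP => j; rewrite !mxE.
have H i : exists t : C, \forall v \near v0,
    row (rshift r i) M0 *m Z v = t *: (row (lshift r i) M0 *m Z v).
  apply: period_relation_const; apply: filterS nf => v [uV [t tE]].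
    rewrite rowu; apply/eqP => z.
    have : delta_mx 0 i = 0 :> 'rV[C]_r by rewrite -(mulmxK uV (delta_mx 0 i)) -rowE z mul0mx.
    by move=> /rowP/(_ i)/eqP; rewrite !mxE !eqxx oner_eq0.
  exists (t 0 i); rewrite rowu rowd tE.
  by apply/rowP => j; rewrite mxE mul_diag_mx !mxE.
have [t tE] := choice H; exists (\row_i t i); split=> //.
have tE' : \forall v \near v0, forall i,
    row (rshift r i) M0 *m Z v = t i *: (row (lshift r i) M0 *m Z v).
  exact: filter_forall tE.
apply: filterS2 nf tE' => v [uV _] tv; split=> //.
apply/row_matrixP => i; rewrite -rowd tv rowu.
by apply/rowP => j; rewrite [RHS]mxE mul_diag_mx !mxE.
Qed.

End LocalSplitting.

Section HolomorphicInverse.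
Context {R : realType}.
Notation C := (Cx R).

Lemma hol_det (V : normedModType C) n (F : V -> 'M[C]_n) x :
  (forall i j, holomorphic_at (fun y => F y i j : C) x) ->
  holomorphic_at (fun y => \det (F y) : C) x.
Proof.
move=> hF; rewrite /determinant.
apply: (@hol_sum R V _ _ _ (fun (s : 'S_n) y => (-1) ^+ odd_perm s * \prod_i F y i (s i) : C)) => s _.
apply: (holM (hol_cst ((-1) ^+ (odd_perm s)) x)).
by apply: (@hol_prod R V _ _ _ (fun i y => F y i (s i))) => i _; exact: hF.
Qed.

Lemma hol_invmx (V : normedModType C) n (F : V -> 'M[C]_n) x :
  holomorphic_at F x -> F x \in unitmx -> holomorphic_at (fun y => invmx (F y)) x.
Proof.
move=> hF ux.
have hdet : holomorphic_at (fun y => \det (F y) : C) x.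
  by apply: hol_det => i j; exact: hol_coord.
have d0 : \det (F x) != 0 by rewrite -unitfE -unitmxE.
have dn := near_neq0 (hol_cont hdet) d0.
apply: hol_mx => i j.
have hc : holomorphic_at (fun y => (\det (F y))^-1 * cofactor (F y) j i : C) x.
  apply: (holM (holV hdet d0)); rewrite /cofactor.
  apply: (holM (hol_cst _ x)); apply: hol_det => a b.
  have -> : (fun y => row' j (col' i (F y)) a b) = (fun y => F y (lift j a) (lift i b)).
    by apply/funext => y; rewrite !mxE.
  exact: hol_coord.
apply: hol_near_eq hc; apply: filterS dn => y dy.
by rewrite /invmx unitmxE unitfE dy !mxE.
Qed.

Lemma hol_submx (V : normedModType C) m n p q (f : 'I_p -> 'I_m) (g : 'I_q -> 'I_n)
    (F : V -> 'M[C]_(m, n)) x :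
  holomorphic_at F x -> holomorphic_at (fun y => \matrix_(i, j) F y (f i) (g j) : 'M[C]_(p, q)) x.
Proof.
move=> hF; apply: hol_mx => i j.
have -> : (fun y => (\matrix_(i, j) F y (f i) (g j)) i j) = (fun y => F y (f i) (g j)).
  by apply/funext => y; rewrite !mxE.
exact: hol_coord.
Qed.

Lemma diff0_adherent n (phi : 'rV[C]_n -> C) v w : holomorphic_at phi v ->
  (forall Q, nbhs v Q -> exists y, Q y /\ 'd phi y w = 0 :> C) -> 'd phi v w = 0 :> C.
Proof.
move=> hv H; apply/eqP/negPn/negP => tw.
have cdt : {for v, continuous (fun y => 'd phi y w : C)} by exact: hol_cont (hol_deriv w hv).
have [y [Qy y0]] := H _ (near_neq0 cdt tw).
by move/eqP: Qy.
Qed.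

Lemma diff0_near_cst (V : normedModType C) (phi : V -> C) y w :
  (\forall z \near y, phi z = phi y) -> 'd phi y w = 0 :> C.
Proof.
move=> N.
have ne : \forall z \near y, (fun=> phi y) z = phi z by apply: filterS N => z ->.
have [_ e1] := diff_near_eq ne (hol_diff (hol_cst _ _)).
apply: (etrans (congr1 (fun h => h w) e1)); exact: diff_cstE.
Qed.

End HolomorphicInverse.

Section Modulus.
Context {R : realType}.
Notation C := (Cx R).

Definition tau_of n (d : 'I_n -> nat) (W : 'M[C]_(n + n, n)) : 'M[C]_n :=
  dsubmx W *m invmx (usubmx W) *m diag_mx (\row_i (d i)%:R).

Lemma modulus_tau_of n (d : 'I_n -> nat) (alpha beta tau : 'M[C]_n) :
  (forall i, 0 < d i)%N -> is_modulus d alpha beta tau ->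
  alpha \in unitmx /\ tau = tau_of d (col_mx alpha beta).
Proof.
move=> d0 [theta [ut aE bE]].
have uD : diag_mx (\row_i (d i)%:R : 'rV[C]_n) \in unitmx.
  rewrite unitmxE det_diag unitfE; apply/prodf_neq0 => i _.
  by rewrite mxE pnatr_eq0 -lt0n.
have ua : alpha \in unitmx.
  by have := unitmx_mul alpha theta; rewrite aE uD ut andbT => <-.
split=> //; rewrite /tau_of col_mxKu col_mxKd -aE -bE -mulmxA.
by rewrite mulKmx.
Qed.

Lemma tau_of_mulr n (d : 'I_n -> nat) (W : 'M[C]_(n + n, n)) (H : 'M[C]_n) :
  usubmx (W *m H) \in unitmx -> tau_of d (W *m H) = tau_of d W.
Proof.
rewrite -mul_usub_mx => uWH; have := uWH; rewrite unitmx_mul => /andP[uW uH].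
rewrite /tau_of -mul_usub_mx -mul_dsub_mx; congr (_ *m _).
by apply: (can_inj (mulmxK uWH)); rewrite mulmxKV // !mulmxA mulmxKV.
Qed.

Lemma tau_of_hol (V : normedModType C) n (d : 'I_n -> nat) (W : V -> 'M[C]_(n + n, n)) x :
  holomorphic_at W x -> usubmx (W x) \in unitmx -> holomorphic_at (fun y => tau_of d (W y)) x.
Proof.
move=> hW uW.
have hu := hol_submx (lshift n) id hW; have hd := hol_submx (@rshift n n) id hW.
have Eu : (fun y => \matrix_(i, j) W y (lshift n i) j : 'M[C]_n) = (fun y => usubmx (W y)).
  by apply/funext => y; apply/matrixP => i j; rewrite !mxE.
have Ed : (fun y => \matrix_(i, j) W y (rshift n i) j : 'M[C]_n) = (fun y => dsubmx (W y)).
  by apply/funext => y; apply/matrixP => i j; rewrite !mxE.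
have hu' : holomorphic_at (fun y => usubmx (W y)) x by rewrite -Eu.
have hd' : holomorphic_at (fun y => dsubmx (W y)) x by rewrite -Ed.
exact: (hol_mulmx (hol_mulmx hd' (hol_invmx hu' uW)) (hol_cst_mx _ x)).
Qed.

End Modulus.

Section Isotrivial.
Context {R : realType}.
Notation C := (Cx R).
Variables (r : nat) (M : cmanifold R r) (X : SK_geometry M).
Hypothesis scaleX : scale_invariant X.
Hypothesis splitX : completely_iso_split X.
Variables (U : set M) (d : 'I_r -> nat) (alpha beta tau : M -> 'M[C]_r).
Hypothesis d0 : forall i, (0 < d i)%N.
Hypothesis flat : flat_frame X U (fun u => col_mx (alpha u) (beta u)).
Hypothesis mod : forall u, U u -> is_modulus d (alpha u) (beta u) (tau u).

Section AtPoint.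
Variables (u0 : M) (c : chart M).
Hypothesis cu0 : cdom c u0.
Hypothesis Uu0 : U u0.
Notation v0 := (cmap c u0).

Lemma modulus_frame : exists (W : set M) (G : M -> 'M[C]_r) (B : M -> 'M[C]_(r + r, r))
    (k : 'M[C]_(r + r)),
  [/\ open W /\ W u0, holo_frame (@unif R r M r X) W G,
      forall u, W u -> lattice_basis (periods (@unif R r M r X u)) (B u),
      holo_from W (fun u => B u *m invmx (G u))
    & \forall v \near v0, usubmx (k *m (B (cinv c v) *m invmx (G (cinv c v)))) \in unitmx /\
        tau (cinv c v) = tau_of d (k *m (B (cinv c v) *m invmx (G (cinv c v))))].
Proof.
have [W [G [B [[oW Wu0] hF lB hZ]]]] := @family_local R r M r X u0.
have [k uk Nk] := flat_frame_int flat Uu0 oW Wu0 hF lB hZ.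
exists W, G, B, (map_mx intr k); split=> //.
have N0 : nbhs (cinv c v0) [set u | U u /\ W u /\
    col_mx (alpha u) (beta u) = map_mx intr k *m B u] by rewrite cmapK.
have N1 : \forall v \near v0, U (cinv c v) /\ W (cinv c v) /\
    col_mx (alpha (cinv c v)) (beta (cinv c v)) = map_mx intr k *m B (cinv c v).
  exact: (cinv_continuous cu0 N0).
apply: filterS N1 => v [Uv [Wv Ev]].
have [uG _] := hF; have uGv := uG _ Wv.
have [ua tE] := modulus_tau_of d0 (mod Uv).
set u := cinv c v in Uv Wv Ev uGv ua tE *.
have E : col_mx (alpha u) (beta u) = map_mx intr k *m (B u *m invmx (G u)) *m G u.
  by rewrite mulmxA mulmxKV.
have uE : usubmx (map_mx intr k *m (B u *m invmx (G u)) *m G u) \in unitmx.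
  by rewrite -E col_mxKu.
split; first by move: uE; rewrite -mul_usub_mx unitmx_mul => /andP[].
by rewrite tE E tau_of_mulr.
Qed.

Lemma modulus_hol i j : holomorphic_at (fun v => tau (cinv c v) i j : C) v0.
Proof.
have [W [G [B [k [[oW Wu0] hF lB hZ N]]]]] := modulus_frame.
have hZ0 := hZ _ Wu0 _ cu0.
have [uk _] := nbhs_singleton N.
have ht := tau_of_hol d (hol_mulmx (hol_cst_mx k v0) hZ0) uk.
apply: hol_near_eq (hol_coord i j ht).
by apply: filterS N => v [_ ->].
Qed.

End AtPoint.

Lemma modulus_split_const : exists Mo : set M, [/\ open Mo, dense Mo &
  forall u0 c, cdom c u0 -> Mo u0 -> U u0 ->
    \forall v \near cmap c u0, tau (cinv c v) = tau (cinv c (cmap c u0))].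
Proof.
have [Mo [E [f [oMo dMo iso loc]]]] := splitX; exists Mo; split=> // u0 c cu0 Mu0 Uu0.
have [W [G [B [k [[oW Wu0] hF lB hZ N]]]]] := modulus_frame cu0 Uu0.
have [U' [D [F [a [b [g [K [[U'u0 U'Mo] fD lF lE [_ _ DF]]]]]]]]] := loc _ Mu0.
have fin u : U' u -> finite_set [set x | (@Defs.proj R r M r X @^-1` [set u]) x /\ f u x = @prod_cover R r (E u) 0].
  by move=> /U'Mo/iso[].
have a0 u i : U' u -> a u 0 i != 0.
  by move=> U'u; exact: (factor_period_neq0 (lE u i U'u)).
have [M0 [t [uM0 Nt]]] :=
  split_frame_const scaleX cu0 oW Wu0 hF lB hZ U'u0 fD lF fin a0 DF.
pose K0 : 'M[C]_(r + r, r) := k *m invmx M0 *m col_mx 1%:M (diag_mx t).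
have NN : \forall v \near cmap c u0, tau (cinv c v) = tau_of d K0.
  apply: filterS2 N Nt => v [uk ->] [uV dV].
  set Z := B (cinv c v) *m invmx (G (cinv c v)) in uk uV dV *.
  have ZE : k *m Z = K0 *m usubmx (M0 *m Z).
    rewrite /K0 -!mulmxA mul_col_mx mul1mx -dV vsubmxK.
    by rewrite mulKmx.
  by rewrite ZE tau_of_mulr // -ZE.
have E0 := nbhs_singleton NN.
by apply: filterS NN => v Ev; exact: etrans Ev (esym E0).
Qed.

Lemma modulus_entry_diff0 c v i j w : cdom c (cinv c v) -> cmap c (cinv c v) = v ->
  U (cinv c v) -> 'd (fun v => tau (cinv c v) i j : C) v w = 0 :> C.
Proof.
move=> cv vE Uv; have [Mo [oMo dMo HMo]] := modulus_split_const.
have [oU _ _] := flat.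
have hv := modulus_hol cv Uv i j; rewrite vE in hv.
apply: (diff0_adherent hv) => Q NQ.
have NQ' : nbhs (cmap c (cinv c v)) Q by rewrite vE.
pose P := [set u | cdom c u /\ U u /\ Q (cmap c u)].
have NP : nbhs (cinv c v) P.
  have N1 : nbhs (cinv c v) (cdom c) by apply: open_nbhs_nbhs; split=> //; exact: cdom_open.
  have N2 : nbhs (cinv c v) U by exact: open_nbhs_nbhs.
  have N3 := cmap_continuous cv NQ'.
  by apply: filterS3 N1 N2 N3 => u h1 h2 h3; split.
have [u1 [Pu1 Mu1]] := dMo _ (ex_intro _ (cinv c v) NP) (@open_interior _ P).
have [cu1 [Uu1 Qu]] := interior_subset Pu1.
exists (cmap c u1); split=> //.
apply: diff0_near_cst.
have N1 := HMo _ _ cu1 Mu1 Uu1.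
by apply: filterS N1 => y ->.
Qed.

Lemma modulus_entry_const u0 c i j : cdom c u0 -> U u0 ->
  \forall v \near cmap c u0, tau (cinv c v) i j = tau (cinv c (cmap c u0)) i j.
Proof.
move=> cu0 Uu0; have [oU _ _] := flat.
have N0 : nbhs (cinv c (cmap c u0)) U by rewrite cmapK //; exact: open_nbhs_nbhs.
have NU : \forall v \near cmap c u0, U (cinv c v) by exact: (cinv_continuous cu0 N0).
apply: (@diff0_near_const R _ (fun v => tau (cinv c v) i j : C)).
apply: filterS2 NU (cinv_near cu0) => v Uv [cv vE]; split; last first.
  by move=> w; exact: modulus_entry_diff0.
have hv := modulus_hol cv Uv i j; rewrite vE in hv.
exact: hol_diff.
Qed.

Lemma modulus_locally_const u0 : U u0 -> \forall u \near u0, tau u = tau u0.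
Proof.
move=> Uu0; have [c cu0] := cdom_cover u0.
have H2 i : \forall v \near cmap c u0, forall j,
    tau (cinv c v) i j = tau (cinv c (cmap c u0)) i j.
  exact: filter_forall (fun j => modulus_entry_const i j cu0 Uu0).
have H1 : \forall v \near cmap c u0, tau (cinv c v) = tau u0.
  have H3 : \forall v \near cmap c u0, forall i j,
      tau (cinv c v) i j = tau (cinv c (cmap c u0)) i j by exact: filter_forall H2.
  by apply: filterS H3 => v H; apply/matrixP => i j; rewrite H cmapK.
have Nc : \forall u \near u0, cdom c u by apply: open_nbhs_nbhs; split=> //; exact: cdom_open.
have Nt : \forall u \near u0, tau (cinv c (cmap c u)) = tau u0.
  exact: (cmap_continuous cu0 H1).
by apply: filterS2 Nc Nt => u cu; rewrite cmapK.
Qed.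

End Isotrivial.

Lemma contractible_locally_const (R : realType) (T : topologicalType) (Y : Type) (A : set T)
    (g : T -> Y) :
  @contractible R T A -> (forall x, A x -> \forall y \near x, g y = g x) ->
  exists y0, forall x, A x -> g x = y0.
Proof.
move=> [a [H [Aa cH AH H0 H1]]] lc; exists (g a) => x Ax.
pose h (t : R) := g (H (x, t)).
pose I : set R := `[0, 1]%classic.
have lch t : I t -> \forall s \near t, I s -> h s = h t.
  move=> It; have /subspace_continuousP/(_ (x, t)) := cH.
  have hxt : (A `*` I) (x, t) by split.
  move=> /(_ hxt) ct.
  have Nt := ct _ (lc _ (AH _ _ Ax It)).
  have cx : {for t, continuous (fun s : R => (x, s))}.
    have c1 : (fun=> x) @ t --> x by exact: cvg_cst.
  have c2 : (fun s : R => s) @ t --> t by exact: cvg_id.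
  exact: (cvg_pair c1 c2).
  have Ns : \forall s \near t, (A `*` I) (x, s) -> g (H (x, s)) = g (H (x, t)).
    exact: (cx _ Nt).
  by apply: filterS Ns => s Hs Is; apply: Hs.
have I0 : I 0 by rewrite /I /= in_itv /= lexx ler01.
have I1 : I 1 by rewrite /I /= in_itv /= lexx ler01.
have S : [set t | I t /\ h t = h 0] = I.
  apply: (@segment_connected R 0 1).
  - by exists 0.
  - exists ([set t | I t -> h t = h 0]^°); first exact: open_interior.
    apply/seteqP; split=> t.
      move=> [It t0]; split=> //.
      by apply: filterS (lch t It) => s Hs /Hs ->.
    by move=> [It /interior_subset Ht]; split=> //; exact: Ht.
  - exists (~` [set t | I t -> h t <> h 0]^°).
      by apply: open_closedC; exact: open_interior.
    apply/seteqP; split=> t.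
      by move=> [It t0]; split=> // /interior_subset; apply.
    move=> [It nt]; split=> //; apply: contrapT => t0; apply: nt.
    by apply: filterS (lch t It) => s Hs /Hs ->.
have S1 : [set t | I t /\ h t = h 0] 1 by rewrite S.
by have [_ ] := S1; rewrite /h H0 // H1.
Qed.

Theorem mainTheorem3 (R : realType) (r : nat) (r_ge1 : (1 <= r)%N)
    (M : cmanifold R r) (M_connected : connected [set: M]%classic)
    (X : SK_geometry M) :
  scale_invariant X -> completely_iso_split X -> isotrivial X.
Proof.
move=> scaleX splitX U oU ctrU d alpha beta tau [d0 _] flat _ mod.
apply: contractible_locally_const ctrU _ => u Uu.
exact: (modulus_locally_const scaleX splitX d0 flat mod Uu).
Qed.
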